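(* Let $\gamma>0$ and $K\in\mathbb{T}^3$. The essential spectrum of the three-particle operator $H_\gamma(K)$ satisfies $$\sigma_{ess}(H_\gamma(K))=[\tau(K,\gamma),\,E_{\max}(K,\gamma)].$$
   Context: $\mathbb{T}^3=(-\pi,\pi]^3$ is the three-dimensional torus (addition modulo $(2\pi\mathbb{Z})^3$). Put $\varepsilon(p)=\sum_{i=1}^3(1-\cos p^{(i)})$, $\mu_0=(2\pi)^3\big(\int_{\mathbb{T}^3}\varepsilon(p)^{-1}dp\big)^{-1}$, $v(\gamma)=\mu_0(1+\gamma)$. Two-particle operator: for $k\in\mathbb{T}^3$, $\hbar_\gamma(k)$ acts on $L_2(\mathbb{T}^3)$ by $(\hbar_\gamma(k)f)(q)=\mathcal{E}_{k,\gamma}(q)f(q)-\frac{v(\gamma)}{(2\pi)^3}\int_{\mathbb{T}^3}f(q')dq'$, $\mathcal{E}_{k,\gamma}(q)=\varepsilon(q)+\gamma\varepsilon(k-q)$. For $k\ne0$, $z_\gamma(k)$ denotes its unique eigenvalue below the bottom $m(k,\gamma)=\min_p\mathcal{E}_{k,\gamma}(p)$ of its essential spectrum; $z_\gamma(0)=0$. Three-particle operator (two identical fermions and a boson, total quasi-momentum $K$): $H_\gamma(K)$ acts on the subspace $L_2^a((\mathbb{T}^3)^2)$ of antisymmetric functions, $f(p,q)=-f(q,p)$, of $L_2((\mathbb{T}^3)^2)$ by $$(H_\gamma(K)f)(p,q)=E(K,\gamma;p,q)f(p,q)-\frac{v(\gamma)}{(2\pi)^3}\int_{\mathbb{T}^3}f(p,q')dq'-\frac{v(\gamma)}{(2\pi)^3}\int_{\mathbb{T}^3}f(p',q)dp',$$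 $$E(K,\gamma;p,q)=\varepsilon(p)+\varepsilon(q)+\gamma\varepsilon(K-p-q).$$ $E_{\max}(K,\gamma)=\max_{p,q\in\mathbb{T}^3}E(K,\gamma;p,q)$ and $\tau(K,\gamma)=\inf_{p\in\mathbb{T}^3}\{z_\gamma(K-p)+\varepsilon(p)\}$. *)

(* Defs.v *)
From HB Require Import structures.
From mathcomp Require Import all_boot all_order all_algebra.
From mathcomp Require Import complex.
From mathcomp Require Import all_classical all_reals all_analysis.

Set Implicit Arguments.
Unset Strict Implicit.
Unset Printing Implicit Defensive.

Import Order.TTheory GRing.Theory Num.Theory.
Import numFieldNormedType.Exports.

Local Open Scope classical_set_scope.
Local Open Scope ring_scope.

(* Complex L_2 spaces. A vector of L_2(mu) is represented by a function        *)
(* T -> R[i] with square-integrable real and imaginary parts; two functions    *)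
(* that agree mu-almost everywhere represent the same vector, so every         *)
(* identity between vectors below is an a.e. identity.                         *)
Section ComplexL2.
Context d (T : measurableType d) (R : realType).
Variable mu : {measure set T -> \bar R}.

Definition cL2 : set (T -> R[i]) := [set f |
  (fun x => complex.Re (f x)) \in Lfun mu 2%:E /\
  (fun x => complex.Im (f x)) \in Lfun mu 2%:E].

Definition cL2norm (f : T -> R[i]) : R :=
  fine ('N[mu]_2%:E [EFin \o (fun x => Normc.normc (f x))])%E.

Definition cintegral (f : T -> R[i]) : R[i] :=
  Complex (\int[mu]_x complex.Re (f x)) (\int[mu]_x complex.Im (f x)).

(* Spectral notions for a bounded linear operator A on a closed subspace V of  *)
(* L_2(mu) that A maps into itself.                                            *)
Variables (V : set (T -> R[i])) (A : (T -> R[i]) -> T -> R[i]).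

(* A - z is onto V and bounded below, i.e. it is a bijection of V (modulo a.e. *)
(* equality) with bounded inverse.                                             *)
Definition resolvent_set : set R[i] := [set z |
  (forall g, V g ->
     exists2 f, V f & (fun x => A f x - z * f x) = g %[ae mu]) /\
  (exists C : R, forall f, V f ->
     cL2norm f <= C * cL2norm (fun x => A f x - z * f x))].

Definition spectrum : set R[i] := ~` resolvent_set.

Definition L2_eigenspace (z : R[i]) : set (T -> R[i]) :=
  [set f | V f /\ A f = (fun x => z * f x) %[ae mu]].

Definition is_eigenvalue (z : R[i]) : Prop :=
  exists2 f, L2_eigenspace z f & ~ f = (fun=> 0) %[ae mu].

Definition finite_multiplicity (z : R[i]) : Prop :=
  exists (n : nat) (e : 'I_n -> T -> R[i]), (forall i, L2_eigenspace z (e i)) /\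
    forall f, L2_eigenspace z f ->
      exists c : 'I_n -> R[i], f = (fun x => \sum_(i < n) c i * e i x) %[ae mu].

Definition isolated_in_spectrum (z : R[i]) : Prop :=
  spectrum z /\ exists2 r : R, 0 < r &
    forall w, spectrum w -> Normc.normc (w - z) < r -> w = z.

Definition discrete_spectrum : set R[i] := [set z |
  [/\ isolated_in_spectrum z, is_eigenvalue z & finite_multiplicity z]].

Definition essential_spectrum : set R[i] := spectrum `\` discrete_spectrum.

End ComplexL2.

(* The library makes product_measure1 canonically a finite (hence sigma-finite) *)
(* measure only for subprobabilities; iterating products needs an instance for *)
(* finite measures.                                                            *)
Section FiniteProduct.
Context d1 d2 (T1 : measurableType d1) (T2 : measurableType d2) (R : realType).
Variables (m1 : {finite_measure set T1 -> \bar R})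
          (m2 : {finite_measure set T2 -> \bar R}).

Definition finite_product : set (T1 * T2) -> \bar R := (m1 \x m2)%E.

HB.instance Definition _ := Measure.on finite_product.

Let finite_product_fin : fin_num_fun finite_product.
Proof.
have E : finite_product setT = (m1 setT * m2 setT)%E.
  by rewrite /finite_product -setXTT product_measure1E.
by apply: lty_fin_num_fun; rewrite [ltLHS]E lte_mul_pinfty// ?ltey_eq ?fin_num_measure.
Qed.

HB.instance Definition _ :=
  Measure_isFinite.Build _ _ _ finite_product finite_product_fin.

End FiniteProduct.

(* The torus is the box ]-pi, pi]^3 in R^3. Lebesgue measure on the circle is  *)
(* the restriction to ]-pi, pi] of Lebesgue measure on R, so functions on the  *)
(* torus are functions on R^3 taken modulo their values outside the box.       *)
(* Reduction modulo 2 pi is not performed on arguments such as k - q: they     *)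
(* only occur in 2 pi-periodic functions.                                      *)
Section Torus.
Variable R : realType.

Definition circle : set (measurableTypeR R) := `]- pi, pi].

Lemma measurable_circle : measurable circle.
Proof. exact: measurable_itv. Qed.

Lemma circle_fin : (@lebesgue_measure R circle < +oo)%E.
Proof. by rewrite lebesgue_measure_itv /=; case: ifP => // _; rewrite ltry. Qed.

Definition circle_measure : {finite_measure set (measurableTypeR R) -> \bar R} :=
  mfrestr measurable_circle circle_fin.

Local Notation R3 := (measurableTypeR R * measurableTypeR R * measurableTypeR R)%type.

Definition torus : set R3 := circle `*` circle `*` circle.

Definition torus_measure : {finite_measure set R3 -> \bar R} :=
  finite_product (finite_product circle_measure circle_measure) circle_measure.

Definition torus2_measure : {finite_measure set (R3 * R3)%type -> \bar R} :=
  finite_product torus_measure torus_measure.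

Definition in_2piZ (x : R) : Prop := exists n : int, x = 2 * pi * n%:~R.

End Torus.

Section Hamiltonians.
Variable R : realType.
Local Notation R3 := (measurableTypeR R * measurableTypeR R * measurableTypeR R)%type.
Local Notation mu3 := (torus_measure R).
Local Notation mu6 := (torus2_measure R).

Definition dispersion (p : R3) : R :=
  (1 - cos p.1.1) + (1 - cos p.1.2) + (1 - cos p.2).

Definition mu0 : R := (2 * pi) ^+ 3 * (\int[mu3]_p (dispersion p)^-1)^-1.

Definition coupling (gamma : R) : R := mu0 * (1 + gamma).

Definition energy2 (k : R3) (gamma : R) (q : R3) : R :=
  dispersion q + gamma * dispersion (k - q).

Definition h2 (gamma : R) (k : R3) (f : R3 -> R[i]) (q : R3) : R[i] :=
  (energy2 k gamma q)%:C%C * f q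
  - (coupling gamma / (2 * pi) ^+ 3)%:C%C * cintegral mu3 f.

(* The minimum is attained on the box because energy2 is continuous and         *)
(* 2 pi-periodic; likewise for energy3_max.                                    *)
Definition energy2_min (k : R3) (gamma : R) : R :=
  inf [set energy2 k gamma q | q in @torus R].

(* k = 0 is understood on the torus. For other k, z2 is the eigenvalue of      *)
(* h2 gamma k below energy2_min, selected by xget.                             *)
Definition z2 (gamma : R) (k : R3) : R :=
  if pselect [/\ in_2piZ k.1.1, in_2piZ k.1.2 & in_2piZ k.2] then 0
  else xget 0 [set z : R | z < energy2_min k gamma /\
                 is_eigenvalue mu3 (cL2 mu3) (h2 gamma k) z%:C%C].

Definition energy3 (K : R3) (gamma : R) (pq : R3 * R3) : R :=
  dispersion pq.1 + dispersion pq.2 + gamma * dispersion (K - pq.1 - pq.2).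

Definition cL2_antisym : set (R3 * R3 -> R[i]) := [set f |
  cL2 mu6 f /\ f = (fun pq => - f (pq.2, pq.1)) %[ae mu6]].

Definition H3 (gamma : R) (K : R3) (f : R3 * R3 -> R[i]) (pq : R3 * R3) : R[i] :=
  (energy3 K gamma pq)%:C%C * f pq
  - (coupling gamma / (2 * pi) ^+ 3)%:C%C * cintegral mu3 (fun q' => f (pq.1, q'))
  - (coupling gamma / (2 * pi) ^+ 3)%:C%C * cintegral mu3 (fun p' => f (p', pq.2)).

Definition essential_spectrum_H3 (gamma : R) (K : R3) : set R[i] :=
  essential_spectrum mu6 cL2_antisym (H3 gamma K).

Definition energy3_max (K : R3) (gamma : R) : R :=
  sup [set energy3 K gamma pq | pq in @torus R `*` @torus R].

Definition tau (K : R3) (gamma : R) : R :=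
  inf [set z2 gamma (K - p) + dispersion p | p in @torus R].

End Hamiltonians.

(* Main.v *)
From HB Require Import structures.
Require Import Defs.
From mathcomp Require Import all_boot all_order all_algebra.
From mathcomp Require Import complex.
From mathcomp Require Import lra ring.
From mathcomp Require Import all_classical all_reals all_analysis.
From mathcomp Require Import measurable_realfun.

Set Implicit Arguments.
Unset Strict Implicit.
Unset Printing Implicit Defensive.
Import Order.TTheory GRing.Theory Num.Theory.
Import numFieldNormedType.Exports.

Local Open Scope classical_set_scope.
Local Open Scope ring_scope.

(** Write [E] for the energy, [k] for the coupling constant and [F], [F2] for the
    marginals of a function [f] of [(p, q)]; then [H f = E f - k F(p) - k F2(q)].
    The theorem is of HVZ type: the essential spectrum is the set of energies at
    which a fermion can move freely away from a bound pair, from [tau] on, or at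
    which all three particles are free, between the minimum and the maximum
    of [E].

    Everything is decided by the pair integral
    [k * \int (E(p, q) - w)^-1 dq], which increases with [w] below the minimum
    of [E]. The pair operator [h2] has the eigenvalue [z] exactly when its
    integral is [1] ([eigenvalue_h2]). The constant [mu0] makes the integral
    equal to [1] at zero quasi-momentum and threshold; for other quasi-momenta
    the pair energy is flatter, which makes the integral exceed [1] at the
    threshold, so that the eigenvalue exists ([bound_state_exists]). Hence
    [z2 (K - p) + dispersion p] is the energy at which the pair integral passes
    through [1] ([z2P]), and below [tau] the pair integral stays under [1] for
    all [p].

    Nothing below [tau] is essential. If [(H - w) f = g], dividing by [E - w] and
    integrating over [q] gives an equation for [F] whose factor
    [1 - k * \int (E(p, q) - w)^-1 dq] is bounded away from zero for [w] below
    [tau], and whose remaining coupling, to [F2], is compact since [E(p, _)]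
    ranges over a totally bounded family. So [f] is bounded by [g] and finitely
    many functionals of [f] ([faddeev_semi_fredholm]), and such a bound near [w]
    leaves only the resolvent set or an isolated eigenvalue of finite
    multiplicity ([semi_fredholm_not_essential]). Above the maximum of [E] the
    interaction, which is attractive, produces no spectrum
    ([bounded_below_above]), and nonreal points are in the resolvent set of any
    bounded symmetric operator ([nonreal_resolvent]).

    Conversely, for [w] between [tau] and the minimum of [E] the pair integral is
    [1] at some [p], by the intermediate value theorem, and the bound pair
    together with a fermion localized near [p] gives approximate eigenvectors
    ([weyl_bound_state]). For [w] between the minimum and the maximum of [E] both
    fermions are localized near a point where [E] is [w] ([weyl_threshold]). By
    closedness the whole interval lies in the spectrum. It is nondegenerate, so
    none of its points is isolated, and all are essential
    ([interval_essential]).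

    [H] has real coefficients. The estimates are therefore made for real
    functions and transferred to complex ones part by part. *)

(** * Symmetric operators on a complete semi-inner product space *)

(** Vectors of norm zero are not identified: in the application they are the
    functions that vanish almost everywhere. Uniqueness statements therefore
    read [ipnorm _ = 0] instead of an equality of vectors. *)
Section SemiHilbert.
Context {R : realType} {E : lmodType R} (ip : E -> E -> R).
Hypothesis ip_linear :
  forall a f g h, ip (a *: f + g) h = a * ip f h + ip g h.
Hypothesis ip_sym : forall f g, ip f g = ip g f.
Hypothesis ip_ge0 : forall f, 0 <= ip f f.

Definition ipnorm f := Num.sqrt (ip f f).

Lemma ipDl f g h : ip (f + g) h = ip f h + ip g h.
Proof. by rewrite -[f in LHS]scale1r ip_linear mul1r. Qed.

Lemma ip0l h : ip 0 h = 0.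
Proof. by apply: (addrI (ip 0 h)); rewrite -ipDl !addr0. Qed.

Lemma ipZl a f h : ip (a *: f) h = a * ip f h.
Proof. by rewrite -[a *: f]addr0 ip_linear ip0l addr0. Qed.

Lemma ipBl f g h : ip (f - g) h = ip f h - ip g h.
Proof. by rewrite ipDl -scaleN1r ipZl mulN1r. Qed.

Lemma ipDr f g h : ip h (f + g) = ip h f + ip h g.
Proof. by rewrite !(ip_sym h) ipDl. Qed.

Lemma ipZr a f h : ip h (a *: f) = a * ip h f.
Proof. by rewrite !(ip_sym h) ipZl. Qed.

Lemma ipBr f g h : ip h (f - g) = ip h f - ip h g.
Proof. by rewrite !(ip_sym h) ipBl. Qed.

Lemma ipNl f h : ip (- f) h = - ip f h.
Proof. by rewrite -scaleN1r ipZl mulN1r. Qed.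

Lemma ipNr f h : ip h (- f) = - ip h f.
Proof. by rewrite !(ip_sym h) ipNl. Qed.

Lemma ipnorm_ge0 f : 0 <= ipnorm f.
Proof. exact: sqrtr_ge0. Qed.

Lemma ipnorm_sqr f : ipnorm f ^+ 2 = ip f f.
Proof. exact: sqr_sqrtr. Qed.

Lemma ipnorm_le f c : 0 <= c -> (ipnorm f <= c) = (ip f f <= c ^+ 2).
Proof. by move=> c0; rewrite -ipnorm_sqr ler_pXn2r ?nnegrE ?ipnorm_ge0. Qed.

Lemma ip_sqr_le f g : ip f g ^+ 2 <= ip f f * ip g g.
Proof.
have q t : 0 <= ip f f + 2 * t * ip f g + t ^+ 2 * ip g g.
  have := ip_ge0 (f + t *: g).
  rewrite ipDl !ipDr !ipZl !ipZr (ip_sym g f); lra.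
have [g0|gN0] := eqVneq (ip g g) 0.
  suff -> : ip f g = 0 by rewrite g0 mulr0 expr0n.
  apply/eqP; apply/negPn/negP => fg.
  have := q (- (ip f f + 1) / (2 * ip f g)).
  have -> : 2 * (- (ip f f + 1) / (2 * ip f g)) * ip f g = - (ip f f + 1).
    by field.
  rewrite g0; lra.
have g_gt0 : 0 < ip g g by rewrite lt_neqAle eq_sym gN0 ip_ge0.
have := q (- ip f g / ip g g).
have -> : ip f f + 2 * (- ip f g / ip g g) * ip f g +
    (- ip f g / ip g g) ^+ 2 * ip g g = ip f f - ip f g ^+ 2 / ip g g by field.
by rewrite subr_ge0 ler_pdivrMr.
Qed.

Lemma ip_le f g : `|ip f g| <= ipnorm f * ipnorm g.
Proof.
rewrite -(@ler_pXn2r _ 2) ?nnegrE ?mulr_ge0 ?ipnorm_ge0//.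
by rewrite real_normK ?num_real// exprMn !ipnorm_sqr ip_sqr_le.
Qed.

Lemma ipnormD f g : ipnorm (f + g) <= ipnorm f + ipnorm g.
Proof.
rewrite ipnorm_le ?addr_ge0 ?ipnorm_ge0// ipDl !ipDr (ip_sym g f).
have := ip_le f g; have := ler_norm (ip f g).
by rewrite sqrrD !ipnorm_sqr; lra.
Qed.

Lemma ipnormZ a f : ipnorm (a *: f) = `|a| * ipnorm f.
Proof.
by rewrite /ipnorm ipZl ipZr mulrA -expr2 sqrtrM ?sqr_ge0// sqrtr_sqr.
Qed.

Lemma ipnormN f : ipnorm (- f) = ipnorm f.
Proof. by rewrite -scaleN1r ipnormZ normrN1 mul1r. Qed.

Lemma ipnormBC f g : ipnorm (f - g) = ipnorm (g - f).
Proof. by rewrite -ipnormN opprB. Qed.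

Lemma ipnormB f g : ipnorm (f - g) <= ipnorm f + ipnorm g.
Proof. by rewrite -(ipnormN g) ipnormD. Qed.

Lemma ipnorm0 : ipnorm 0 = 0.
Proof. by rewrite /ipnorm ip0l sqrtr0. Qed.

Lemma ipnorm_null f : (forall h, ip f h = 0) -> ipnorm f = 0.
Proof. by move=> /(_ f); rewrite /ipnorm => ->; rewrite sqrtr0. Qed.

Lemma ipnorm_eq f g : ipnorm (f - g) = 0 -> ipnorm f = ipnorm g.
Proof.
move=> fg; apply/eqP; rewrite eq_le.
have := ipnormD (f - g) g; rewrite subrK fg add0r => ->.
by have := ipnormD (g - f) f; rewrite subrK ipnormBC fg add0r.
Qed.

Lemma ip_null f g : ipnorm f = 0 -> ip f g = 0.
Proof.
by move=> f0; have := ip_le f g; rewrite f0 mul0r normr_le0 => /eqP.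
Qed.

(** The form in which limits enter below: a quantity that does not depend on
    [n] and is squeezed by a geometric sequence. *)
Lemma geometric_le0 (x C r : R) : 0 <= r -> r < 1 ->
  (forall n, x <= C * r ^+ n) -> x <= 0.
Proof.
move=> r0 r1 xr.
have cv : (fun n => C * r ^+ n) @ \oo --> C * 0.
  apply: cvgMr; apply: cvg_expr; by rewrite ger0_norm.
rewrite mulr0 in cv; rewrite -(cvg_lim _ cv)//.
by apply: limr_ge; [apply/cvg_ex; exists 0 | exact: nearW].
Qed.

(** Completeness is only ever used for sequences with geometrically decreasing
    steps, and in that form it comes with an explicit rate. *)
Definition geometrically_complete := forall (u : nat -> E) (D r : R),
  0 <= r -> r < 1 -> (forall n, ipnorm (u n.+1 - u n) <= D * r ^+ n) ->
  exists l, forall n, ipnorm (u n - l) <= D * r ^+ n / (1 - r).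

Hypothesis complete : geometrically_complete.

(** Zarantonello's theorem: [u - t (A u - g)] is a contraction for a small
    step [t], and its fixed point solves the equation. *)
Lemma monotone_surjective (A : E -> E) (a b : R) : 0 < a ->
  (forall u v, a * ip (u - v) (u - v) <= ip (A u - A v) (u - v)) ->
  (forall u v, ipnorm (A u - A v) <= b * ipnorm (u - v)) ->
  forall g, exists f, ipnorm (A f - g) = 0.
Proof.
move=> a0 mono lip g.
pose c := Num.max b a.
have ac : a <= c by rewrite /c le_max lexx orbT.
have c0 : 0 < c by exact: lt_le_trans ac.
have {}lip u v : ipnorm (A u - A v) <= c * ipnorm (u - v).
  apply: le_trans (lip u v) _.
  by rewrite ler_wpM2r ?ipnorm_ge0// /c le_max lexx.
pose t := a / c ^+ 2; pose rho := Num.sqrt (1 - a ^+ 2 / c ^+ 2).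
have t0 : 0 < t by rewrite divr_gt0// exprn_gt0.
have ac1 : a ^+ 2 / c ^+ 2 <= 1.
  by rewrite ler_pdivrMr ?exprn_gt0// mul1r ler_pXn2r ?nnegrE ?(ltW a0) ?(ltW c0).
have rho1 : rho < 1.
  by rewrite -sqrtr1 ltr_sqrt// ltrBlDr ltrDl divr_gt0 ?exprn_gt0.
pose F u := u - t *: (A u - g).
have FE u v : F u - F v = (u - v) - t *: (A u - A v).
  rewrite /F opprD opprK addrACA; congr (_ + _).
  by rewrite addrC -[LHS]opprB -scalerBr opprB addrA subrK.
have Flip u v : ipnorm (F u - F v) <= rho * ipnorm (u - v).
  rewrite ipnorm_le ?mulr_ge0 ?sqrtr_ge0// exprMn ipnorm_sqr sqr_sqrtr ?subr_ge0//.
  rewrite FE; have h1 := mono u v; have h2 := lip u v.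
  rewrite ipnorm_le ?mulr_ge0 ?(ltW c0) ?ipnorm_ge0// exprMn ipnorm_sqr in h2.
  move: (u - v) (A u - A v) h1 h2 => w d h1 h2.
  rewrite ipBl !ipBr !ipZl !ipZr (ip_sym w d).
  set ww := ip w w in h1 h2 *; set dw := ip d w in h1 *.
  set dd := ip d d in h2 *.
  have h3 : t * (t * dd) <= t * (a * ww).
    rewrite ler_pM2l// /t mulrAC ler_pdivrMr ?exprn_gt0// -mulrA.
    by rewrite ler_pM2l// mulrC.
  have h4 : t * (a * ww) <= t * dw by rewrite ler_pM2l.
  have -> : a ^+ 2 / c ^+ 2 = t * a by rewrite /t; ring.
  lra.
pose u n := iter n F 0.
have [l lP] : exists l, forall n, ipnorm (u n - l) <=
    ipnorm (u 1%N - u 0%N) * rho ^+ n / (1 - rho).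
  apply: complete => //; first exact: sqrtr_ge0.
  elim=> [|n IH]; first by rewrite expr0 mulr1.
  rewrite exprS mulrCA; apply: le_trans (Flip _ _) _.
  by rewrite ler_wpM2l// sqrtr_ge0.
exists l; apply/eqP; rewrite eq_le ipnorm_ge0 andbT.
have tl n : t * ipnorm (A l - g) <=
    (2 * ipnorm (u 1%N - u 0%N) / (1 - rho)) * rho ^+ n.
  have <- : ipnorm (F l - l) = t * ipnorm (A l - g).
    by rewrite /F addrAC subrr add0r ipnormN ipnormZ gtr0_norm.
  have -> : F l - l = (F l - F (u n)) + (u n.+1 - l) by rewrite addrA subrK.
  apply: le_trans (ipnormD _ _) _.
  have h1 := Flip l (u n); have h2 := lP n; have h3 := lP n.+1.
  have h4 : rho * ipnorm (l - u n) <= ipnorm (u n - l).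
    by rewrite ipnormBC -[leRHS]mul1r ler_wpM2r ?ipnorm_ge0// ltW.
  have h5 : ipnorm (u 1%N - u 0%N) * rho ^+ n.+1 / (1 - rho) <=
            ipnorm (u 1%N - u 0%N) * rho ^+ n / (1 - rho).
    rewrite ler_pM2r ?invr_gt0 ?subr_gt0// ler_wpM2l ?ipnorm_ge0//.
    by rewrite exprS -[leRHS]mul1r ler_wpM2r ?exprn_ge0 ?sqrtr_ge0// ltW.
  have -> : (2 * ipnorm (u 1%N - u 0%N) / (1 - rho)) * rho ^+ n =
     2 * (ipnorm (u 1%N - u 0%N) * rho ^+ n / (1 - rho)) by ring.
  lra.
have := geometric_le0 (sqrtr_ge0 _) rho1 tl.
by rewrite pmulr_rle0.
Qed.

Definition symmetric_op (S : E -> E) := forall f g, ip (S f) g = ip f (S g).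

(** Symmetry forces linearity up to vectors of norm zero. *)
Lemma symmetric_opB S f g : symmetric_op S ->
  ipnorm (S (f - g) - (S f - S g)) = 0.
Proof.
move=> symS; apply: ipnorm_null => h.
by rewrite !ipBl !symS ipBl subrr.
Qed.

Lemma symmetric_opZ S a f : symmetric_op S ->
  ipnorm (S (a *: f) - a *: S f) = 0.
Proof.
move=> symS; apply: ipnorm_null => h.
by rewrite ipBl ipZl !symS ipZl subrr.
Qed.

Section Symmetric.
Variables (S : E -> E) (B : R).
Hypothesis symS : symmetric_op S.
Hypothesis bndS : forall f, ipnorm (S f) <= B * ipnorm f.

(** [S^2 + b^2] is strongly monotone, whatever the sign of [S]. With [b = 0] it
    serves real spectral parameters, with [b] the imaginary part nonreal ones. *)
Lemma sqr_coercive_surjective (b c : R) : 0 < c ->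
  (forall f, c * ip f f <= ip (S f) (S f) + b ^+ 2 * ip f f) ->
  forall g, exists f, ipnorm (S (S f) + b ^+ 2 *: f - g) = 0.
Proof.
move=> c0 coer.
have B0 : forall f, 0 < ipnorm f -> 0 <= B.
  move=> f f0; rewrite -(pmulr_lge0 _ f0).
  exact: le_trans (ipnorm_ge0 _) (bndS f).
apply: (@monotone_surjective _ c (B ^+ 2 + b ^+ 2)) => // u v.
  apply: le_trans (coer (u - v)) _.
  rewrite opprD addrACA -scalerBr [leRHS]ipDl ipZl lerD2r.
  by rewrite [leRHS]ipBl !symS -[leRHS]ipBl.
rewrite opprD addrACA -scalerBr.
apply: le_trans (ipnormD _ _) _.
rewrite ipnormZ ger0_norm ?sqr_ge0// mulrDl lerD2r.
have lip w z : ipnorm (S w - S z) <= B * ipnorm (w - z).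
  by rewrite -(ipnorm_eq (symmetric_opB w z symS)).
have [uv|] := eqVneq (ipnorm (u - v)) 0.
  apply: le_trans (lip _ _) _; rewrite uv mulr0.
  have := lip u v; rewrite uv mulr0 => h.
  have -> : ipnorm (S u - S v) = 0 by apply/eqP; rewrite eq_le h ipnorm_ge0.
  by rewrite mulr0.
move=> uv0.
apply: le_trans (lip _ _) _.
rewrite expr2 -mulrA ler_wpM2l//.
have : 0 < ipnorm (u - v) by rewrite lt_neqAle eq_sym uv0 ipnorm_ge0.
exact: B0.
Qed.

(** [S (S f) = g] is solvable by coercivity of [S^2], and [S f] is then the
    solution. *)
Lemma bounded_below_surjective (C : R) :
  (forall f, ipnorm f <= C * ipnorm (S f)) ->
  forall g, exists f, ipnorm (S f - g) = 0.
Proof.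
move=> below g; pose D := Num.max C 1.
have D0 : 0 < D by rewrite lt_max ltr01 orbT.
have [| |f fP] := @sqr_coercive_surjective 0 (D ^- 2) _ _ g.
- by rewrite invr_gt0 exprn_gt0.
- move=> f; rewrite expr0n/= mul0r addr0 ler_pdivrMl ?exprn_gt0//.
  rewrite -!ipnorm_sqr -exprMn ler_pXn2r ?nnegrE ?mulr_ge0 ?ipnorm_ge0 ?(ltW D0)//.
  apply: le_trans (below f) _.
  by rewrite ler_wpM2r ?ipnorm_ge0// le_max lexx.
- by exists (S f); move: fP; rewrite expr0n/= scale0r addr0.
Qed.

(** [S + i b] on the complexification, written out on real and imaginary
    parts: it inverts [S - i b] up to the factor [S^2 + b^2]. *)
Lemma nonreal_surjective (b : R) : b != 0 -> forall g1 g2, exists u v,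
  ipnorm (S u + b *: v - g1) = 0 /\ ipnorm (S v - b *: u - g2) = 0.
Proof.
move=> b0 g1 g2.
have surj : forall g, exists f, ipnorm (S (S f) + b ^+ 2 *: f - g) = 0.
  apply: (@sqr_coercive_surjective b (b ^+ 2)).
    by rewrite lt_neqAle sqr_ge0 eq_sym sqrf_eq0 b0.
  by move=> f; rewrite lerDr ip_ge0.
have [u0 u0P] := surj g1; have [v0 v0P] := surj g2.
exists (S u0 - b *: v0), (S v0 + b *: u0).
split; apply: ipnorm_null => h.
- move: (ip_null h u0P); rewrite !(ipDl, ipNl, ipZl) !symS !(ipDl, ipNl, ipZl).
  rewrite !symS => e; lra.
- move: (ip_null h v0P); rewrite !(ipDl, ipNl, ipZl) !symS !(ipDl, ipNl, ipZl).
  rewrite !symS => e; lra.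
Qed.

(** The cross terms cancel by symmetry of [S]; what remains is
    [|S u|^2 + |S v|^2 + b^2 (|u|^2 + |v|^2)]. *)
Lemma nonreal_bounded_below (b : R) u v :
  b ^+ 2 * (ip u u + ip v v) <=
  ip (S u + b *: v) (S u + b *: v) + ip (S v - b *: u) (S v - b *: u).
Proof.
rewrite !(ipDl, ipDr, ipNl, ipNr, ipZl, ipZr) (ip_sym v (S u)) (ip_sym u (S v)).
rewrite (symS v u) (ip_sym v (S u)).
have := ip_ge0 (S u); have := ip_ge0 (S v); lra.
Qed.

End Symmetric.

Definition bounded_seminorm (P : E -> R) :=
  [/\ forall f g, P (f - g) <= P f + P g,
      forall a f, P (a *: f) = `|a| * P f
    & exists D, forall f, P f <= D * ipnorm f].

Definition bounded_functional (l : E -> R) :=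
  (forall a f g, l (a *: f + g) = a * l f + l g) /\
  exists D, forall f, `|l f| <= D * ipnorm f.

Lemma bounded_functional_sub l f g : bounded_functional l ->
  l (f - g) = l f - l g.
Proof.
by move=> [lin _]; rewrite addrC -scaleN1r lin mulN1r addrC.
Qed.

Lemma bounded_functionalZ l a f : bounded_functional l -> l (a *: f) = a * l f.
Proof.
move=> [lin _]; have l0 : l 0 = 0.
  by have := lin 1 0 0; rewrite scale1r addr0 mul1r => e; lra.
by rewrite -[a *: f]addr0 lin l0 addr0.
Qed.

Lemma bounded_seminorm_functional l : bounded_functional l ->
  bounded_seminorm (fun f => `|l f|).
Proof.
move=> lb; split; last by case: lb.
- by move=> f g; rewrite (bounded_functional_sub _ _ lb) ler_normB.
- by move=> a f; rewrite (bounded_functionalZ _ _ lb) normrM.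
Qed.

Lemma bounded_functional_ip e : bounded_functional (ip^~ e).
Proof.
split=> [a f g|]; first exact: ip_linear.
by exists (ipnorm e) => f; rewrite mulrC ip_le.
Qed.

Lemma bounded_seminorm_ge0 P f : bounded_seminorm P -> 0 <= P f.
Proof.
move=> [PB PZ _]; have := PB f f.
rewrite subrr -(scale0r f) PZ normr0 mul0r; lra.
Qed.

Lemma bounded_seminormD P Q : bounded_seminorm P -> bounded_seminorm Q ->
  bounded_seminorm (fun f => P f + Q f).
Proof.
move=> [PB PZ [D PD]] [QB QZ [D' QD]]; split.
- by move=> f g; have := PB f g; have := QB f g; lra.
- by move=> a f; rewrite PZ QZ mulrDr.
- by exists (D + D') => f; rewrite mulrDl lerD.
Qed.

(** The terms are added one by one, absorbing each functional into the
    seminorm. *)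
Lemma bounded_seminorm_sum P (ls : seq (E -> R)) : bounded_seminorm P ->
  (forall l, l \in ls -> bounded_functional l) ->
  bounded_seminorm (fun f => P f + \sum_(l <- ls) `|l f|).
Proof.
elim: ls P => [|l ls IH] P Pb lb.
  by rewrite (_ : (fun _ => _) = P)//; apply/funext => f; rewrite big_nil addr0.
rewrite (_ : (fun _ => _) =
    (fun f => (P f + `|l f|) + \sum_(l <- ls) `|l f|)); last first.
  by apply/funext => f; rewrite big_cons addrA.
apply: IH => [|m mls]; last by apply: lb; rewrite inE mls orbT.
apply: bounded_seminormD => //; apply: bounded_seminorm_functional.
by apply: lb; rewrite mem_head.
Qed.

(** A lower bound that holds up to one bounded functional [l] holds outright
    if [P] has no kernel: otherwise normalizing by [l f = 1] gives a sequence
    along which [P] vanishes, on whose differences [l] vanishes; it is therefore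
    Cauchy, and its limit is in the kernel of [P] although [l] is [1] there. *)
Lemma remove_functional P l C : bounded_seminorm P -> bounded_functional l ->
  (forall f, P f = 0 -> ipnorm f = 0) ->
  (forall f, ipnorm f <= C * (P f + `|l f|)) ->
  exists C', forall f, ipnorm f <= C' * P f.
Proof.
move=> Pb lb ker low.
pose D := Num.max C 1.
have D0 : 0 < D by rewrite lt_max ltr01 orbT.
have P0 f : 0 <= P f by exact: bounded_seminorm_ge0.
have {}low f : ipnorm f <= D * (P f + `|l f|).
  by apply: le_trans (low f) _; rewrite ler_wpM2r ?addr_ge0// le_max lexx.
have [//|noC] := pselect (exists C', forall f, ipnorm f <= C' * P f).
have ex d : 0 < d -> exists f, l f = 1 /\ P f <= d.
  move=> d0; apply: contrapT => nof; apply: noC; exists (D + D / d) => f.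
  rewrite leNgt; apply/negP => hf.
  have lf : P f / d < `|l f|.
    have h := lt_le_trans hf (low f).
    rewrite mulrDl mulrDr ltrD2l -mulrA ltr_pM2l// in h.
    by rewrite mulrC.
  have lf0 : l f != 0.
    rewrite -normr_gt0; apply: le_lt_trans lf.
    by rewrite divr_ge0// ltW.
  apply: nof; exists ((l f)^-1 *: f); split.
    by rewrite (bounded_functionalZ _ _ lb) mulVf.
  case: Pb => _ -> _; rewrite normfV ler_pdivrMl ?normr_gt0//.
  by rewrite -ler_pdivrMr// ltW.
have {}ex n : exists f, l f = 1 /\ P f <= 2^-1 ^+ n.
  by apply: ex; rewrite exprn_gt0.
have [u uP] := boolp.choice ex.
have half n : 2^-1 ^+ n.+1 <= 2^-1 ^+ n :> R.
  by rewrite exprS ler_piMl ?exprn_ge0//; lra.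
have h0 : 0 <= 2^-1 :> R by lra.
have h1 : 2^-1 < 1 :> R by lra.
have step n : ipnorm (u n.+1 - u n) <= D * 2 * 2^-1 ^+ n.
  apply: le_trans (low _) _.
  rewrite (bounded_functional_sub _ _ lb) !(proj1 (uP _)) subrr normr0 addr0.
  rewrite -mulrA ler_pM2l//; case: Pb => PB _ _.
  have := PB (u n.+1) (u n); have := proj2 (uP n); have := proj2 (uP n.+1).
  have := half n; lra.
have [g gP] := complete h0 h1 step.
have ug n : ipnorm (u n - g) <= (D * 2 * 2) * 2^-1 ^+ n.
  apply: le_trans (gP n) _; rewrite [leRHS]mulrAC.
  by rewrite (_ : (1 - 2^-1)^-1 = 2 :> R)//; field.
have g0 : ipnorm g = 0.
  apply: ker; apply/eqP; rewrite eq_le P0 andbT.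
  case: (Pb) => PB _ [d Pd].
  apply: (@geometric_le0 _ (1 + `|d| * (D * 2 * 2)) 2^-1 h0 h1) => n.
  have := PB (u n) (u n - g); rewrite subKr => /le_trans; apply.
  rewrite mulrDl mul1r lerD ?(proj2 (uP n))//.
  apply: le_trans (Pd _) _.
  apply: (@le_trans _ _ (`|d| * ipnorm (u n - g))).
    by rewrite ler_wpM2r ?ipnorm_ge0 ?ler_norm.
  by rewrite -(mulrA `|d|) ler_wpM2l.
exfalso; case: (lb) => _ [d ld].
have lg : l g = 0.
  by apply/eqP; rewrite -normr_le0; have := ld g; rewrite g0 mulr0.
suff : 1 <= 0 :> R by rewrite ler10.
apply: (@geometric_le0 _ (`|d| * (D * 2 * 2)) 2^-1 h0 h1) => n.
have := ld (u n - g); rewrite (bounded_functional_sub _ _ lb) lg (proj1 (uP n)).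
rewrite subr0 normr1 => /le_trans; apply.
apply: (@le_trans _ _ (`|d| * ipnorm (u n - g))).
  by rewrite ler_wpM2r ?ipnorm_ge0 ?ler_norm.
by rewrite -(mulrA `|d|) ler_wpM2l.
Qed.

Lemma remove_functionals P (ls : seq (E -> R)) C : bounded_seminorm P ->
  (forall l, l \in ls -> bounded_functional l) ->
  (forall f, P f = 0 -> ipnorm f = 0) ->
  (forall f, ipnorm f <= C * (P f + \sum_(l <- ls) `|l f|)) ->
  exists C', forall f, ipnorm f <= C' * P f.
Proof.
elim: ls P C => [|l ls IH] P C Pb lb ker low.
  by exists C => f; apply: le_trans (low f) _; rewrite big_nil addr0.
have lbl : bounded_functional l by apply: lb; rewrite mem_head.
have Plb := bounded_seminormD Pb (bounded_seminorm_functional lbl).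
have [|||C' C'P] := IH (fun f => P f + `|l f|) C Plb.
- by move=> m mls; apply: lb; rewrite inE mls orbT.
- move=> f Pl0; apply: ker; apply/eqP.
  rewrite eq_le bounded_seminorm_ge0// andbT -Pl0 lerDl//.
- by move=> f; apply: le_trans (low f) _; rewrite big_cons addrA.
- exact: remove_functional C'P.
Qed.

(** The values of the functionals embed [N] linearly into [R^n]; a family of
    maximal rank there spans [N]. *)
Lemma finite_dimensional (N : set E) (ls : seq (E -> R)) :
  (forall l, l \in ls -> bounded_functional l) ->
  (forall a f g, N f -> N g -> N (a *: f + g)) ->
  (forall f, N f -> (forall l, l \in ls -> l f = 0) -> ipnorm f = 0) ->
  exists (k : nat) (e : 'I_k -> E), (forall i, N (e i)) /\
    forall f, N f ->
      exists c : 'I_k -> R, ipnorm (f - \sum_(i < k) c i *: e i) = 0.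
Proof.
move=> lb Nlin Nker.
pose n := size ls.
pose v f : 'rV[R]_n := \row_(j < n) nth (fun=> 0) ls j f.
have vlin a f g : v (a *: f + g) = a *: v f + v g.
  apply/rowP => j; rewrite !mxE.
  by case: (lb (nth (fun=> 0) ls j)) => [|-> //]; exact: mem_nth.
pose M k (e : 'I_k -> E) := \matrix_(i < k) v (e i).
pose p k := `[< exists e : 'I_k -> E, (forall i, N (e i)) /\ row_free (M k e) >].
have p0 : exists k, p k.
  exists 0%N; apply/asboolP; exists (fun=> 0).
  by split=> [[]//|]; rewrite -row_leq_rank.
have pn k : p k -> (k <= n)%N.
  by move=> /asboolP[e [_]]; rewrite /row_free => /eqP <-; exact: rank_leq_col.
pose k := ex_maxn p0 pn.
have [pk kmax] : p k /\ forall j, p j -> (j <= k)%N by rewrite /k; case: ex_maxnP.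
case/asboolP: pk => e [Ne ef]; exists k, e; split=> // f Nf.
have sub : (v f <= M k e)%MS.
  apply: contraT => vf.
  pose e' (i : 'I_(k + 1)) := match fintype.split i with inl i => e i | inr _ => f end.
  suff : p (k + 1)%N by move/kmax; rewrite addn1 ltnn.
  apply/asboolP; exists e'; split.
    by move=> i; rewrite /e'; case: fintype.split.
  have -> : M (k + 1)%N e' = col_mx (M k e) (v f).
    apply/row_matrixP => i; rewrite rowK /e' -[i in row i]splitK.
    case: fintype.split => j /=; first by rewrite rowKu rowK.
    by rewrite rowKd [j]ord1 row_id.
  rewrite /row_free eqn_leq rank_leq_row /= -addsmxE.
  have le := mxrank_leqif_sup (addsmxSl (M k e) (v f)).
  move/eqP: ef => ef; rewrite addn1 -{1}ef (ltn_leqif le).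
  by rewrite addsmx_sub submx_refl.
have [c ce] := submxP sub.
have N0 : N 0 by have := Nlin (-1) f f Nf Nf; rewrite scaleN1r addNr.
have v0 : v 0 = 0 by have := vlin (-1) 0 0; rewrite scaler0 addr0 scaleN1r addNr.
have NE : N (f - \sum_i c 0 i *: e i).
  rewrite addrC -scaleN1r; apply: (Nlin) => //.
  apply: (big_ind N) => // [x y Nx Ny|i _]; last first.
    by rewrite -[_ *: _]addr0; exact: Nlin.
  by rewrite -[x]scale1r; exact: Nlin.
have vE : v (f - \sum_i c 0 i *: e i) = 0.
  rewrite addrC -scaleN1r vlin ce mulmx_sum_row scaleN1r; apply/eqP.
  rewrite addrC subr_eq0; apply/eqP; symmetry.
  elim/big_rec2 : _ => // i x y _ <-; rewrite vlin.
  by rewrite rowK.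
exists (fun i => c 0 i); apply: Nker => // l lls.
have ln : (index l ls < n)%N by rewrite index_mem.
by move/rowP: vE => /(_ (Ordinal ln)); rewrite !mxE /= nth_index.
Qed.

Section Discrete.
Variables (H : E -> E) (B : R).
Hypothesis symH : symmetric_op H.
Hypothesis bndH : forall f, ipnorm (H f) <= B * ipnorm f.

Lemma symmetric_op_shift z : symmetric_op (fun f => H f - z *: f).
Proof. by move=> f g; rewrite !(ipDl, ipDr, ipNl, ipNr, ipZl, ipZr) symH. Qed.

Lemma bounded_op_shift z f : ipnorm (H f - z *: f) <= (B + `|z|) * ipnorm f.
Proof.
by apply: le_trans (ipnormB _ _) _; rewrite ipnormZ mulrDl lerD2r.
Qed.

Lemma bounded_seminorm_op (S : E -> E) D : symmetric_op S ->
  (forall f, ipnorm (S f) <= D * ipnorm f) -> bounded_seminorm (fun f => ipnorm (S f)).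
Proof.
move=> symS bS; split; last by exists D.
- move=> f g; rewrite (ipnorm_eq (symmetric_opB f g symS)); exact: ipnormB.
- by move=> a f; rewrite (ipnorm_eq (symmetric_opZ a f symS)) ipnormZ.
Qed.

(** The estimate behind finite-dimensional kernel and closed range. It is
    formulated without orthogonal complements, in the form in which it comes out
    of a compactness argument. *)
Definition semi_fredholm z := exists (C : R) (ls : seq (E -> R)),
  (forall l, l \in ls -> bounded_functional l) /\
  forall f, ipnorm f <= C * (ipnorm (H f - z *: f) + \sum_(l <- ls) `|l f|).

Lemma semi_fredholm_bounded_below z : semi_fredholm z ->
  (forall f, ipnorm (H f - z *: f) = 0 -> ipnorm f = 0) ->
  exists C, forall f, ipnorm f <= C * ipnorm (H f - z *: f).
Proof.
move=> [C [ls [lb low]]] ker.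
apply: (remove_functionals _ lb) low => //.
exact: bounded_seminorm_op (symmetric_op_shift z) (bounded_op_shift z).
Qed.

(** On the kernel of [H - z] the finitely many functionals alone control the
    norm. *)
Lemma semi_fredholm_finite_multiplicity z : semi_fredholm z ->
  exists (k : nat) (e : 'I_k -> E), (forall i, ipnorm (H (e i) - z *: e i) = 0) /\
    forall f, ipnorm (H f - z *: f) = 0 ->
      exists c : 'I_k -> R, ipnorm (f - \sum_(i < k) c i *: e i) = 0.
Proof.
move=> [C [ls [lb low]]].
apply: (finite_dimensional (N := [set f | ipnorm (H f - z *: f) = 0]) lb).
- move=> a f g /= Nf Ng; apply: ipnorm_null => h.
  rewrite -/((fun f => H f - z *: f) _) symmetric_op_shift ip_linear.
  by rewrite -!symmetric_op_shift !ip_null// mulr0 addr0.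
- move=> f /= Nf lf; apply/eqP; rewrite eq_le ipnorm_ge0 andbT.
  apply: le_trans (low f) _; rewrite Nf add0r big_seq big1 ?mulr0// => l ls_l.
  by rewrite lf// normr0.
Qed.

(** Eigenvectors at a nearby value are orthogonal to the kernel of [H - z],
    on whose complement [H - z] is bounded below. *)
Lemma semi_fredholm_isolated z : semi_fredholm z ->
  exists2 r, 0 < r & forall w g, w != z -> `|w - z| < r ->
    ipnorm (H g - w *: g) = 0 -> ipnorm g = 0.
Proof.
move=> Qz; have [k [e [Ne span]]] := semi_fredholm_finite_multiplicity Qz.
have [C [ls [lb low]]] := Qz.
have Sb := bounded_seminorm_op (symmetric_op_shift z) (bounded_op_shift z).
pose es := [seq ip^~ (e i) | i <- enum 'I_k].
have esb l : l \in es -> bounded_functional l.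
  by move=> /mapP[i _ ->]; exact: bounded_functional_ip.
have sume f : \sum_(l <- es) `|l f| = \sum_(i < k) `|ip f (e i)|.
  by rewrite /es big_map big_enum.
have Pb := bounded_seminorm_sum Sb esb.
have [||C' C'P] := @remove_functionals _ ls (Num.max C 0) Pb lb.
- move=> f /= /eqP; rewrite sume paddr_eq0 ?ipnorm_ge0 ?sumr_ge0//.
  move=> /andP[/eqP /span[c fc]].
  rewrite psumr_eq0// => /allP f0.
  have ipf i : ip f (e i) = 0.
    by apply/eqP; rewrite -normr_eq0; apply: f0; rewrite mem_index_enum.
  apply/eqP; rewrite -sqrf_eq0 ipnorm_sqr -[X in ip _ X](subrK (\sum_(i < k) c i *: e i)).
  rewrite ipDr ip_sym ip_null// add0r.
  suff H0 m (F : 'I_m -> E) : (forall i, ip f (F i) = 0) -> ip f (\sum_i F i) = 0.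
    by rewrite H0// => i; rewrite ipZr ipf mulr0.
  move=> F0; elim/big_ind : _ => //; first by rewrite ip_sym ip0l.
  by move=> x y x0 y0; rewrite ipDr x0 y0 addr0.
- move=> f; apply: le_trans (low f) _.
  have sum0 (ms : seq (E -> R)) : 0 <= \sum_(l <- ms) `|l f| by exact: sumr_ge0.
  apply: (@le_trans _ _ (Num.max C 0 *
      (ipnorm (H f - z *: f) + \sum_(l <- ls) `|l f|))).
    by rewrite ler_wpM2r ?addr_ge0 ?ipnorm_ge0// le_max lexx.
  by rewrite ler_wpM2l ?le_max ?lexx ?orbT// lerD2r lerDl.
exists (`|C'| + 1)^-1; first by rewrite invr_gt0 ltr_wpDl.
move=> w g wz wzr Ng.
have ge i : ip g (e i) = 0.
  have : (w - z) * ip g (e i) = 0.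
    have := ip_null g (Ne i); rewrite ip_sym.
    have := ip_null (e i) Ng; rewrite !(ipDl, ipDr, ipNl, ipNr, ipZl, ipZr) symH.
    lra.
  by move/eqP; rewrite mulf_eq0 subr_eq0 (negPf wz) => /eqP.
have := C'P g; rewrite /= sume big1 ?addr0; last by move=> i _; rewrite ge normr0.
have -> : ipnorm (H g - z *: g) = `|w - z| * ipnorm g.
  rewrite -ipnormZ; apply: ipnorm_eq.
  by rewrite scalerBl opprB addrA subrK Ng.
move=> h; apply/eqP; rewrite eq_le ipnorm_ge0 andbT leNgt; apply/negP => g0.
have : ipnorm g < ipnorm g; last by rewrite ltxx.
apply: le_lt_trans h _; rewrite mulrA gtr_pMl//.
have : (`|C'| + 1) * `|w - z| < 1.
  by rewrite mulrC -ltr_pdivlMr ?div1r// ltr_wpDl.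
have : C' * `|w - z| <= `|C'| * `|w - z| by rewrite ler_wpM2r// ler_norm.
by have := normr_ge0 (w - z); rewrite mulrDl mul1r; lra.
Qed.

End Discrete.
End SemiHilbert.

(** * Completeness of L2 *)

Section LiminfBounds.
Context {R : realType}.
Implicit Types (u : (\bar R)^nat) (M : \bar R).
Local Open Scope ereal_scope.

Lemma limn_einf_ge u M N : (forall n, (N <= n)%N -> M <= u n) ->
  M <= limn_einf u.
Proof.
move=> Mu; rewrite limn_einf_lim; apply: lime_ge; first exact: is_cvg_einfs.
exists N => // n /= Nn; apply: le_ereal_inf_tmp => _ [k /= nk <-].
by apply: Mu; exact: leq_trans nk.
Qed.

Lemma limn_einf_le u M : (forall n, u n <= M) -> limn_einf u <= M.
Proof.
move=> uM; rewrite limn_einf_lim; apply: lime_le; first exact: is_cvg_einfs.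
apply: nearW => n; apply: le_trans (uM n); apply: ereal_inf_lbound.
by exists n => /=.
Qed.

Lemma measurable_fun_limn_einf d (T : measurableType d) (f : (T -> \bar R)^nat) :
  (forall n, measurable_fun setT (f n)) ->
  measurable_fun setT (fun x => limn_einf (f^~ x)).
Proof.
move=> mf; rewrite (_ : (fun _ => _) =
    fun x => - limn_esup (fun n => - f n x)).
  apply: measurableT_comp => //.
  by apply: measurable_fun_limn_esup => n; exact: measurableT_comp.
apply/funext => x; rewrite -limn_einfN; congr limn_einf.
by apply/funext => n /=; rewrite oppeK.
Qed.

End LiminfBounds.

Section L2.
Context d (X : measurableType d) (R : realType).
Variable nu : {measure set X -> \bar R}.
Local Notation L2 := (Lfun nu 2%:E).
Implicit Types f g h : X -> R.

Lemma L2_measurable f : f \in L2 -> measurable_fun setT f.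
Proof. by move=> /andP[/set_mem]. Qed.

Lemma L2_normE f : ('N[nu]_2%:E [EFin \o f] =
  (\int[nu]_x (f x ^+ 2)%:E) `^ 2^-1)%E.
Proof.
rewrite unlock /Lnorm; congr (_ `^ _)%E.
by apply: eq_integral => x _ /=; rewrite powR_mulrn// real_normK ?num_real.
Qed.

Lemma L2P f : f \in L2 <->
  measurable_fun setT f /\ (\int[nu]_x (f x ^+ 2)%:E < +oo)%E.
Proof.
split=> [fL|[mf ff]].
  split; first exact: L2_measurable.
  have /integrableP[_] := Lfun2_integrable_sqr fL.
  by under eq_integral do rewrite /= ger0_norm ?sqr_ge0//.
apply/andP; split; apply/mem_set => //=.
by rewrite /finite_norm L2_normE poweR_lty.
Qed.

Lemma L2_mul_integrable f g : f \in L2 -> g \in L2 ->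
  nu.-integrable setT (EFin \o (fun x => f x * g x)).
Proof. by move=> fL gL; apply/Lfun1_integrable; exact: Lfun2_mul_Lfun1. Qed.

Lemma L2_le f g : measurable_fun setT f -> g \in L2 ->
  (forall x, `|f x| <= `|g x|) -> f \in L2.
Proof.
move=> mf gL fg; apply/L2P; split=> //.
have [_] := (L2P g).1 gL; apply: le_lt_trans.
apply: ge0_le_integral => //.
- by move=> x _; rewrite lee_fin sqr_ge0.
- by apply/measurable_EFinP; exact: measurable_funX.
- by apply/measurable_EFinP; apply: measurable_funX; exact: L2_measurable.
- move=> x _; rewrite lee_fin -[_ ^+ 2]real_normK ?num_real//.
  by rewrite -[leRHS]real_normK ?num_real// ler_pXn2r ?nnegrE.
Qed.

Definition L2ip f g : R := \int[nu]_x (f x * g x).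

Lemma L2ip_sym f g : L2ip f g = L2ip g f.
Proof. by apply: eq_Rintegral => x _; rewrite mulrC. Qed.

Lemma L2ip_ge0 f : 0 <= L2ip f f.
Proof. by apply: Rintegral_ge0 => x _; rewrite -expr2 sqr_ge0. Qed.

Lemma L2ip_linear a f g h : f \in L2 -> g \in L2 -> h \in L2 ->
  L2ip (a *: f + g) h = a * L2ip f h + L2ip g h.
Proof.
move=> fL gL hL; rewrite /L2ip.
have fh := L2_mul_integrable fL hL; have gh := L2_mul_integrable gL hL.
have afh : nu.-integrable setT (EFin \o (fun x => a * (f x * h x))).
  by rewrite (_ : EFin \o _ = fun x => (a%:E * (f x * h x)%:E)%E)//;
    exact: integrableZl.
rewrite -RintegralZl// -RintegralD//.
by apply: eq_Rintegral => x _ /=; rewrite !fctE mulrDl mulrA.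
Qed.

Lemma L2ip_sqrE f : f \in L2 ->
  (L2ip f f)%:E = (\int[nu]_x (f x ^+ 2)%:E)%E.
Proof.
move=> fL; rewrite /L2ip /Rintegral fineK.
  by apply: eq_integral => x _; rewrite expr2.
by apply: integrable_fin_num => //; exact: L2_mul_integrable.
Qed.

Lemma L2ip_eq0 f : f \in L2 -> L2ip f f = 0 <-> f = (fun=> 0) %[ae nu].
Proof.
move=> fL.
have mf2 : measurable_fun setT (fun x => (f x ^+ 2)%:E).
  by apply/measurable_EFinP; apply: measurable_funX; exact: L2_measurable.
have e : (\int[nu]_x `|(f x ^+ 2)%:E|)%E = (L2ip f f)%:E.
  by rewrite L2ip_sqrE//; apply: eq_integral => x _; rewrite gee0_abs// lee_fin sqr_ge0.
have [i1 i2] := ae_eq_integral_abs nu measurableT mf2.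
rewrite e in i1 i2; split=> [f0|f0].
  have := i1 (congr1 EFin f0); apply: filterS => x /= /(_ I) [] /eqP.
  by rewrite sqrf_eq0 => /eqP.
suff : (L2ip f f)%:E = 0%E by case.
by apply: i2; apply: filterS f0 => x /= fx _; rewrite fx // expr0n.
Qed.

End L2.

Section L2Complete.
Context d (X : measurableType d) (R : realType).
Variable nu : {measure set X -> \bar R}.
Local Notation L2 := (Lfun nu 2%:E).
Local Notation E := (LfunType nu (lee1n 2)).
Implicit Types f g h : X -> R.

Definition L2norm f : R := Num.sqrt (L2ip nu f f).

(** An instance of the semi-inner products above, on the module of [L2]
    functions. *)
Definition Lfun_ip (f g : E) : R := L2ip nu f g.

Lemma Lfun_ip_linear a (f g h : E) :
  Lfun_ip (a *: f + g) h = a * Lfun_ip f h + Lfun_ip g h.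
Proof. by apply: L2ip_linear; exact: LfunP. Qed.

Lemma L2normD f g : f \in L2 -> g \in L2 ->
  L2norm (f + g) <= L2norm f + L2norm g.
Proof.
move=> fL gL.
have := ipnormD Lfun_ip_linear (fun f g : E => L2ip_sym nu f g)
  (fun f : E => L2ip_ge0 nu f).
by move=> /(_ (Lfun_Sub (lee1n 2) fL) (Lfun_Sub (lee1n 2) gL)).
Qed.

Lemma L2norm_ge0 f : 0 <= L2norm f.
Proof. exact: sqrtr_ge0. Qed.

Lemma L2norm_leP f c : f \in L2 -> 0 <= c ->
  (L2norm f <= c) = (\int[nu]_x (f x ^+ 2)%:E <= (c ^+ 2)%:E)%E.
Proof.
move=> fL c0; rewrite -L2ip_sqrE// lee_fin.
by rewrite -[L2ip _ _ _ in RHS]sqr_sqrtr ?L2ip_ge0// ler_pXn2r ?nnegrE ?L2norm_ge0.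
Qed.

Lemma L2normN f : L2norm (- f) = L2norm f.
Proof.
by congr Num.sqrt; apply: eq_Rintegral => x _; rewrite !fctE mulrNN.
Qed.

Lemma L2_lincomb a f g : f \in L2 -> g \in L2 -> a *: f + g \in L2.
Proof. have [_] := Lfun_submod_closed nu (lee1n 2); exact. Qed.

Lemma L2_zero : 0 \in L2.
Proof. by have [] := Lfun_submod_closed nu (lee1n 2). Qed.

Lemma L2_add f g : f \in L2 -> g \in L2 -> f + g \in L2.
Proof. by move=> fL gL; rewrite -[f]scale1r; exact: L2_lincomb. Qed.

Lemma L2_scale a f : f \in L2 -> a *: f \in L2.
Proof. by move=> fL; rewrite -[_ *: _]addr0 L2_lincomb// L2_zero. Qed.

Lemma L2_sub f g : f \in L2 -> g \in L2 -> f - g \in L2.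
Proof. by move=> fL gL; rewrite addrC -scaleN1r; exact: L2_lincomb. Qed.

Lemma L2_sum I (s : seq I) (F : I -> X -> R) : (forall i, F i \in L2) ->
  \sum_(i <- s) F i \in L2.
Proof.
move=> FL; apply: (big_ind (fun f => f \in L2)) => //; first exact: L2_zero.
exact: L2_add.
Qed.

Section Limit.
Variables (u : nat -> X -> R) (D r : R).
Hypotheses (r_ge0 : 0 <= r) (r_lt1 : r < 1).
Hypothesis uL : forall n, u n \in L2.
Hypothesis u_step : forall n, L2norm (u n.+1 - u n) <= D * r ^+ n.

Let C := D / (1 - r).

Let D_ge0 : 0 <= D.
Proof. by have := le_trans (L2norm_ge0 _) (u_step 0); rewrite expr0 mulr1. Qed.

Let g n x : R := `|u n.+1 x - u n x|.

Let gL n : g n \in L2.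
Proof.
have uuL : u n.+1 - u n \in L2 by exact: L2_sub.
apply: (L2_le _ uuL) => [|x]; last by rewrite normr_id.
apply: measurableT_comp => //; exact: L2_measurable uuL.
Qed.

Let g_norm n : L2norm (g n) <= D * r ^+ n.
Proof.
apply: le_trans (u_step n); rewrite /L2norm /L2ip.
rewrite (@eq_Rintegral _ _ _ _ _ (fun x => (u n.+1 - u n) x * (u n.+1 - u n) x))//.
by move=> x _; rewrite /g -expr2 real_normK ?num_real// expr2.
Qed.

Let geo_sum m k : \sum_(m <= i < m + k) D * r ^+ i <= C * r ^+ m.
Proof.
rewrite -mulr_sumr /C -mulrA ler_wpM2l// -{1}[m]add0n big_addn addKn.
rewrite mulrC ler_pdivlMr ?subr_gt0//.
rewrite (eq_bigr (fun i => r ^+ m * r ^+ i)); last by move=> i _; rewrite exprD mulrC.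
rewrite -mulr_sumr -mulrA ler_piMr ?exprn_ge0//.
rewrite big_mkord mulrC -opprB mulNr -subrX1 opprB.
by rewrite lerBlDr lerDl exprn_ge0.
Qed.

Let S n x : R := \sum_(0 <= k < n) g k x.

Let SL n : S n \in L2.
Proof.
rewrite (_ : S n = \sum_(0 <= k < n) g k); first exact: L2_sum.
by apply/funext => x; rewrite /S fct_sumE.
Qed.

Let norm_sum (f : nat -> X -> R) m k : (forall n, f n \in L2) ->
  (forall n, L2norm (f n) <= D * r ^+ n) ->
  L2norm (\sum_(m <= i < m + k) f i) <= C * r ^+ m.
Proof.
move=> fL fD; apply: le_trans (geo_sum m k).
elim: k => [|k IH].
  rewrite addn0 !big_geq// /L2norm /L2ip.
  by under eq_Rintegral do rewrite mulr0; rewrite Rintegral_cst// mul0r sqrtr0.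
rewrite addnS !big_nat_recr ?leq_addr//=.
apply: le_trans (L2normD _ _) _; rewrite ?L2_sum//.
exact: lerD.
Qed.

Let S_norm n : L2norm (S n) <= C.
Proof.
rewrite (_ : S n = \sum_(0 <= k < 0 + n) g k).
  by rewrite -[leRHS]mulr1 -(expr0 r) norm_sum.
by apply/funext => x; rewrite /S fct_sumE.
Qed.

Let C_ge0 : 0 <= C.
Proof. by rewrite divr_ge0// subr_ge0 ltW. Qed.

Let S_nd x : {homo S^~ x : m n / (m <= n)%N >-> m <= n}.
Proof.
apply/nondecreasing_seqP => n; rewrite /S big_nat_recr//= lerDl.
exact: normr_ge0.
Qed.

(** By Fatou's lemma the square of the total variation of [n |-> u n x] has
    finite integral. *)
Let S_bounded : \forall x \ae nu, exists M, forall n, S n x <= M.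
Proof.
pose h x := limn_einf (fun n => (S n x ^+ 2)%:E).
have mS n : measurable_fun setT (fun x => (S n x ^+ 2)%:E).
  by apply/measurable_EFinP; apply: measurable_funX; exact: L2_measurable.
have mh : measurable_fun setT h by exact: measurable_fun_limn_einf.
have h0 x : (0 <= h x)%E.
  by apply: (@limn_einf_ge _ _ _ 0%N) => n _; rewrite lee_fin sqr_ge0.
have hint : nu.-integrable setT h.
  apply/integrableP; split=> //.
  under eq_integral do rewrite gee0_abs//.
  apply: (@le_lt_trans _ _ (C ^+ 2)%:E); last by rewrite ltry.
  apply: le_trans (fatou nu measurableT mS _) _.
    by move=> n x _; rewrite lee_fin sqr_ge0.
  by apply: limn_einf_le => n; rewrite -L2norm_leP.
have := integrable_ae measurableT hint.
apply: filterS => x /= /(_ I) hx; exists (Num.sqrt (fine (h x))) => n.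
have S0 m : 0 <= S m x by apply: sumr_ge0 => i _; exact: normr_ge0.
rewrite -(ger0_norm (S0 n)) -sqrtr_sqr ler_wsqrtr// -lee_fin fineK//.
apply: (@limn_einf_ge _ _ _ n) => m nm.
by rewrite lee_fin ler_pXn2r ?nnegrE// S_nd.
Qed.

(** Riesz-Fischer, for sequences with geometric steps: such a sequence converges
    almost everywhere, and Fatou's lemma turns the bounds on [u n - u (n + m)]
    into a bound on the distance to the limit. *)
Lemma L2_limit_exists : exists2 l, l \in L2 &
  forall n, L2norm (u n - l) <= D * r ^+ n / (1 - r).
Proof.
(* The limsup is measurable whether or not the sequence converges everywhere. *)
pose l x := fine (limn_esup (fun n => (u n x)%:E)).
have ml : measurable_fun setT l.
  apply: measurableT_comp => //; apply: measurable_fun_limn_esup => n.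
  by apply/measurable_EFinP; exact: L2_measurable.
have ul : \forall x \ae nu, (fun n => u n x) @ \oo --> l x.
  apply: filterS S_bounded => x [M SM].
  have cvg_u : cvgn (fun n => u n x).
    have : cvgn (series (telescope (fun n => u n x))).
      apply: normed_cvg; apply: nondecreasing_is_cvgn; first exact: S_nd.
      by exists M => _ [n _ <-]; exact: SM.
    rewrite telescopeK => /cvgD/(_ (@cvg_cst _ (u 0%N x) _ \oo _)).
    move/cvgP; congr (cvgn _); apply/funext => n; exact: subrK.
  have [L uL'] := (cvg_ex _).1 cvg_u.
  suff -> : l x = L by [].
  rewrite /l; have -> := (cvg_limn_einf_sup (l := L%:E) _).2 => //.
  by apply/fine_cvgP; split; [exact: nearW | exact: uL'].
have key n : (\int[nu]_x ((u n - l) x ^+ 2)%:E <= ((C * r ^+ n) ^+ 2)%:E)%E.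
  pose F m x := ((u n x - u (n + m)%N x) ^+ 2)%:E.
  have mF m : measurable_fun setT (F m).
    apply/measurable_EFinP; apply: measurable_funX.
    by apply: measurable_funB; exact: L2_measurable.
  have F0 m x : (0 <= F m x)%E by rewrite lee_fin sqr_ge0.
  have -> : (\int[nu]_x ((u n - l) x ^+ 2)%:E =
      \int[nu]_x limn_einf (F^~ x))%E.
    apply: ge0_ae_eq_integral => //.
    - apply/measurable_EFinP; apply: measurable_funX.
      by apply: measurable_funB => //; exact: L2_measurable.
    - exact: measurable_fun_limn_einf.
    - by move=> x _; rewrite lee_fin sqr_ge0.
    - by move=> x _; apply: (@limn_einf_ge _ _ _ 0%N).
    apply: filterS ul => x ux _.
    rewrite (cvg_limn_einf_sup (l := ((u n - l) x ^+ 2)%:E) _).1 //.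
    apply/fine_cvgP; split; first exact: nearW.
    rewrite (_ : _ \o _ = fun m => (u n x - u (n + m)%N x) ^+ 2)//.
    have ux' : (fun m => u (n + m)%N x) @ \oo --> l x.
      rewrite (_ : (fun m => _) = fun m => u (m + n)%N x).
        by rewrite (cvg_shiftn n (fun m => u m x)).
      by apply/funext => m; rewrite addnC.
    by apply: cvgM; apply: cvgB => //; exact: cvg_cst.
  apply: le_trans (fatou nu measurableT mF _) _ => //.
  apply: limn_einf_le => m; rewrite -[leLHS]/(\int[nu]_x ((u n - u (n + m)%N) x ^+ 2)%:E)%E.
  rewrite -L2norm_leP ?L2_sub ?(mulr_ge0 C_ge0) ?exprn_ge0//.
  rewrite -L2normN opprB.
  rewrite (_ : u (n + m)%N - u n = \sum_(n <= k < n + m) (u k.+1 - u k)).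
    by apply: norm_sum => // k; rewrite L2_sub.
  by rewrite telescope_sumr ?leq_addr.
have lL : l \in L2.
  rewrite -[l](subKr (u 0%N)) L2_sub//; apply/L2P; split.
    by apply: measurable_funB => //; exact: L2_measurable.
  by apply: le_lt_trans (key 0%N) _; rewrite ltry.
exists l => // n; rewrite L2norm_leP ?L2_sub//.
  by apply: le_trans (key n) _; rewrite /C mulrAC.
by rewrite mulrAC mulr_ge0 ?exprn_ge0.
Qed.
End Limit.

End L2Complete.

(** * Marginals of functions of two variables *)

Section L2CauchySchwarz.
Context d (X : measurableType d) (R : realType).
Variable nu : {measure set X -> \bar R}.
Local Notation E := (LfunType nu (lee1n 2)).
Implicit Types f g : X -> R.

Lemma L2ip_sqr_le f g : f \in Lfun nu 2%:E -> g \in Lfun nu 2%:E ->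
  L2ip nu f g ^+ 2 <= L2ip nu f f * L2ip nu g g.
Proof.
move=> fL gL.
exact: (ip_sqr_le (@Lfun_ip_linear _ _ _ nu) (fun f g : E => L2ip_sym nu f g)
  (fun f : E => L2ip_ge0 nu f) (Lfun_Sub (lee1n 2) fL) (Lfun_Sub (lee1n 2) gL)).
Qed.

Lemma ae_eq_Rintegral f g : measurable_fun setT f -> measurable_fun setT g ->
  f = g %[ae nu] -> \int[nu]_x f x = \int[nu]_x g x.
Proof.
move=> mf mg fg; congr fine; apply: ae_eq_integral => //.
- exact/measurable_EFinP.
- exact/measurable_EFinP.
- by apply: filterS fg => x fgx _; rewrite fgx.
Qed.

End L2CauchySchwarz.

Section Product.
Context d (T : measurableType d) (R : realType).
Variable mu : {finite_measure set T -> \bar R}.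
Local Notation nu := (finite_product mu mu).
Implicit Types (f g : T * T -> R) (u v : T -> R).

Definition swap_fun f : T * T -> R := fun x => f (x.2, x.1).

Lemma measurable_swap_pair : measurable_fun setT (fun x : T * T => (x.2, x.1)).
Proof. exact: measurable_swap. Qed.

Lemma measurable_swap_fun f : measurable_fun setT f ->
  measurable_fun setT (swap_fun f).
Proof. by move=> mf; apply: (measurableT_comp mf); exact: measurable_swap_pair. Qed.

(** Tonelli's theorem with the two orders of integration. *)
Lemma ge0_integral_swap (F : T * T -> \bar R) : measurable_fun setT F ->
  (forall x, (0 <= F x)%E) ->
  (\int[nu]_x F (x.2, x.1) = \int[nu]_x F x)%E.
Proof.
move=> mF F0.
have mF' : measurable_fun setT (fun x => F (x.2, x.1)).
  by apply: (measurableT_comp mF); exact: measurable_swap_pair.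
rewrite -[LHS]/(\int[(mu \x mu)]_x F (x.2, x.1))%E.
rewrite -[RHS]/(\int[(mu \x mu)]_x F x)%E.
by rewrite fubini_tonelli1// fubini_tonelli2.
Qed.

Lemma ae_swap (P : set (T * T)) : (\forall x \ae nu, P x) ->
  \forall x \ae nu, P (x.2, x.1).
Proof.
move=> [A [mA A0 PA]]; exists [set x | A (x.2, x.1)]; split.
- rewrite -[X in measurable X]setTI; exact: measurable_swap_pair.
- have mA' : measurable [set x : T * T | A (x.2, x.1)].
    by rewrite -[X in measurable X]setTI; exact: measurable_swap_pair.
  have nuE (B : set (T * T)) : measurable B ->
      nu B = (\int[nu]_x (\1_B x)%:E)%E.
    by move=> mB; rewrite integral_indic// setIT.
  rewrite nuE// -A0 [RHS]nuE// -(@ge0_integral_swap (fun x => (\1_A x)%:E))//.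
  by apply/measurable_EFinP; exact: measurable_indic.
- by move=> x /= nPx; apply: PA.
Qed.

Lemma Rintegral_swap f : measurable_fun setT f ->
  \int[nu]_x swap_fun f x = \int[nu]_x f x.
Proof.
move=> mf; congr fine; rewrite integralE [in RHS]integralE.
have mF : measurable_fun setT (EFin \o f) by exact/measurable_EFinP.
congr (_ - _)%E.
  rewrite -[RHS](ge0_integral_swap (measurable_funepos mF) (funepos_ge0 _)).
  by apply: eq_integral => x _; rewrite !funeposE.
rewrite -[RHS](ge0_integral_swap (measurable_funeneg mF) (funeneg_ge0 _)).
by apply: eq_integral => x _; rewrite !funenegE.
Qed.

Lemma L2ip_swap f g : measurable_fun setT f -> measurable_fun setT g ->
  L2ip nu (swap_fun f) (swap_fun g) = L2ip nu f g.
Proof. by move=> mf mg; rewrite -[RHS]Rintegral_swap//; exact: measurable_funM. Qed.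

Lemma L2_swap f : f \in Lfun nu 2%:E -> swap_fun f \in Lfun nu 2%:E.
Proof.
move=> /L2P[mf ff]; apply/L2P; split; first exact: measurable_swap_fun.
rewrite (@ge0_integral_swap (fun x => (f x ^+ 2)%:E))//.
  by apply/measurable_EFinP; exact: measurable_funX.
by move=> x; rewrite lee_fin sqr_ge0.
Qed.

Lemma ae_sections (P : set (T * T)) : (\forall x \ae nu, P x) ->
  \forall p \ae mu, \forall q \ae mu, P (p, q).
Proof.
move=> [A [mA A0 PA]].
have mx : measurable_fun setT (mu \o xsection A) by exact: measurable_fun_xsection.
have : (\int[mu]_p `|(mu \o xsection A) p|)%E = 0%E.
  by under eq_integral do rewrite gee0_abs//; exact: A0.
move=> /(ae_eq_integral_abs mu measurableT mx).
apply: filterS => p /= /(_ I) Ap0; exists (xsection A p); split => //.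
  exact: measurable_xsection.
by move=> q /= nP; rewrite /xsection /= inE; apply: PA.
Qed.

Lemma ae_fst (P : set T) : (\forall p \ae mu, P p) -> \forall x \ae nu, P x.1.
Proof.
move=> [A [mA A0 PA]]; exists (A `*` setT); split.
- exact: measurableX.
- have -> : nu (A `*` setT) = (mu A * mu setT)%E by exact: product_measure1E.
  by rewrite A0 mul0e.
- by move=> x /= nP; split=> //; exact: PA.
Qed.

Lemma ae_snd (P : set T) : (\forall p \ae mu, P p) -> \forall x \ae nu, P x.2.
Proof. by move=> /ae_fst/ae_swap. Qed.

Definition marginal f : T -> R := fun p => \int[mu]_q f (p, q).

Lemma L2_integrable_product f : f \in Lfun nu 2%:E -> nu.-integrable setT (EFin \o f).
Proof.
move=> fL; apply/Lfun1_integrable; apply: Lfun_subset12 fL.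
exact: fin_num_measure.
Qed.

Lemma measurable_section f p : measurable_fun setT f ->
  measurable_fun setT (fun q => f (p, q)).
Proof. by move=> mf; apply: (measurableT_comp mf); exact: measurable_pair1. Qed.

Lemma measurable_marginal f : nu.-integrable setT (EFin \o f) ->
  measurable_fun setT (marginal f).
Proof.
move=> fi; apply: measurableT_comp => //.
exact: (@measurable_fubini_F _ _ T T R mu mu (EFin \o f)).
Qed.

Lemma L2_measurable_marginal f : f \in Lfun nu 2%:E ->
  measurable_fun setT (marginal f).
Proof. by move=> fL; apply: measurable_marginal; exact: L2_integrable_product. Qed.

Lemma ae_section_L2 f : f \in Lfun nu 2%:E ->
  \forall p \ae mu, (fun q => f (p, q)) \in Lfun mu 2%:E.
Proof.
move=> fL; have [mf ff] := (L2P nu f).1 fL.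
have i2 := Lfun2_integrable_sqr fL.
have := @ae_integrable1 _ _ T T R mu mu (EFin \o (fun x => f x ^+ 2)) i2.
apply: filterS => p /integrableP[_ ip]; apply/L2P; split.
  exact: measurable_section.
apply: le_lt_trans ip; apply: ge0_le_integral => //.
- by move=> x _; rewrite lee_fin sqr_ge0.
- apply/measurable_EFinP; apply: measurable_funX; exact: measurable_section.
- apply: measurableT_comp => //; apply/measurable_EFinP; apply: measurable_funX.
  exact: measurable_section.
- by move=> q _; rewrite lee_fin ler_norm.
Qed.

Definition total_mass : R := fine (mu setT).

Lemma L2ip1 u : L2ip mu u (fun=> 1) = \int[mu]_q u q.
Proof. by apply: eq_Rintegral => q _; rewrite mulr1. Qed.

Lemma L2_cst c : (fun=> c) \in Lfun mu 2%:E.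
Proof.
apply/L2P; split=> //.
rewrite integral_cst// ltey_eq fin_numM// fin_num_measure//.
Qed.

Lemma Rintegral_sqr_le u : u \in Lfun mu 2%:E ->
  (\int[mu]_q u q) ^+ 2 <= total_mass * L2ip mu u u.
Proof.
move=> uL; rewrite -L2ip1; apply: le_trans (L2ip_sqr_le uL (L2_cst 1)) _.
rewrite mulrC ler_wpM2r ?L2ip_ge0// L2ip1 Rintegral_cst// mul1r//.
Qed.

(** Fubini's theorem for the product of two [L2] functions, whose sections are
    almost everywhere in [L2]. *)
Lemma L2ip_sections f g : f \in Lfun nu 2%:E -> g \in Lfun nu 2%:E ->
  L2ip nu f g = \int[mu]_p L2ip mu (fun q => f (p, q)) (fun q => g (p, q)).
Proof.
move=> fL gL; have fg := L2_mul_integrable fL gL.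
rewrite /L2ip /Rintegral -[X in fine X]integral12_prod_meas1//.
congr fine; apply: ae_eq_integral => //.
- exact: measurable_fubini_F fg.
- apply: measurableT_comp => //; apply: measurableT_comp => //.
  exact: measurable_fubini_F fg.
have := ae_integrable1 fg; apply: filterS => p ip _ /=.
rewrite fineK//; exact: integrable_fin_num.
Qed.

(** Integrating out a variable is bounded because the total mass is finite:
    Cauchy-Schwarz on almost every section. *)
Lemma L2_marginal f : f \in Lfun nu 2%:E -> marginal f \in Lfun mu 2%:E /\
  L2ip mu (marginal f) (marginal f) <= total_mass * L2ip nu f f.
Proof.
move=> fL.
have mm : measurable_fun setT (fun p => (marginal f p ^+ 2)%:E).
  by apply/measurable_EFinP; apply: measurable_funX; exact: L2_measurable_marginal.
have i1 : nu.-integrable setT (EFin \o (fun x => f x * f x)).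
  exact: L2_mul_integrable.
have le : (\int[mu]_p (marginal f p ^+ 2)%:E <= (total_mass * L2ip nu f f)%:E)%E.
  rewrite EFinM [X in (_ * X%:E)%E](_ : L2ip nu f f = fine (\int[nu]_x (f x * f x)%:E))//.
  rewrite [X in (_ * X)%E]fineK; last exact: (integrable_fin_num measurableT i1).
  rewrite -[X in (_ * X)%E]integral12_prod_meas1// -ge0_integralZl//; first last.
  - by rewrite lee_fin fine_ge0.
  - by move=> p _; apply: integral_ge0 => q _; rewrite lee_fin -expr2 sqr_ge0.
  - exact: measurable_fubini_F i1.
  apply: ae_ge0_le_integral => //.
  - by move=> p _; rewrite lee_fin sqr_ge0.
  - move=> p _; apply: mule_ge0; first by rewrite lee_fin fine_ge0.
    by apply: integral_ge0 => q _; rewrite lee_fin -expr2 sqr_ge0.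
  - apply: measurable_funeM; exact: measurable_fubini_F i1.
  apply: filterS (ae_section_L2 fL) => p pL _.
  rewrite /fubini_F; under eq_integral do rewrite -expr2.
  rewrite -[X in (_ * X)%E](L2ip_sqrE pL) -EFinM lee_fin.
  exact: Rintegral_sqr_le.
split.
  apply/L2P; split; first exact: L2_measurable_marginal.
  by apply: le_lt_trans le _; rewrite ltry.
rewrite -lee_fin L2ip_sqrE//.
apply/L2P; split; first exact: L2_measurable_marginal.
by apply: le_lt_trans le _; rewrite ltry.
Qed.

Lemma L2_fst u : u \in Lfun mu 2%:E -> (fun x => u x.1) \in Lfun nu 2%:E /\
  L2ip nu (fun x => u x.1) (fun x => u x.1) = total_mass * L2ip mu u u.
Proof.
move=> uL.
have e : (\int[nu]_x (u x.1 ^+ 2)%:E = (total_mass * L2ip mu u u)%:E)%E.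
  rewrite -[LHS]/(\int[(mu \x mu)]_x (u x.1 ^+ 2)%:E)%E fubini_tonelli1//=.
  - rewrite /fubini_F /=.
    under eq_integral do rewrite integral_cst//.
    rewrite ge0_integralZr//.
    + rewrite -L2ip_sqrE// EFinM muleC; congr (_ * _)%E.
      by rewrite /total_mass fineK//; exact: fin_num_measure.
    + apply/measurable_EFinP; apply: measurable_funX; exact: L2_measurable uL.
    + by move=> x _; rewrite lee_fin sqr_ge0.
  - apply/measurable_EFinP; apply: measurable_funX.
    by apply: measurableT_comp => //; exact: L2_measurable uL.
  - by move=> x; rewrite lee_fin sqr_ge0.
have uL' : (fun x => u x.1) \in Lfun nu 2%:E.
  apply/L2P; split; last by rewrite e ltry.
  by apply: measurableT_comp => //; exact: L2_measurable uL.
by split=> //; apply: EFin_inj; rewrite L2ip_sqrE.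
Qed.

(** [marginal] is adjoint to [u |-> fun x => u x.1]. *)
Lemma L2ip_marginal u g : u \in Lfun mu 2%:E -> g \in Lfun nu 2%:E ->
  L2ip nu (fun x => u x.1) g = L2ip mu u (marginal g).
Proof.
move=> uL gL; rewrite L2ip_sections//; last exact: (L2_fst uL).1.
apply: ae_eq_Rintegral.
- apply: (@measurable_marginal (fun x => u x.1 * g x)).
  exact: L2_mul_integrable (L2_fst uL).1 gL.
- apply: measurable_funM; [exact: L2_measurable uL | exact: L2_measurable_marginal].
have := ae_integrable1 (L2_integrable_product gL).
apply: filterS => p ip _.
by rewrite -[LHS]/(\int[mu]_q (u p * g (p, q))) RintegralZl.
Qed.

End Product.

(** * The Hamiltonian on real antisymmetric functions *)

Section L2Bilinear.
Context d (X : measurableType d) (R : realType).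
Variable nu : {measure set X -> \bar R}.
Local Notation L2 := (Lfun nu 2%:E).
Implicit Types f g h : X -> R.

Lemma L2ipDl f g h : f \in L2 -> g \in L2 -> h \in L2 ->
  L2ip nu (f + g) h = L2ip nu f h + L2ip nu g h.
Proof. by move=> fL gL hL; rewrite -[f in LHS]scale1r L2ip_linear// mul1r. Qed.

Lemma L2ipZl a f h : f \in L2 -> h \in L2 ->
  L2ip nu (a *: f) h = a * L2ip nu f h.
Proof.
move=> fL hL; rewrite /L2ip -RintegralZl//; last exact: L2_mul_integrable.
by apply: eq_Rintegral => x _; rewrite fctE mulrA.
Qed.

Lemma L2ipBl f g h : f \in L2 -> g \in L2 -> h \in L2 ->
  L2ip nu (f - g) h = L2ip nu f h - L2ip nu g h.
Proof.
move=> fL gL hL; rewrite L2ipDl//; last by rewrite -scaleN1r L2_scale.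
by rewrite -scaleN1r L2ipZl// mulN1r.
Qed.

Lemma L2norm_eq0 f : f \in L2 -> L2norm nu f = 0 <-> f = (fun=> 0) %[ae nu].
Proof.
move=> fL; rewrite -(L2ip_eq0 fL) /L2norm; split=> [/eqP|->].
  by rewrite sqrtr_eq0 => h; apply/eqP; rewrite eq_le h L2ip_ge0.
exact: sqrtr0.
Qed.

Lemma L2normZ a f : f \in L2 -> L2norm nu (a *: f) = `|a| * L2norm nu f.
Proof.
move=> fL; rewrite /L2norm L2ipZl ?L2_scale// L2ip_sym L2ipZl// mulrA -expr2.
by rewrite sqrtrM ?sqr_ge0// sqrtr_sqr.
Qed.

Lemma L2norm_le f g : measurable_fun setT f -> g \in L2 ->
  (forall x, `|f x| <= `|g x|) -> L2norm nu f <= L2norm nu g.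
Proof.
move=> mf gL fg; have fL := L2_le mf gL fg.
rewrite L2norm_leP ?L2norm_ge0// sqr_sqrtr ?L2ip_ge0// L2ip_sqrE//.
apply: ge0_le_integral => //.
- by move=> x _; rewrite lee_fin sqr_ge0.
- by apply/measurable_EFinP; exact: measurable_funX.
- by apply/measurable_EFinP; apply: measurable_funX; exact: L2_measurable gL.
- move=> x _; rewrite lee_fin -[_ ^+ 2]real_normK ?num_real//.
  by rewrite -[leRHS]real_normK ?num_real// ler_pXn2r ?nnegrE.
Qed.

Lemma ae_eq_L2norm f g : measurable_fun setT f -> measurable_fun setT g ->
  f = g %[ae nu] -> L2norm nu f = L2norm nu g.
Proof.
move=> mf mg fg; congr Num.sqrt; apply: ae_eq_Rintegral; try exact: measurable_funM.
by apply: filterS fg => x e xT; rewrite e.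
Qed.

End L2Bilinear.

Section Hamiltonian.
Context d (T : measurableType d) (R : realType).
Variable mu : {finite_measure set T -> \bar R}.
Local Notation nu := (finite_product mu mu).
Local Notation L2 := (Lfun nu 2%:E).
Local Notation M := (total_mass mu).
Implicit Types (f g : T * T -> R) (u v : T -> R).

Lemma total_mass_ge0 : 0 <= M.
Proof. exact: fine_ge0. Qed.

Lemma L2norm_marginal f : f \in L2 ->
  L2norm nu (fun x => marginal mu f x.1) <= M * L2norm nu f.
Proof.
move=> fL; have [mL mle] := L2_marginal fL.
rewrite /L2norm (L2_fst mL).2 -[M in leRHS]ger0_norm ?total_mass_ge0//.
rewrite -sqrtr_sqr -sqrtrM ?sqr_ge0// ler_wsqrtr// expr2 -mulrA.
by rewrite ler_wpM2l// total_mass_ge0.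
Qed.

Lemma L2norm_swap f : f \in L2 -> L2norm nu (swap_fun f) = L2norm nu f.
Proof. by move=> /L2_measurable mf; rewrite /L2norm L2ip_swap. Qed.

Lemma swap_funK f : swap_fun (swap_fun f) = f.
Proof. by apply/funext => -[]. Qed.

Lemma ae_eq_marginal f g : f \in L2 -> g \in L2 -> f = g %[ae nu] ->
  marginal mu f = marginal mu g %[ae mu].
Proof.
move=> fL gL fg.
have : \forall x \ae nu, f x = g x by apply: filterS fg => x; exact.
move/ae_sections; apply: filterS => p fgp _; apply: ae_eq_Rintegral.
- exact: measurable_section (L2_measurable fL).
- exact: measurable_section (L2_measurable gL).
- by apply: filterS fgp => q e _.
Qed.

Variables (En : T * T -> R) (k E1 : R).
Hypothesis mEn : measurable_fun setT En.
Hypothesis En_sym : forall p q, En (q, p) = En (p, q).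
Hypothesis En_bnd : forall x, `|En x| <= E1.

(** The real form of the three-particle operator: a multiplication minus a
    contact interaction in each of the two fermion-boson channels. *)
Definition ham f : T * T -> R := fun x =>
  En x * f x - k * marginal mu f x.1 - k * marginal mu (swap_fun f) x.2.

Let pot f : T * T -> R := fun x => marginal mu f x.1.

Lemma hamE f : ham f = En * f - k *: pot f - k *: swap_fun (pot (swap_fun f)).
Proof. by []. Qed.

Lemma L2_mulE f : f \in L2 -> En * f \in L2.
Proof.
move=> fL; apply: (@L2_le _ _ _ _ _ (E1 *: f)); last 2 first.
- exact: L2_scale.
- move=> x; rewrite !fctE !normrM ler_wpM2r//.
  by apply: le_trans (En_bnd x) _; exact: ler_norm.
by apply: measurable_funM => //; exact: L2_measurable fL.
Qed.

Lemma L2_pot f : f \in L2 -> pot f \in L2.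
Proof. by move=> fL; exact: (L2_fst (L2_marginal fL).1).1. Qed.

Lemma L2_ham f : f \in L2 -> ham f \in L2.
Proof.
move=> fL; rewrite hamE !L2_sub ?L2_mulE ?L2_scale ?L2_swap ?L2_pot//.
by rewrite L2_swap.
Qed.

(** Each interaction term is the square of a marginal as a quadratic form, which
    gives both symmetry and, for [0 <= k], its sign. *)
Lemma L2ip_ham f g : f \in L2 -> g \in L2 -> L2ip nu (ham f) g =
  L2ip nu (En * f) g - k * L2ip mu (marginal mu f) (marginal mu g)
  - k * L2ip mu (marginal mu (swap_fun f)) (marginal mu (swap_fun g)).
Proof.
move=> fL gL; have sfL := L2_swap fL; have sgL := L2_swap gL.
rewrite hamE !L2ipBl ?L2_sub ?L2_mulE ?L2_scale ?L2_swap ?L2_pot//.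
rewrite !L2ipZl ?L2_swap ?L2_pot//; congr (_ - k * _ - k * _).
  exact: L2ip_marginal (L2_marginal fL).1 gL.
rewrite -{1}[g]swap_funK L2ip_swap.
- exact: L2ip_marginal (L2_marginal sfL).1 sgL.
- exact: L2_measurable (L2_pot sfL).
- exact: L2_measurable sgL.
Qed.

Lemma ham_sym f g : f \in L2 -> g \in L2 ->
  L2ip nu (ham f) g = L2ip nu f (ham g).
Proof.
move=> fL gL; rewrite [RHS]L2ip_sym (L2ip_ham fL gL) (L2ip_ham gL fL).
rewrite (L2ip_sym _ (marginal mu f)) (L2ip_sym _ (marginal mu (swap_fun f))).
congr (_ - _ - _); apply: eq_Rintegral => x _; rewrite !fctE; ring.
Qed.

Lemma ham_bounded f : f \in L2 ->
  L2norm nu (ham f) <= (`|E1| + 2 * `|k| * M) * L2norm nu f.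
Proof.
move=> fL; have sfL := L2_swap fL.
have eL := L2_mulE fL; have pL := L2_pot fL.
have qL := L2_swap (L2_pot sfL).
have h1 : L2norm nu (En * f) <= `|E1| * L2norm nu f.
  rewrite -L2normZ//; apply: L2norm_le; first exact: L2_measurable eL.
    exact: L2_scale.
  move=> x; rewrite !fctE !normrM ler_wpM2r//.
  by apply: le_trans (En_bnd x) _; exact: ler_norm.
have bnd (h : T * T -> R) : h \in L2 -> L2norm nu h <= M * L2norm nu f ->
    L2norm nu (- (k *: h)) <= `|k| * M * L2norm nu f.
  by move=> hL hM; rewrite L2normN L2normZ// -mulrA ler_wpM2l.
have h2 := bnd _ pL (L2norm_marginal fL).
have h3 : L2norm nu (- (k *: swap_fun (pot (swap_fun f)))) <= `|k| * M * L2norm nu f.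
  apply: bnd => //; rewrite L2norm_swap ?L2_pot//.
  by rewrite -(L2norm_swap fL); exact: L2norm_marginal.
have NL (h : T * T -> R) : h \in L2 -> - (k *: h) \in L2.
  by move=> hL; rewrite -scaleN1r !L2_scale.
rewrite hamE; apply: le_trans (L2normD _ _) _; rewrite ?L2_add ?NL//.
apply: le_trans (lerD (le_trans (L2normD eL (NL _ pL)) (lerD h1 h2)) h3) _.
by rewrite le_eqVlt; apply/orP; left; apply/eqP; ring.
Qed.

(** A boolean predicate, so that the antisymmetric functions form a submodule
    and inherit a module structure. *)
Definition antisymL2 : {pred T * T -> R} :=
  [pred f | (f \in L2) && `[< f = - swap_fun f %[ae nu] >] ].

Lemma antisymL2P f : f \in antisymL2 <-> f \in L2 /\ f = - swap_fun f %[ae nu].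
Proof. by rewrite inE; split=> [/andP[? /asboolP]|[-> /asboolP]]. Qed.

Lemma antisymL2_submod_closed : submod_closed antisymL2.
Proof.
split.
  by apply/antisymL2P; split; [exact: L2_zero|apply: nearW => x _; rewrite !fctE oppr0].
move=> a f g /antisymL2P[fL fa] /antisymL2P[gL ga]; apply/antisymL2P; split.
  exact: L2_lincomb.
apply: filterS2 fa ga => x fx gx _; move: (fx I) (gx I).
by rewrite /swap_fun !fctE => -> ->; rewrite opprD scalerN.
Qed.

Lemma antisym_marginal f : f \in antisymL2 ->
  marginal mu f = - marginal mu (swap_fun f) %[ae mu].
Proof.
move=> /antisymL2P[fL fa]; have sfL := L2_swap fL.
have NsL : - swap_fun f \in L2 by rewrite -scaleN1r L2_scale.
apply: filterS2 (ae_eq_marginal fL NsL fa)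
  (ae_integrable1 (L2_integrable_product sfL)) => p e ip pT; rewrite e//.
have -> : (- marginal mu (swap_fun f)) p =
  -1 * \int[mu]_q swap_fun f (p, q) by rewrite mulN1r.
rewrite -RintegralZl//.
by apply: eq_Rintegral => q _; rewrite mulN1r.
Qed.

Lemma ham_antisym f : f \in antisymL2 -> ham f \in antisymL2.
Proof.
move=> fA; have fm := antisym_marginal fA.
have /antisymL2P[fL fa] := fA; apply/antisymL2P; split; first exact: L2_ham.
have h1 := ae_fst fm; have h2 := ae_snd fm.
apply: filterS3 fa h1 h2 => -[p q] e1 e2 e3 _.
move: (e1 I) (e2 I) (e3 I); rewrite !fctE /= => {}e1 {}e2 {}e3.
have -> : swap_fun (ham f) (p, q) = En (p, q) * swap_fun f (p, q)
    - k * marginal mu f q - k * marginal mu (swap_fun f) p.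
  by rewrite /swap_fun /= /ham /= En_sym.
have -> : ham f (p, q) = En (p, q) * f (p, q)
    - k * marginal mu f p - k * marginal mu (swap_fun f) q by [].
rewrite e1 e2 e3; ring.
Qed.

End Hamiltonian.

Section Antisymmetric.
Context d (T : measurableType d) (R : realType).
Variable mu : {finite_measure set T -> \bar R}.
Local Notation nu := (finite_product mu mu).

HB.instance Definition _ :=
  GRing.isSubmodClosed.Build R (T * T -> R) (antisymL2 mu)
    (antisymL2_submod_closed mu).

Record antisym := Antisym
  { antisym_fun : T * T -> R; _ : antisym_fun \in antisymL2 mu }.

HB.instance Definition _ := [isSub for antisym_fun].
HB.instance Definition _ := [Choice of antisym by <:].
HB.instance Definition _ := [SubChoice_isSubLmodule of antisym by <:].

Definition antisym_ip (f g : antisym) : R :=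
  L2ip nu (antisym_fun f) (antisym_fun g).

Lemma antisym_L2 (f : antisym) : antisym_fun f \in Lfun nu 2%:E.
Proof. by case: f => f /= /antisymL2P[]. Qed.

Lemma antisym_ip_linear a (f g h : antisym) :
  antisym_ip (a *: f + g) h = a * antisym_ip f h + antisym_ip g h.
Proof. by apply: L2ip_linear; exact: antisym_L2. Qed.

Lemma antisym_ip_sym (f g : antisym) : antisym_ip f g = antisym_ip g f.
Proof. exact: L2ip_sym. Qed.

Lemma antisym_ip_ge0 (f : antisym) : 0 <= antisym_ip f f.
Proof. exact: L2ip_ge0. Qed.

Lemma antisym_normE (f : antisym) :
  ipnorm antisym_ip f = L2norm nu (antisym_fun f).
Proof. by []. Qed.

(** The limit in [L2] need not be antisymmetric everywhere, only almost
    everywhere: the swap is an isometry, so [l] and [- swap_fun l] are both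
    limits of the same sequence. *)
Lemma antisym_complete : geometrically_complete antisym_ip.
Proof.
move=> u D r r0 r1 step.
have [l lL lP] := L2_limit_exists r0 r1 (fun n => antisym_L2 (u n)) step.
suff la : l \in antisymL2 mu by exists (Antisym la).
apply/antisymL2P; split=> //.
have lsL : l + swap_fun l \in Lfun nu 2%:E by rewrite L2_add ?L2_swap.
have : L2norm nu (l + swap_fun l) = 0.
  apply/eqP; rewrite eq_le L2norm_ge0 andbT.
  apply: (geometric_le0 (C := 2 * D / (1 - r)) r0 r1) => n.
  pose v := antisym_fun (u n); have vL : v \in Lfun nu 2%:E by exact: antisym_L2.
  have -> : L2norm nu (l + swap_fun l) = L2norm nu ((l - v) + swap_fun (l - v)).
    apply: ae_eq_L2norm.
    - exact: L2_measurable lsL.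
    - by apply: L2_measurable (nu) _ _; rewrite L2_add ?L2_swap ?L2_sub.
    have /antisymL2P[_] : v \in antisymL2 mu by rewrite /v; case: (u n).
    by apply: filterS => x e _; move: (e I); rewrite /swap_fun !fctE => ->; ring.
  apply: le_trans (L2normD _ _) _; rewrite ?L2_swap ?L2_sub//.
  rewrite L2norm_swap ?L2_sub//.
  have := lP n; rewrite -L2normN opprB -/v; set x := D * _ / _ => h.
  have -> : 2 * D / (1 - r) * r ^+ n = x + x by rewrite /x; ring.
  exact: lerD.
move/(L2norm_eq0 lsL); apply: filterS => x e _; move: (e I); rewrite !fctE.
by move/eqP; rewrite addr_eq0 => /eqP.
Qed.

Section Op.
Variables (En : T * T -> R) (k E1 : R).
Hypothesis mEn : measurable_fun setT En.
Hypothesis En_sym : forall p q, En (q, p) = En (p, q).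
Hypothesis En_bnd : forall x, `|En x| <= E1.

Definition antisym_ham (f : antisym) : antisym :=
  Antisym (ham_antisym k mEn En_sym En_bnd (valP f)).

Lemma antisym_ham_sym : symmetric_op antisym_ip antisym_ham.
Proof.
by move=> f g; exact: (ham_sym k mEn En_bnd (antisym_L2 f) (antisym_L2 g)).
Qed.

Lemma antisym_ham_bounded : exists B, forall f,
  ipnorm antisym_ip (antisym_ham f) <= B * ipnorm antisym_ip f.
Proof.
exists (`|E1| + 2 * `|k| * total_mass mu) => f; rewrite !antisym_normE.
exact: (ham_bounded k mEn En_bnd (antisym_L2 f)).
Qed.

End Op.
End Antisymmetric.

(** * From real to complex functions *)

(** The operator has real coefficients, so it acts separately on the real and
    imaginary parts of a function. Statements about its spectrum thus reduce
    to estimates on real antisymmetric functions. *)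
Section Complexification.
Context d (T : measurableType d) (R : realType).
Variable mu : {finite_measure set T -> \bar R}.
Local Notation nu := (finite_product mu mu).
Local Notation L2 := (Lfun nu 2%:E).
Local Notation E := (antisym mu).
Local Notation N := (ipnorm (@antisym_ip _ _ _ mu)).

Definition repart (f : T * T -> R[i]) : T * T -> R := fun x => complex.Re (f x).
Definition impart (f : T * T -> R[i]) : T * T -> R := fun x => complex.Im (f x).

Definition cantisym : set (T * T -> R[i]) :=
  [set f | cL2 nu f /\ f = (fun pq => - f (pq.2, pq.1)) %[ae nu]].

Lemma complexE (z : R[i]) : z = Complex (complex.Re z) (complex.Im z).
Proof. by case: z. Qed.

Lemma ReD (z w : R[i]) : complex.Re (z + w) = complex.Re z + complex.Re w.
Proof. by case: z; case: w. Qed.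
Lemma ImD (z w : R[i]) : complex.Im (z + w) = complex.Im z + complex.Im w.
Proof. by case: z; case: w. Qed.
Lemma ReN (z : R[i]) : complex.Re (- z) = - complex.Re z.
Proof. by case: z. Qed.
Lemma ImN (z : R[i]) : complex.Im (- z) = - complex.Im z.
Proof. by case: z. Qed.
Lemma ReM (z w : R[i]) : complex.Re (z * w) =
  complex.Re z * complex.Re w - complex.Im z * complex.Im w.
Proof. by case: z; case: w. Qed.
Lemma ImM (z w : R[i]) : complex.Im (z * w) =
  complex.Re z * complex.Im w + complex.Im z * complex.Re w.
Proof. by case: z; case: w. Qed.

Lemma eq_ReIm (z w : R[i]) : complex.Re z = complex.Re w ->
  complex.Im z = complex.Im w -> z = w.
Proof. by case: z; case: w => ? ? ? ? /= -> ->. Qed.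

Lemma cantisymP (f : T * T -> R[i]) : cantisym f <->
  repart f \in antisymL2 mu /\ impart f \in antisymL2 mu.
Proof.
split=> [[[rL iL] fa]|[/antisymL2P[rL ra] /antisymL2P[iL ia]]].
  split; apply/antisymL2P; split=> //; apply: filterS fa => x e _.
    by rewrite /repart e// ReN.
  by rewrite /impart e// ImN.
split=> //; apply: filterS2 ra ia => x r i _.
by apply: eq_ReIm; [rewrite ReN; exact: r|rewrite ImN; exact: i].
Qed.

Definition cfun (u v : T * T -> R) : T * T -> R[i] :=
  fun x => Complex (u x) (v x).

Lemma cantisym_cfun (u v : E) : cantisym (cfun (antisym_fun u) (antisym_fun v)).
Proof. by apply/cantisymP; split; [case: u|case: v]. Qed.

Lemma cantisym_ex (f : T * T -> R[i]) : cantisym f ->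
  exists u v : E, f = cfun (antisym_fun u) (antisym_fun v).
Proof.
move=> /cantisymP[r i]; exists (Antisym r), (Antisym i).
by apply/funext => x; rewrite /cfun /= -complexE.
Qed.

Lemma cL2norm_cfun (u v : T * T -> R) : u \in L2 -> v \in L2 ->
  cL2norm nu (cfun u v) = Num.sqrt (L2ip nu u u + L2ip nu v v).
Proof.
move=> uL vL; rewrite /cL2norm L2_normE.
have -> : (\int[nu]_x (((fun y => Normc.normc (cfun u v y)) x) ^+ 2)%:E =
    (L2ip nu u u + L2ip nu v v)%:E)%E.
  rewrite EFinD !L2ip_sqrE// -ge0_integralD//.
  - apply: eq_integral => x _; rewrite -EFinD; congr EFin.
    by rewrite /= sqr_sqrtr// addr_ge0 ?sqr_ge0.
  - by move=> x _; rewrite lee_fin sqr_ge0.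
  - by apply/measurable_EFinP; apply: measurable_funX; exact: L2_measurable uL.
  - by move=> x _; rewrite lee_fin sqr_ge0.
  - by apply/measurable_EFinP; apply: measurable_funX; exact: L2_measurable vL.
by rewrite poweR_EFin /= powR12_sqrt// addr_ge0 ?L2ip_ge0.
Qed.

Lemma antisym_norm_sqr (u : E) : L2ip nu (antisym_fun u) (antisym_fun u) = N u ^+ 2.
Proof. by rewrite sqr_sqrtr// L2ip_ge0. Qed.

Lemma cL2norm_antisym (u v : E) :
  cL2norm nu (cfun (antisym_fun u) (antisym_fun v)) =
  Num.sqrt (N u ^+ 2 + N v ^+ 2).
Proof. by rewrite cL2norm_cfun ?antisym_L2// !antisym_norm_sqr. Qed.

Lemma antisym_null (u : E) : N u = 0 <-> antisym_fun u = (fun=> 0) %[ae nu].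
Proof. exact: L2norm_eq0 (antisym_L2 u). Qed.

Lemma antisym_nullB (u v : E) : N (u - v) = 0 <->
  antisym_fun u = antisym_fun v %[ae nu].
Proof.
rewrite antisym_null; split; apply: filterS => x /(_ I) e _.
  by apply/eqP; rewrite -subr_eq0; apply/eqP.
by rewrite -[LHS]/(antisym_fun u x - antisym_fun v x) e subrr.
Qed.

Section Operator.
Variables (En : T * T -> R) (k E1 : R).
Hypothesis mEn : measurable_fun setT En.
Hypothesis En_sym : forall p q, En (q, p) = En (p, q).
Hypothesis En_bnd : forall x, `|En x| <= E1.

Definition cham (f : T * T -> R[i]) (pq : T * T) : R[i] :=
  (En pq)%:C%C * f pq
  - k%:C%C * cintegral mu (fun q' => f (pq.1, q'))
  - k%:C%C * cintegral mu (fun p' => f (p', pq.2)).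

Local Notation H := (antisym_ham k mEn En_sym En_bnd).

Lemma cham_cfun (u v : T * T -> R) :
  cham (cfun u v) = cfun (ham mu En k u) (ham mu En k v).
Proof.
apply/funext => x; apply: eq_ReIm.
  by rewrite /cham !(ReD, ReN, ReM) /= !mul0r !subr0.
by rewrite /cham !(ImD, ImN, ImM) /= !mul0r !addr0.
Qed.

(** The real part of [(H - (a + i b)) (u + i v)]; the imaginary part is
    [shiftR a (- b) v u]. *)
Definition shiftR a b (u v : E) : E := H u - a *: u + b *: v.

Lemma cham_shift a b (u v : E) :
  (fun x => cham (cfun (antisym_fun u) (antisym_fun v)) x -
            Complex a b * cfun (antisym_fun u) (antisym_fun v) x) =
  cfun (antisym_fun (shiftR a b u v)) (antisym_fun (shiftR a (- b) v u)).
Proof.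
rewrite cham_cfun; apply/funext => x; apply: eq_ReIm.
  rewrite !(ReD, ReN, ReM)/= -[RHS]/(_ - a * _ + b * _).
  by rewrite opprB addrA addrAC.
rewrite !(ImD, ImN, ImM)/= -[RHS]/(_ - a * _ + - b * _).
by rewrite opprD addrA mulNr.
Qed.

Local Notation spec := (spectrum nu cantisym cham).
Local Notation res := (resolvent_set nu cantisym cham).

Lemma resolventI (a b C : R) :
  (forall g1 g2 : E, exists u v,
     N (shiftR a b u v - g1) = 0 /\ N (shiftR a (- b) v u - g2) = 0) ->
  (forall u v, N u ^+ 2 + N v ^+ 2 <=
     C * (N (shiftR a b u v) ^+ 2 + N (shiftR a (- b) v u) ^+ 2)) ->
  res (Complex a b).
Proof.
move=> surj low; split.
  move=> g /cantisym_ex[g1 [g2 ->]].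
  have [u [v [h1 h2]]] := surj g1 g2.
  exists (cfun (antisym_fun u) (antisym_fun v)); first exact: cantisym_cfun.
  apply: filterS2 ((antisym_nullB _ _).1 h1) ((antisym_nullB _ _).1 h2).
  move=> x e1 e2 _.
  etransitivity; first exact: (congr1 (fun h => h x) (cham_shift a b u v)).
  by rewrite /cfun e1// e2.
exists (Num.sqrt `|C|) => f /cantisym_ex[u [v ->]].
rewrite cham_shift !cL2norm_antisym -sqrtrM// ler_wsqrtr//.
apply: le_trans (low u v) _; rewrite ler_wpM2r ?ler_norm// addr_ge0 ?sqr_ge0//.
Qed.

Let symH : symmetric_op (@antisym_ip _ _ _ mu) H.
Proof. exact: antisym_ham_sym. Qed.

Let symS a := symmetric_op_shift (@antisym_ip_linear _ _ _ mu)
  (@antisym_ip_sym _ _ _ mu) symH a.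

Let bndS (a : R) : exists B, forall f : E, N (H f - a *: f) <= B * N f.
Proof.
have [B BP] := antisym_ham_bounded mu k mEn En_sym En_bnd.
exists (B + `|a|) => f.
exact: (bounded_op_shift (@antisym_ip_linear _ _ _ mu)
  (@antisym_ip_sym _ _ _ mu) (@antisym_ip_ge0 _ _ _ mu) BP).
Qed.

Lemma nonreal_resolvent (a b : R) : b != 0 -> res (Complex a b).
Proof.
move=> b0; have [B BP] := bndS a.
apply: (@resolventI a b (b ^+ 2)^-1).
  move=> g1 g2.
  have [u [v [h1 h2]]] := nonreal_surjective (@antisym_ip_linear _ _ _ mu)
    (@antisym_ip_sym _ _ _ mu) (@antisym_ip_ge0 _ _ _ mu)
    (@antisym_complete _ _ _ mu) (symS a) BP b0 g1 g2.
  exists u, v; split; first exact: h1.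
  by rewrite /shiftR scaleNr; exact: h2.
move=> u v; rewrite ler_pdivlMl ?lt_neqAle ?sqr_ge0 ?andbT 1?eq_sym ?sqrf_eq0//.
rewrite /shiftR scaleNr !(ipnorm_sqr (@antisym_ip_ge0 _ _ _ mu)).
exact: (nonreal_bounded_below (@antisym_ip_linear _ _ _ mu)
  (@antisym_ip_sym _ _ _ mu) (@antisym_ip_ge0 _ _ _ mu) (symS a)).
Qed.

Lemma bounded_below_resolvent (a C : R) : (forall f : E, N f <= C * N (H f - a *: f)) ->
  res (Complex a 0).
Proof.
move=> low; have [B BP] := bndS a.
have surj := bounded_below_surjective (@antisym_ip_linear _ _ _ mu)
    (@antisym_ip_sym _ _ _ mu) (@antisym_ip_ge0 _ _ _ mu)
    (@antisym_complete _ _ _ mu) (symS a) BP low.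
have s0 u v b : b = 0 -> shiftR a b u v = H u - a *: u.
  by move=> ->; rewrite /shiftR scale0r addr0.
apply: (@resolventI a 0 (C ^+ 2)) => [g1 g2|u v].
  have [u hu] := surj g1; have [v hv] := surj g2; exists u, v.
  by rewrite !s0 ?oppr0.
rewrite !s0 ?oppr0// mulrDr -!exprMn.
have sq f : N f ^+ 2 <= (C * N (H f - a *: f)) ^+ 2.
  have := low f => h; rewrite ler_pXn2r ?nnegrE ?sqrtr_ge0//.
  by apply: le_trans h; exact: sqrtr_ge0.
exact: lerD.
Qed.

Lemma approximate_spectrum (a : R) :
  (forall e, 0 < e -> exists f : E, N f != 0 /\ N (H f - a *: f) <= e * N f) ->
  spec (Complex a 0).
Proof.
move=> app [_ [C CP]].
have [f [f0 fe]] := app (`|C| + 1)^-1 (ltac:(by rewrite invr_gt0 ltr_wpDl)).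
have := CP _ (cantisym_cfun f 0); rewrite cham_shift !cL2norm_antisym.
have z0 : shiftR a (- 0) 0 f = H 0 - a *: 0 by rewrite /shiftR oppr0 scale0r addr0.
have [B BP] := bndS a.
have n0 : N 0 = 0 by exact: (ipnorm0 (@antisym_ip_linear _ _ _ mu)).
have h0 : N (H 0 - a *: 0) = 0.
  apply/eqP; rewrite eq_le sqrtr_ge0 andbT; have := BP 0; by rewrite n0 mulr0.
rewrite z0 h0 n0 /shiftR scale0r addr0 expr0n/= !addr0 !sqrtr_sqr.
rewrite !ger0_norm ?sqrtr_ge0// => h.
have fpos : 0 < N f by rewrite lt_neqAle eq_sym f0 sqrtr_ge0.
have : N f < N f; last by rewrite ltxx.
apply: le_lt_trans h _; apply: (@le_lt_trans _ _ (`|C| * N (H f - a *: f))).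
  by rewrite ler_wpM2r ?sqrtr_ge0// ler_norm.
apply: (@le_lt_trans _ _ (`|C| * ((`|C| + 1)^-1 * N f))).
  by rewrite ler_wpM2l.
by rewrite mulrA gtr_pMl// ltr_pdivrMr ?mul1r ?ltrDl// ltr_wpDl.
Qed.

(** Such an [a] is either in the resolvent set or an isolated eigenvalue of
    finite multiplicity. Isolation needs the hypothesis also at the nearby [w]:
    there the kernel is trivial by [semi_fredholm_isolated], and only then does
    the semi-Fredholm bound become a bound from below. *)
Lemma semi_fredholm_not_essential (a dl : R) : 0 < dl ->
  (forall w, `|w - a| < dl -> semi_fredholm (@antisym_ip _ _ _ mu) H w) ->
  ~ essential_spectrum nu cantisym cham (Complex a 0).
Proof.
move=> dl0 sf [spa]; apply.
have sfa : semi_fredholm (@antisym_ip _ _ _ mu) H a.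
  by apply: sf; rewrite subrr normr0.
have [B BP] := antisym_ham_bounded mu k mEn En_sym En_bnd.
have below w : semi_fredholm (@antisym_ip _ _ _ mu) H w ->
    (forall f : E, N (H f - w *: f) = 0 -> N f = 0) -> res (Complex w 0).
  move=> sfw ker.
  have [C CP] := semi_fredholm_bounded_below (@antisym_ip_linear _ _ _ mu)
    (@antisym_ip_sym _ _ _ mu) (@antisym_ip_ge0 _ _ _ mu)
    (@antisym_complete _ _ _ mu) symH BP sfw ker.
  exact: bounded_below_resolvent CP.
have eigE (u v : E) : N (H u - a *: u) = 0 -> N (H v - a *: v) = 0 ->
    L2_eigenspace nu cantisym cham (Complex a 0)
      (cfun (antisym_fun u) (antisym_fun v)).
  move=> u0 v0; split; first exact: cantisym_cfun.
  have := cham_shift a 0 u v; rewrite /shiftR oppr0 !scale0r !addr0 => e.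
  apply: filterS2 ((antisym_null _).1 u0) ((antisym_null _).1 v0) => x e1 e2 _.
  apply/eqP; rewrite -subr_eq0; apply/eqP.
  by rewrite (congr1 (fun h => h x) e) /cfun e1// e2.
split.
- split=> //.
  have [r r0 rP] := semi_fredholm_isolated (@antisym_ip_linear _ _ _ mu)
    (@antisym_ip_sym _ _ _ mu) (@antisym_ip_ge0 _ _ _ mu)
    (@antisym_complete _ _ _ mu) symH BP sfa.
  exists (Num.min r dl); first by rewrite lt_min r0.
  move=> -[w b] spw; have [->|b0] := eqVneq b 0; last first.
    by move: spw => []; exact: nonreal_resolvent.
  rewrite [Normc.normc _](_ : _ = `|w - a|); last first.
    by rewrite /= subr0 expr0n addr0 sqrtr_sqr.
  rewrite lt_min => /andP[wr wd].
  have [->//|wa] := eqVneq w a.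
  exfalso; move: spw; have [->|b0'] := eqVneq b 0; last first.
    by apply; exact: nonreal_resolvent.
  apply; apply: below; first exact: sf.
  by move=> f; exact: rP.
- apply: contrapT => noeig; apply: spa; apply: below => // f f0.
  apply: contrapT => fN; apply: noeig.
  exists (cfun (antisym_fun f) (antisym_fun f)); first exact: eigE.
  move=> e; apply: fN; apply/antisym_null; apply: filterS e => x /(_ I) ex _.
  by have := congr1 (@complex.Re R) ex.
- have [n [e [eN span]]] := semi_fredholm_finite_multiplicity
    (@antisym_ip_linear _ _ _ mu) (@antisym_ip_sym _ _ _ mu)
    (@antisym_ip_ge0 _ _ _ mu) symH sfa.
  have z0 : N (H 0 - a *: 0) = 0.
    have [B' BP'] := bndS a.
    apply/eqP; rewrite eq_le sqrtr_ge0 andbT; have := BP' 0.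
    by rewrite (ipnorm0 (@antisym_ip_linear _ _ _ mu)) mulr0.
  exists n, (fun i => cfun (antisym_fun (e i)) (antisym_fun (0 : E))); split.
    by move=> i; apply: eigE.
  move=> f [/cantisym_ex[u [v ->]] fe].
  have := cham_shift a 0 u v; rewrite /shiftR oppr0 !scale0r !addr0 => she.
  have [u0 v0] : N (H u - a *: u) = 0 /\ N (H v - a *: v) = 0.
    split; apply/antisym_null; apply: filterS fe => x /(_ I) fx _.
      etransitivity; first exact: (esym (congr1 (fun h => complex.Re (h x)) she)).
      by cbv beta; rewrite fx subrr.
    etransitivity; first exact: (esym (congr1 (fun h => complex.Im (h x)) she)).
    by cbv beta; rewrite fx subrr.
  have [c cP] := span u u0; have [c' c'P] := span v v0.
  exists (fun i => Complex (c i) (c' i)).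
  have sumE (g : 'I_n -> R) x : antisym_fun (\sum_i g i *: e i) x =
      \sum_i g i * antisym_fun (e i) x.
    elim/big_rec2 : _ => // i y z _ <-.
    by [].
  apply: filterS2 ((antisym_nullB _ _).1 cP) ((antisym_nullB _ _).1 c'P).
  move=> x /(_ I) e1 /(_ I) e2 _; rewrite /cfun e1 e2 !sumE.
  elim/big_rec3 : _ => // i x1 x2 x3 _ <-.
  have -> : antisym_fun (0 : E) x = 0 :> R by [].
  by apply: eq_ReIm; rewrite ?(ReD, ImD, ReM, ImM) /= mulr0 ?subr0 ?add0r.
Qed.

End Operator.
End Complexification.

(** * The channel equation below the threshold *)

Section L2Monotone.
Context d (X : measurableType d) (R : realType).
Variable nu : {measure set X -> \bar R}.
Local Notation L2 := (Lfun nu 2%:E).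
Implicit Types f g : X -> R.

Lemma L2norm_le_ae f g : f \in L2 -> g \in L2 ->
  (\forall x \ae nu, `|f x| <= `|g x|) -> L2norm nu f <= L2norm nu g.
Proof.
move=> fL gL fg.
rewrite L2norm_leP ?L2norm_ge0// sqr_sqrtr ?L2ip_ge0// L2ip_sqrE//.
apply: ae_ge0_le_integral => //.
- by move=> x _; rewrite lee_fin sqr_ge0.
- by apply/measurable_EFinP; apply: measurable_funX; exact: L2_measurable fL.
- by move=> x _; rewrite lee_fin sqr_ge0.
- by apply/measurable_EFinP; apply: measurable_funX; exact: L2_measurable gL.
- apply: filterS fg => x fgx _; rewrite lee_fin -[_ ^+ 2]real_normK ?num_real//.
  by rewrite -[leRHS]real_normK ?num_real// ler_pXn2r ?nnegrE.
Qed.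

Lemma L2_norm f : f \in L2 -> (fun x => `|f x|) \in L2.
Proof.
move=> fL; apply: (@L2_le _ _ _ _ _ f) => // [|x]; last by rewrite normr_id.
by apply: measurableT_comp => //; exact: L2_measurable fL.
Qed.

Lemma L2norm_norm f : L2norm nu (fun x => `|f x|) = L2norm nu f.
Proof.
congr Num.sqrt; apply: eq_Rintegral => x _.
by rewrite -expr2 real_normK ?num_real// expr2.
Qed.

Lemma L2_mul_bounded (w f : X -> R) c : measurable_fun setT w ->
  (forall x, `|w x| <= c) -> f \in L2 -> w * f \in L2.
Proof.
move=> mw wc fL; apply: (@L2_le _ _ _ _ _ (c *: f)); last 2 first.
- exact: L2_scale.
- move=> x; rewrite !fctE !normrM ler_wpM2r//.
  by apply: le_trans (wc x) _; exact: ler_norm.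
by apply: measurable_funM => //; exact: L2_measurable fL.
Qed.

Lemma L2norm_mul_bounded (w f : X -> R) c : measurable_fun setT w ->
  (forall x, `|w x| <= c) -> f \in L2 -> 0 <= c ->
  L2norm nu (w * f) <= c * L2norm nu f.
Proof.
move=> mw wc fL c0; rewrite -[c in leRHS](ger0_norm c0) -L2normZ//.
apply: L2norm_le; rewrite ?L2_scale//.
  by apply: L2_measurable (nu) _ _; exact: L2_mul_bounded wc fL.
move=> x; rewrite !fctE !normrM (ger0_norm c0) ler_wpM2r//.
Qed.

End L2Monotone.

Section FiniteMeasure.
Context d (T : measurableType d) (R : realType).
Variable mu : {finite_measure set T -> \bar R}.
Local Notation M := (total_mass mu).
Local Notation L2 := (Lfun mu 2%:E).
Implicit Types u w : T -> R.

Lemma L2_integrable u : u \in L2 -> mu.-integrable setT (EFin \o u).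
Proof.
move=> uL; apply/Lfun1_integrable; apply: Lfun_subset12 uL.
exact: fin_num_measure.
Qed.

Lemma bounded_L2 u c : measurable_fun setT u -> (forall x, `|u x| <= c) ->
  u \in L2.
Proof.
move=> mu' uc; apply: L2_le (L2_cst mu c) _ => // x.
by apply: le_trans (uc x) _; exact: ler_norm.
Qed.

Lemma L2norm_cst c : L2norm mu (fun=> c) = `|c| * Num.sqrt M.
Proof.
rewrite /L2norm /L2ip Rintegral_cst// sqrtrM -?expr2 ?sqr_ge0//.
by rewrite sqrtr_sqr.
Qed.

Lemma Rintegral_norm_le u : u \in L2 ->
  \int[mu]_x `|u x| <= Num.sqrt M * L2norm mu u.
Proof.
move=> uL; have nL := L2_norm uL.
rewrite -(L2norm_norm mu u) -sqrtrM ?total_mass_ge0//.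
apply: le_trans (ler_norm _) _.
by rewrite -sqrtr_sqr ler_wsqrtr// Rintegral_sqr_le.
Qed.

End FiniteMeasure.

(** Here [phi] stands for an antisymmetric function, [g] for its image under
    [H - w], [W] for [1 / (En - w)], and [F], [F2] for the two marginals of
    [phi]; [phiE] is the equation [(H - w) phi = g] solved for [phi]. *)
Section ChannelEquation.
Context d (T : measurableType d) (R : realType).
Variable mu : {finite_measure set T -> \bar R}.
Local Notation nu := (finite_product mu mu).
Local Notation M := (total_mass mu).
Variables (k dd dl : R) (W phi g : T * T -> R) (F F2 : T -> R).
Hypotheses (dd_gt0 : 0 < dd) (dl_gt0 : 0 < dl).
Hypothesis mW : measurable_fun setT W.
Hypothesis W_bnd : forall x, `|W x| <= dd^-1.
Hypothesis dlP : forall p, dl <= 1 - k * \int[mu]_q W (p, q).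
Hypotheses (gL : g \in Lfun nu 2%:E) (FL : F \in Lfun mu 2%:E).
Hypothesis F2L : F2 \in Lfun mu 2%:E.
Hypothesis F_def : forall p, F p = \int[mu]_q phi (p, q).
Hypothesis phiE : forall x, phi x = W x * (g x + k * F x.1 + k * F2 x.2).
Hypothesis F2_norm : L2norm mu F2 = L2norm mu F.

Let mWp p : measurable_fun setT (fun q => W (p, q)).
Proof. exact: measurable_section mW. Qed.

(** Integrating [phiE] over [q]: a scalar equation for [F] in which the
    interaction in the same channel has become a factor. *)
Let channel_eq : \forall p \ae mu, F p * (1 - k * \int[mu]_q W (p, q)) =
  \int[mu]_q (W (p, q) * g (p, q)) + k * \int[mu]_q (W (p, q) * F2 q).
Proof.
apply: filterS (ae_section_L2 gL) => p gp.
have i1 : mu.-integrable setT (EFin \o (fun q => W (p, q) * g (p, q))).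
  apply: L2_integrable.
  exact: (L2_mul_bounded (mWp p) (fun q => W_bnd (p, q)) gp).
have i2 : mu.-integrable setT (EFin \o (fun q => W (p, q))).
  by apply: L2_integrable; exact: (bounded_L2 mu (mWp p) (fun q => W_bnd (p, q))).
have i3 : mu.-integrable setT (EFin \o (fun q => W (p, q) * F2 q)).
  apply: L2_integrable.
  exact: (L2_mul_bounded (mWp p) (fun q => W_bnd (p, q)) F2L).
have i2' : mu.-integrable setT (EFin \o (fun q => k * F p * W (p, q))).
  by rewrite (_ : _ \o _ = fun q => ((k * F p)%:E * (W (p, q))%:E)%E)//;
    exact: integrableZl.
have i3' : mu.-integrable setT (EFin \o (fun q => k * (W (p, q) * F2 q))).
  by rewrite (_ : _ \o _ = fun q => (k%:E * (W (p, q) * F2 q)%:E)%E)//;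
    exact: integrableZl.
have i12 : mu.-integrable setT
    (EFin \o (fun q => W (p, q) * g (p, q) + k * F p * W (p, q))).
  rewrite (_ : _ \o _ = (fun q => (W (p, q) * g (p, q))%:E) \+
    (fun q => (k * F p * W (p, q))%:E))//; exact: integrableD.
have FE : F p = \int[mu]_q (W (p, q) * g (p, q) + k * F p * W (p, q) +
    k * (W (p, q) * F2 q)).
  by rewrite [LHS]F_def; apply: eq_Rintegral => q _; rewrite phiE /=; ring.
rewrite mulrBr mulr1 {1}FE RintegralD// RintegralD// !RintegralZl//.
ring.
Qed.

(** The coupling to the other channel is replaced by an approximation [l], because
    only finitely many of its values can be kept as functionals. *)
Let channel_bound (S e : R) : 0 <= S -> 0 <= e ->
  (forall p, exists2 l, `|l| <= S & `|\int[mu]_q (W (p, q) * F2 q) - l| <= e) ->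
  dl * L2norm mu F <=
  dd^-1 * Num.sqrt M * L2norm nu g + `|k| * (S + e) * Num.sqrt M.
Proof.
move=> S0 e0 near_l.
pose G p := dd^-1 * marginal mu (fun x => `|g x|) p.
have ngL := L2_norm gL.
have [mngL mng] := L2_marginal ngL.
have GL : G \in Lfun mu 2%:E by rewrite [G](_ : _ = dd^-1 *: marginal mu (fun x => `|g x|)) ?L2_scale.
pose c := `|k| * (S + e).
have le : \forall p \ae mu, `|(dl *: F) p| <= `|(G + (fun=> c)) p|.
  apply: filterS2 channel_eq (ae_section_L2 gL) => p eqp gp.
  rewrite !fctE normrM (gtr0_norm dl_gt0).
  have G0 : 0 <= G p.
    by apply: mulr_ge0; [rewrite invr_ge0 ltW | exact: Rintegral_ge0].
  have c0 : 0 <= c by rewrite mulr_ge0 ?addr_ge0.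
  rewrite (ger0_norm (addr_ge0 G0 c0)).
  apply: (@le_trans _ _ (`|F p * (1 - k * \int[mu]_q W (p, q))|)).
    rewrite normrM mulrC ler_wpM2l//.
    by apply: le_trans (dlP p) _; exact: ler_norm.
  rewrite eqp; apply: le_trans (ler_normD _ _) _; apply: lerD.
    have i1 : mu.-integrable setT (EFin \o (fun q => W (p, q) * g (p, q))).
      apply: L2_integrable.
      exact: (L2_mul_bounded (mWp p) (fun q => W_bnd (p, q)) gp).
    have i2 : mu.-integrable setT (EFin \o (fun q => `|g (p, q)|)).
      by apply: L2_integrable; exact: L2_norm.
    apply: le_trans (le_normr_Rintegral _ _) _ => //.
    have -> : G p = \int[mu]_q (dd^-1 * `|g (p, q)|).
      by rewrite (RintegralZl _ measurableT i2).
    apply: le_Rintegral => //.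
    - apply: L2_integrable; apply: L2_norm.
      exact: (L2_mul_bounded (mWp p) (fun q => W_bnd (p, q)) gp).
    - apply: L2_integrable; exact: (L2_scale dd^-1 (L2_norm gp)).
    - by move=> q _; rewrite normrM ler_wpM2r.
  rewrite normrM ler_wpM2l//; have [l lS le] := near_l p.
  rewrite -[X in `|X|](subrK l) addrC; apply: le_trans (ler_normD _ _) _.
  exact: lerD.
have := L2norm_le_ae (L2_scale dl FL) (L2_add GL (L2_cst mu c)) le.
rewrite L2normZ// (gtr0_norm dl_gt0) => /le_trans; apply.
apply: le_trans (L2normD GL (L2_cst mu c)) _; apply: lerD; last first.
  by rewrite L2norm_cst ger0_norm// mulr_ge0 ?addr_ge0.
rewrite [G](_ : _ = dd^-1 *: marginal mu (fun x => `|g x|))// L2normZ//.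
have dd'0 : 0 <= dd^-1 by rewrite invr_ge0 ltW.
rewrite (ger0_norm dd'0) -mulrA ler_wpM2l//.
by rewrite -(L2norm_norm nu g) -sqrtrM ?total_mass_ge0// ler_wsqrtr.
Qed.

Let vector_bound : L2norm nu phi <= dd^-1 * (L2norm nu g
    + 2 * `|k| * Num.sqrt M * L2norm mu F).
Proof.
have [F1L F1n] := L2_fst FL; have [F2L' F2n] := L2_fst F2L.
have F2s : (fun x : T * T => F2 x.2) \in Lfun nu 2%:E by exact: (L2_swap F2L').
have n1 : L2norm nu (fun x => F x.1) = Num.sqrt M * L2norm mu F.
  by rewrite /L2norm F1n sqrtrM ?total_mass_ge0.
have n2 : L2norm nu (fun x : T * T => F2 x.2) = Num.sqrt M * L2norm mu F.
  rewrite -F2_norm -[LHS](L2norm_swap F2s) /L2norm -sqrtrM ?total_mass_ge0//.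
  by rewrite -F2n.
have -> : phi = W * (g + k *: (fun x => F x.1) + k *: (fun x => F2 x.2)).
  by apply/funext => x; rewrite phiE.
have sL : g + k *: (fun x => F x.1) + k *: (fun x : T * T => F2 x.2) \in Lfun nu 2%:E.
  apply: L2_add; last exact: L2_scale.
  by apply: L2_add => //; exact: L2_scale.
apply: le_trans (L2norm_mul_bounded mW W_bnd sL _) _; first by rewrite invr_ge0 ltW.
rewrite ler_wpM2l ?invr_ge0 ?(ltW dd_gt0)//.
apply: le_trans (L2normD _ _) _; rewrite ?L2_add ?L2_scale//.
apply: (@le_trans _ _ (L2norm nu g + `|k| * (Num.sqrt M * L2norm mu F) +
   `|k| * (Num.sqrt M * L2norm mu F))).
  apply: lerD; last by rewrite L2normZ// n2.
  by apply: le_trans (L2normD _ _) _; rewrite ?L2_scale// L2normZ// n1.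
by rewrite le_eqVlt; apply/orP; left; apply/eqP; ring.
Qed.

(** The coupling to the other channel is a compact operator of [F2]: along the
    finite net [c] its kernel takes finitely many values up to [e], and the
    error is absorbed into the left-hand side when [e] is small. *)
Lemma faddeev_bound (n : nat) (c : 'I_n -> T) (e : R) : 0 <= e ->
  (forall p, exists i, forall q, `|W (p, q) - W (c i, q)| <= e) ->
  `|k| * e * M <= dl / 2 ->
  L2norm nu phi <= dd^-1 * (1 + 4 * `|k| * M / (dl * dd)) * L2norm nu g +
    dd^-1 * 4 * `|k| ^+ 2 * M / dl *
    \sum_(i < n) `|\int[mu]_q (W (c i, q) * F2 q)|.
Proof.
move=> e0 net small.
set S := \sum_(i < n) _.
have S0 : 0 <= S by exact: sumr_ge0.
have sM := sqrtr_ge0 M; have sM2 : Num.sqrt M * Num.sqrt M = M.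
  by rewrite -expr2 sqr_sqrtr// total_mass_ge0.
have F0 := L2norm_ge0 mu F; have k0 := normr_ge0 k.
have e'0 : 0 <= e * (Num.sqrt M * L2norm mu F) by rewrite !mulr_ge0.
have := channel_bound S0 e'0.
have step : forall p, exists2 l, `|l| <= S &
    `|\int[mu]_q (W (p, q) * F2 q) - l| <= e * (Num.sqrt M * L2norm mu F).
  move=> p; have [i ip] := net p.
  exists (\int[mu]_q (W (c i, q) * F2 q)).
    by rewrite /S (bigD1 i)//= lerDl sumr_ge0.
  have int r : mu.-integrable setT (EFin \o (fun q => W (r, q) * F2 q)).
    apply: L2_integrable.
    exact: (L2_mul_bounded (mWp r) (fun q => W_bnd (r, q)) F2L).
  rewrite -RintegralB//.
  have dL : (fun q => W (p, q) * F2 q - W (c i, q) * F2 q) \in Lfun mu 2%:E.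
    apply: L2_sub; exact: (L2_mul_bounded (mWp _) (fun q => W_bnd (_, q)) F2L).
  apply: le_trans (le_normr_Rintegral _ _) _ => //; first exact: L2_integrable dL.
  rewrite -F2_norm; apply: le_trans (ler_wpM2l e0 (Rintegral_norm_le F2L)).
  rewrite -RintegralZl//; last by apply: L2_integrable; exact: L2_norm.
  apply: le_Rintegral => //.
  - by apply: L2_integrable; exact: L2_norm dL.
  - by apply: L2_integrable; exact: (L2_scale e (L2_norm F2L)).
  - by move=> q _; rewrite -mulrBl normrM ler_wpM2r.
move/(_ step).
move=> hF; clear step; apply: le_trans vector_bound _.
move: (L2norm nu g) (L2norm_ge0 nu g) hF => y y0 hF.
move: (L2norm mu F) F0 hF => z z0 hF; move: S S0 hF => S S0 hF.
move: (Num.sqrt M) sM sM2 hF => s s0 sM2 hF.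
have h1 : `|k| * e * M * z <= dl / 2 * z by rewrite ler_wpM2r.
have hz : dl / 2 * z <= dd^-1 * s * y + `|k| * S * s.
  have e1 : `|k| * (S + e * (s * z)) * s = `|k| * S * s + `|k| * e * M * z.
    by rewrite -sM2; ring.
  rewrite e1 in hF; lra.
have hz' : z <= 2 / dl * (dd^-1 * s * y + `|k| * S * s).
  rewrite -(ler_pM2l (_ : 0 < dl / 2)); last by rewrite divr_gt0.
  have -> // : dl / 2 * (2 / dl * (dd^-1 * s * y + `|k| * S * s)) =
    dd^-1 * s * y + `|k| * S * s by field; rewrite !gt_eqF.
have c0 : 0 <= 2 * `|k| * s by rewrite !mulr_ge0.
have := ler_wpM2l c0 hz'.
have -> : 2 * `|k| * s * (2 / dl * (dd^-1 * s * y + `|k| * S * s)) =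
  4 * `|k| * (s * s) / (dl * dd) * y + 4 * `|k| ^+ 2 * (s * s) / dl * S.
  by field; rewrite !gt_eqF.
rewrite sM2 => h2.
have -> : dd^-1 * (1 + 4 * `|k| * M / (dl * dd)) * y +
    dd^-1 * 4 * `|k| ^+ 2 * M / dl * S =
  dd^-1 * (y + (4 * `|k| * M / (dl * dd) * y + 4 * `|k| ^+ 2 * M / dl * S)).
  by ring.
by rewrite ler_wpM2l ?lerD2l// invr_ge0 ltW.
Qed.

End ChannelEquation.

Section Faddeev.
Context d (T : measurableType d) (R : realType).
Variable mu : {finite_measure set T -> \bar R}.
Local Notation nu := (finite_product mu mu).
Local Notation M := (total_mass mu).
Local Notation E := (antisym mu).
Local Notation N := (ipnorm (@antisym_ip _ _ _ mu)).
Variables (En : T * T -> R) (k E1 : R).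
Hypothesis mEn : measurable_fun setT En.
Hypothesis En_sym : forall p q, En (q, p) = En (p, q).
Hypothesis En_bnd : forall x, `|En x| <= E1.
Hypothesis En_net : forall e, 0 < e -> exists (n : nat) (c : 'I_n -> T),
  forall p, exists i, forall q, `|En (p, q) - En (c i, q)| <= e.
Local Notation H := (antisym_ham k mEn En_sym En_bnd).

Section AtEnergy.
Variables (w dd dl : R).
Hypothesis dd_gt0 : 0 < dd.
Hypothesis ddP : forall x, dd <= En x - w.
Hypothesis dl_gt0 : 0 < dl.
Hypothesis dlP : forall p, dl <= 1 - k * \int[mu]_q (En (p, q) - w)^-1.

Let W x := (En x - w)^-1.

Let W_ge0 x : 0 <= W x.
Proof. by rewrite invr_ge0 (le_trans _ (ddP x))// ltW. Qed.

Let W_bnd x : `|W x| <= dd^-1.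
Proof. by rewrite ger0_norm// lef_pV2 ?posrE// (lt_le_trans _ (ddP x)). Qed.

Let mW : measurable_fun setT W.
Proof.
rewrite (_ : W = fun x => (En x - w) `^ (-1)); last first.
  apply/funext => x; rewrite powR_inv1//.
  by apply: le_trans (ddP x); exact: ltW.
apply: (measurableT_comp (@measurable_powR R (-1))).
exact: measurable_funB.
Qed.

Let mWp p : measurable_fun setT (fun q => W (p, q)).
Proof. exact: measurable_section mW. Qed.

Let W_lip p p' q e : `|En (p, q) - En (p', q)| <= e ->
  `|W (p, q) - W (p', q)| <= e / dd ^+ 2.
Proof.
move=> h; have h1 := ddP (p, q); have h2 := ddP (p', q).
have n1 : En (p, q) - w != 0 by rewrite gt_eqF// (lt_le_trans dd_gt0).
have n2 : En (p', q) - w != 0 by rewrite gt_eqF// (lt_le_trans dd_gt0).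
have -> : W (p, q) - W (p', q) =
    - (En (p, q) - En (p', q)) * (W (p, q) * W (p', q)).
  by rewrite /W; field; rewrite n1 n2.
rewrite normrM normrN ler_pM// normrM expr2 invfM.
by rewrite ler_pM.
Qed.

Let FL (f : E) : marginal mu (antisym_fun f) \in Lfun mu 2%:E.
Proof. exact: (L2_marginal (antisym_L2 f)).1. Qed.

Let F2L (f : E) : marginal mu (swap_fun (antisym_fun f)) \in Lfun mu 2%:E.
Proof. exact: (L2_marginal (L2_swap (antisym_L2 f))).1. Qed.

Let phiE (f : E) x : antisym_fun f x = W x * (antisym_fun (H f - w *: f) x +
  k * marginal mu (antisym_fun f) x.1 +
  k * marginal mu (swap_fun (antisym_fun f)) x.2).
Proof.
have -> : antisym_fun (H f - w *: f) x = En x * antisym_fun f x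
    - k * marginal mu (antisym_fun f) x.1
    - k * marginal mu (swap_fun (antisym_fun f)) x.2 - w * antisym_fun f x by [].
have n1 : En x - w != 0 by rewrite gt_eqF// (lt_le_trans dd_gt0).
by rewrite /W; field.
Qed.

Let F2_norm (f : E) : L2norm mu (marginal mu (swap_fun (antisym_fun f))) =
  L2norm mu (marginal mu (antisym_fun f)).
Proof.
rewrite -[LHS]L2normN; apply: ae_eq_L2norm.
- by apply: measurableT_comp => //; exact: L2_measurable (F2L f).
- exact: L2_measurable (FL f).
have pA : antisym_fun f \in antisymL2 mu by case: (f).
by apply: filterS (antisym_marginal pA) => p e pT; exact/esym/e.
Qed.

(** The finitely many functionals are the integrals of the second marginal
    against [W (c i, _)] for a net [c]. *)
Lemma faddeev_semi_fredholm : semi_fredholm (@antisym_ip _ _ _ mu) H w.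
Proof.
(* The [+ 1] only keeps the denominator positive when [k] or the mass is zero. *)
pose e := dl / (2 * (`|k| * M + 1)).
have kM0 : 0 <= `|k| * M by rewrite mulr_ge0// total_mass_ge0.
have kM1 : 0 < `|k| * M + 1 by rewrite ltr_wpDl.
have e0 : 0 < e by rewrite divr_gt0// mulr_gt0.
have ke : `|k| * e * M <= dl / 2.
  rewrite mulrAC /e [2 * _]mulrC invfM mulrA mulrA ler_pM2r ?invr_gt0//.
  rewrite ler_pdivrMr//= mulrDr mulr1 mulrC lerDl ltW//.
have [n [c net]] := En_net (mulr_gt0 e0 (exprn_gt0 2 dd_gt0)).
(* Written as inner products, the functionals are visibly linear and bounded. *)
pose l (i : 'I_n) (f : E) :=
  L2ip nu (swap_fun (antisym_fun f)) (fun x => W (c i, x.1)).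
have WL i : (fun q => W (c i, q)) \in Lfun mu 2%:E.
  exact: (bounded_L2 mu (mWp (c i)) (fun q => W_bnd (c i, q))).
have WL' i : (fun x : T * T => W (c i, x.1)) \in Lfun nu 2%:E.
  exact: (L2_fst (WL i)).1.
have lE i f : l i f = \int[mu]_q (W (c i, q) * marginal mu (swap_fun (antisym_fun f)) q).
  rewrite /l L2ip_sym; exact: (L2ip_marginal (WL i) (L2_swap (antisym_L2 f))).
exists (Num.max (dd^-1 * (1 + 4 * `|k| * M / (dl * dd)))
   (dd^-1 * 4 * `|k| ^+ 2 * M / dl)).
exists [seq l i | i <- enum 'I_n]; split.
  move=> _ /mapP[i _ ->]; split.
    move=> a f g; rewrite /l -L2ip_linear ?L2_swap ?antisym_L2//.
  exists (L2norm nu (fun x => W (c i, x.1))) => f.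
  rewrite -[_ <= _](@ler_pXn2r _ 2) ?nnegrE ?mulr_ge0 ?L2norm_ge0//.
  rewrite real_normK ?num_real// exprMn.
  apply: le_trans (L2ip_sqr_le (L2_swap (antisym_L2 f)) (WL' i)) _.
  have mf := L2_measurable (antisym_L2 f).
  rewrite (L2ip_swap mu mf mf) antisym_norm_sqr mulrC.
  rewrite -[X in X * _](@sqr_sqrtr _ (L2ip _ _ _)) ?L2ip_ge0//.
move=> f; rewrite big_map big_enum mulrDr.
have net' p : exists i, forall q, `|W (p, q) - W (c i, q)| <= e.
  have [i ip] := net p; exists i => q.
  by have := W_lip (ip q); rewrite mulfK// gt_eqF// exprn_gt0.
have := faddeev_bound dd_gt0 dl_gt0 mW W_bnd dlP (antisym_L2 (H f - w *: f))
  (FL f) (F2L f) (fun=> erefl) (phiE f) (F2_norm f) (ltW e0) net' ke.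
rewrite -!antisym_normE => /le_trans; apply.
apply: lerD; first by rewrite ler_wpM2r ?sqrtr_ge0// le_max lexx.
rewrite (eq_bigr (fun i => `|l i f|)); last by move=> i _; rewrite lE.
by rewrite ler_wpM2r ?sumr_ge0// le_max lexx orbT.
Qed.

End AtEnergy.
End Faddeev.

(** * The upper bound and Weyl sequences *)

Section UpperBound.
Context d (T : measurableType d) (R : realType).
Variable mu : {finite_measure set T -> \bar R}.
Local Notation nu := (finite_product mu mu).
Local Notation E := (antisym mu).
Local Notation N := (ipnorm (@antisym_ip _ _ _ mu)).
Variables (En : T * T -> R) (k E1 : R).
Hypothesis mEn : measurable_fun setT En.
Hypothesis En_sym : forall p q, En (q, p) = En (p, q).
Hypothesis En_bnd : forall x, `|En x| <= E1.
Local Notation H := (antisym_ham k mEn En_sym En_bnd).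

(** The interaction is nonpositive as a quadratic form when [0 <= k], so [H] does
    not exceed the maximum of [En]. *)
Lemma bounded_below_above (E2 w : R) : 0 <= k -> (forall x, En x <= E2) ->
  E2 < w -> forall f : E, N f <= (w - E2)^-1 * N (H f - w *: f).
Proof.
move=> k0 EnE2 E2w f.
have wE : 0 < w - E2 by rewrite subr_gt0.
rewrite ler_pdivlMl//.
have fL := antisym_L2 f; set phi := antisym_fun f in fL.
have quad : L2ip nu (ham mu En k phi) phi <= E2 * L2ip nu phi phi.
  rewrite (L2ip_ham k mEn En_bnd fL fL).
  have e1 : L2ip nu (En * phi) phi <= E2 * L2ip nu phi phi.
    rewrite /L2ip -RintegralZl//; last exact: L2_mul_integrable.
    apply: le_Rintegral => //.
    - exact: L2_mul_integrable (L2_mulE mEn En_bnd fL) fL.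
    - rewrite (_ : EFin \o _ = fun x => (E2%:E * (phi x * phi x)%:E)%E)//.
      by apply: integrableZl => //; exact: L2_mul_integrable.
    - move=> x _; rewrite fctE -mulrA ler_wpM2r//.
      by rewrite -expr2 sqr_ge0.
  have := mulr_ge0 k0 (L2ip_ge0 mu (marginal mu phi)).
  have := mulr_ge0 k0 (L2ip_ge0 mu (marginal mu (swap_fun phi))).
  move: e1; move: (L2ip _ _ _) (L2ip _ _ _) (L2ip _ _ _) (L2ip _ _ _).
  move=> a b c e; lra.
have [f0|fN0] := eqVneq (N f) 0.
  by rewrite f0 mulr0 sqrtr_ge0.
have fpos : 0 < N f by rewrite lt_neqAle eq_sym fN0 sqrtr_ge0.
rewrite -(ler_pM2r fpos).
apply: (@le_trans _ _ `|antisym_ip (H f - w *: f) f|); last first.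
  exact: (ip_le (@antisym_ip_linear _ _ _ mu) (@antisym_ip_sym _ _ _ mu)
    (@antisym_ip_ge0 _ _ _ mu)).
rewrite -normrN; apply: le_trans (ler_norm _).
rewrite (ipBl (@antisym_ip_linear _ _ _ mu)) (ipZl (@antisym_ip_linear _ _ _ mu)).
rewrite -[antisym_ip (H f) f]/(L2ip nu (ham mu En k phi) phi).
rewrite -[antisym_ip f f]/(L2ip nu phi phi).
rewrite -mulrA -expr2 -antisym_norm_sqr -/phi.
move: quad; move: (L2ip _ _ _) (L2ip _ _ _) => a b; lra.
Qed.

End UpperBound.

Section Weyl.
Context d (T : measurableType d) (R : realType).
Variable mu : {finite_measure set T -> \bar R}.
Local Notation nu := (finite_product mu mu).
Local Notation M := (total_mass mu).
Local Notation E := (antisym mu).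
Local Notation N := (ipnorm (@antisym_ip _ _ _ mu)).
Variables (En : T * T -> R) (k E1 : R).
Hypothesis mEn : measurable_fun setT En.
Hypothesis En_sym : forall p q, En (q, p) = En (p, q).
Hypothesis En_bnd : forall x, `|En x| <= E1.
Local Notation H := (antisym_ham k mEn En_sym En_bnd).

Lemma ham_swap f : ham mu En k (swap_fun f) = swap_fun (ham mu En k f).
Proof.
apply/funext => -[p q].
rewrite -[LHS]/(En (p, q) * f (q, p) - k * marginal mu (swap_fun f) p -
  k * marginal mu (swap_fun (swap_fun f)) q).
rewrite -[RHS]/(En (q, p) * f (q, p) - k * marginal mu f q -
  k * marginal mu (swap_fun f) p).
by rewrite swap_funK En_sym addrAC.
Qed.

(** Marginals of functions that are not integrable on every section are additive
    only almost everywhere, hence the norm. *)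
Lemma ham_sub f g : f \in Lfun nu 2%:E -> g \in Lfun nu 2%:E ->
  L2norm nu (ham mu En k (f - g) - (ham mu En k f - ham mu En k g)) = 0.
Proof.
move=> fL gL.
have hL h : h \in Lfun nu 2%:E -> ham mu En k h \in Lfun nu 2%:E.
  exact: (L2_ham k mEn En_bnd).
have fgL := L2_sub fL gL.
have xL := L2_sub (hL _ fgL) (L2_sub (hL _ fL) (hL _ gL)).
rewrite /L2norm (_ : L2ip _ _ _ = 0) ?sqrtr0//.
set x := _ - _ in xL *; rewrite {1}/x.
rewrite (L2ipBl (hL _ fgL) (L2_sub (hL _ fL) (hL _ gL)) xL).
rewrite (L2ipBl (hL _ fL) (hL _ gL) xL).
rewrite (ham_sym k mEn En_bnd fgL xL) (ham_sym k mEn En_bnd fL xL).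
rewrite (ham_sym k mEn En_bnd gL xL) (L2ipBl fL gL (hL _ xL)).
by rewrite subrr.
Qed.

(** The trial function [1_A(p) psi(q)], antisymmetrized. For [p] in [A] the
    function [b] bounds the residual of [psi] in the fibre at [p]; the
    interaction in the other channel only sees the integral over [A], which is
    small with the measure of [A]. As [psi] vanishes on [A], the two terms of
    the antisymmetrization have disjoint supports and cannot cancel. *)
Section Trial.
Variables (A : set T) (psi b : T -> R) (w : R).
Hypothesis mA : measurable A.
Hypotheses (psiL : psi \in Lfun mu 2%:E) (bL : b \in Lfun mu 2%:E).
Hypothesis psiA : forall q, A q -> psi q = 0.
Hypothesis bP : forall p q, A p ->
  `|(En (p, q) - w) * psi q - k * \int[mu]_q psi q| <= `|b q|.

Let a := fine (mu A).

Let ia : T -> R := \1_A.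

Let iaL : ia \in Lfun mu 2%:E.
Proof.
apply: (@bounded_L2 _ _ _ mu ia 1); first exact: measurable_indic.
by move=> x; rewrite /ia indicE; case: (_ \in _); rewrite ?normr1 ?normr0.
Qed.

Let ia_int : \int[mu]_q ia q = a.
Proof. by rewrite /Rintegral integral_indic// setIT. Qed.

Let ia_norm : L2norm mu ia = Num.sqrt a.
Proof.
congr Num.sqrt; rewrite -ia_int; apply: eq_Rintegral => q _.
by rewrite /ia indicE; case: (_ \in _); rewrite ?mulr1 ?mulr0.
Qed.

Let tensor (u v : T -> R) : T * T -> R := fun x => u x.1 * v x.2.

Let mtensor u v : u \in Lfun mu 2%:E -> v \in Lfun mu 2%:E ->
  measurable_fun setT (tensor u v).
Proof.
move=> uL vL; apply: measurable_funM.
  by apply: measurableT_comp => //; exact: L2_measurable uL.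
by apply: measurableT_comp => //; exact: L2_measurable vL.
Qed.

Let tensorL u v : u \in Lfun mu 2%:E -> v \in Lfun mu 2%:E ->
  tensor u v \in Lfun nu 2%:E /\
  L2norm nu (tensor u v) = L2norm mu u * L2norm mu v.
Proof.
move=> uL vL.
have mt := mtensor uL vL.
have e : (\int[nu]_x (tensor u v x ^+ 2)%:E =
    (L2ip mu u u * L2ip mu v v)%:E)%E.
  rewrite -[LHS]/(\int[(mu \x mu)]_x (tensor u v x ^+ 2)%:E)%E.
  rewrite fubini_tonelli1//=; first last.
  - by move=> x; rewrite lee_fin sqr_ge0.
  - by apply/measurable_EFinP; exact: measurable_funX.
  rewrite /fubini_F (eq_integral (fun p => (u p ^+ 2)%:E * (L2ip mu v v)%:E)%E).
    rewrite ge0_integralZr//.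
    + by rewrite -L2ip_sqrE// EFinM.
    + by apply/measurable_EFinP; apply: measurable_funX; exact: L2_measurable uL.
    + by move=> x _; rewrite lee_fin sqr_ge0.
    + by rewrite lee_fin L2ip_ge0.
  move=> p _; rewrite L2ip_sqrE// -ge0_integralZl//.
  - by apply: eq_integral => q _; rewrite -EFinM exprMn.
  - by apply/measurable_EFinP; apply: measurable_funX; exact: L2_measurable vL.
  - by move=> x _; rewrite lee_fin sqr_ge0.
  - by rewrite lee_fin sqr_ge0.
have tL : tensor u v \in Lfun nu 2%:E.
  by apply/L2P; split=> //; rewrite e ltry.
split=> //; rewrite /L2norm -sqrtrM ?L2ip_ge0//; congr Num.sqrt.
by apply: EFin_inj; rewrite L2ip_sqrE.
Qed.

Let f1 := tensor ia psi.
Let f1L : f1 \in Lfun nu 2%:E. Proof. exact: (tensorL iaL psiL).1. Qed.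

Let m1 p : marginal mu f1 p = ia p * \int[mu]_q psi q.
Proof. by rewrite -RintegralZl//; exact: L2_integrable. Qed.

Let m2 q : marginal mu (swap_fun f1) q = a * psi q.
Proof.
rewrite -ia_int mulrC -RintegralZl//; last exact: L2_integrable.
by apply: eq_Rintegral => p _; rewrite mulrC.
Qed.

Let X := ham mu En k f1 - w *: f1.

Let XL : X \in Lfun nu 2%:E.
Proof. by rewrite L2_sub ?L2_scale// (L2_ham k mEn En_bnd). Qed.

Let X_norm : L2norm nu X <=
  Num.sqrt a * L2norm mu b + `|k| * a * Num.sqrt M * L2norm mu psi.
Proof.
pose X1 : T * T -> R := fun x =>
  ia x.1 * ((En x - w) * psi x.2 - k * \int[mu]_q psi q).
pose X2 : T * T -> R := tensor (fun=> k * a) psi.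
have XE : X = X1 - X2.
  apply/funext => x.
  have -> : X x = En x * f1 x - k * marginal mu f1 x.1
    - k * marginal mu (swap_fun f1) x.2 - w * f1 x by [].
  have -> : (X1 - X2) x = ia x.1 * ((En x - w) * psi x.2 - k * \int[mu]_q psi q)
     - k * a * psi x.2 by [].
  by rewrite m1 m2 /f1 /tensor; ring.
have [tbL tbn] := tensorL iaL bL.
have [X2L X2n] := tensorL (L2_cst mu (k * a)) psiL.
have X1L : X1 \in Lfun nu 2%:E.
  have -> : X1 = X + X2 by rewrite XE subrK.
  exact: (L2_add XL X2L).
have a0 : 0 <= a by exact: fine_ge0.
rewrite XE; apply: le_trans (L2normD _ _) _ => //.
  by rewrite -scaleN1r L2_scale.
apply: lerD; last first.
  rewrite L2normN X2n L2norm_cst normrM (ger0_norm a0).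
  by rewrite -!mulrA.
rewrite -ia_norm -tbn; apply: L2norm_le => //; first exact: L2_measurable X1L.
move=> -[p q]; rewrite /X1 /tensor /= /ia indicE.
have [pA|pA] := boolP (p \in A); last by rewrite !mul0r.
by rewrite !mul1r; apply: bP; exact: set_mem.
Qed.

Let trial := f1 - swap_fun f1.

Let trial_antisym : trial \in antisymL2 mu.
Proof.
apply/antisymL2P; split; first by rewrite L2_sub ?L2_swap.
by apply: nearW => x _; rewrite /trial /swap_fun !fctE opprB; case: x.
Qed.

Let trial_norm : Num.sqrt a * L2norm mu psi <= L2norm nu trial.
Proof.
rewrite -ia_norm -(tensorL iaL psiL).2; apply: L2norm_le.
- exact: L2_measurable f1L.
- by rewrite L2_sub ?L2_swap.
move=> -[p q]; rewrite /trial /f1 /swap_fun /tensor !fctE /= /ia !indicE.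
have [pA|pA] := boolP (p \in A); last by rewrite mul0r normr0.
by rewrite (psiA (set_mem pA)) mulr0 subr0.
Qed.

Lemma trial_vector : exists f : E,
  Num.sqrt a * L2norm mu psi <= N f /\
  N (H f - w *: f) <=
    2 * (Num.sqrt a * L2norm mu b + `|k| * a * Num.sqrt M * L2norm mu psi).
Proof.
exists (Antisym trial_antisym); split; first exact: trial_norm.
have sXL := L2_swap XL.
have sf1L := L2_swap f1L.
have hL h : h \in Lfun nu 2%:E -> ham mu En k h \in Lfun nu 2%:E.
  exact: (L2_ham k mEn En_bnd).
have tL : trial \in Lfun nu 2%:E by rewrite L2_sub.
rewrite antisym_normE.
rewrite -[antisym_fun _]/(ham mu En k trial - w *: trial).
have -> : ham mu En k trial - w *: trial =
    (ham mu En k trial - (ham mu En k f1 - ham mu En k (swap_fun f1))) +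
    (X - swap_fun X).
  rewrite ham_swap /X /trial; apply/funext => x; rewrite /swap_fun !fctE /=.
  have e (a1 a2 a3 a4 a5 : R) :
    a1 - (a4 - a5) = a1 - (a2 - a3) + (a2 - a4 - (a3 - a5)) by ring.
  by rewrite scalerBr; exact: e.
have dL : ham mu En k trial - (ham mu En k f1 - ham mu En k (swap_fun f1))
    \in Lfun nu 2%:E.
  exact: (L2_sub (hL _ tL) (L2_sub (hL _ f1L) (hL _ sf1L))).
apply: le_trans (L2normD dL (L2_sub XL sXL)) _.
rewrite ham_sub// add0r.
have NsL : - swap_fun X \in Lfun nu 2%:E by rewrite -scaleN1r L2_scale.
apply: le_trans (L2normD XL NsL) _.
rewrite L2normN L2norm_swap//.
by have := X_norm; lra.
Qed.

End Trial.

(** Approximate eigenvectors from trial functions over sets [A] of vanishing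
    measure: after division by the norm of the trial vector, the contribution
    of the other channel is of the order of the square root of the measure
    of [A]. *)
Lemma weyl_criterion w :
  (forall e, 0 < e -> exists (A : set T) (psi b : T -> R),
    [/\ measurable A /\ 0 < fine (mu A) <= e ^+ 2,
        psi \in Lfun mu 2%:E /\ 0 < L2norm mu psi,
        b \in Lfun mu 2%:E /\ L2norm mu b <= e * L2norm mu psi,
        forall q, A q -> psi q = 0
      & forall p q, A p ->
        `|(En (p, q) - w) * psi q - k * \int[mu]_q psi q| <= `|b q| ]) ->
  forall e, 0 < e -> exists f : E, N f != 0 /\ N (H f - w *: f) <= e * N f.
Proof.
move=> crit e e0.
pose c := 1 + `|k| * Num.sqrt M.
have c0 : 0 < c by rewrite ltr_wpDr// mulr_ge0// sqrtr_ge0.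
pose e' := e / (2 * c).
have e'0 : 0 < e' by rewrite divr_gt0// mulr_gt0.
have [A [psi [b [[mA /andP[a0 ae]] [psiL psi0] [bL be] psiA bP]]]] := crit _ e'0.
have [f [f1 f2]] := trial_vector mA psiL bL psiA bP.
have sa : Num.sqrt (fine (mu A)) <= e'.
  by rewrite -(ger0_norm (ltW e'0)) -sqrtr_sqr ler_wsqrtr.
have sa0 : 0 < Num.sqrt (fine (mu A)) by rewrite sqrtr_gt0.
have fpos : 0 < N f by apply: lt_le_trans f1; exact: mulr_gt0.
exists f; split; first by rewrite gt_eqF.
apply: le_trans f2 _.
apply: (@le_trans _ _ (e * (Num.sqrt (fine (mu A)) * L2norm mu psi))); last first.
  by rewrite ler_pM2l.
have -> : e = 2 * (e' * c) by rewrite /e'; field; rewrite gt_eqF.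
rewrite -[leRHS]mulrA ler_pM2l//.
have aE : fine (mu A) = Num.sqrt (fine (mu A)) * Num.sqrt (fine (mu A)).
  by rewrite -expr2 sqr_sqrtr// ltW.
rewrite [X in `|k| * X]aE /c mulrDr mulr1 mulrDl; apply: lerD.
  by rewrite [leRHS]mulrCA ler_pM2l.
have -> : `|k| * (Num.sqrt (fine (mu A)) * Num.sqrt (fine (mu A))) *
  Num.sqrt M * L2norm mu psi = Num.sqrt (fine (mu A)) *
  ((`|k| * Num.sqrt M) * (Num.sqrt (fine (mu A)) * L2norm mu psi)) by ring.
rewrite -[leRHS]mulrA ler_wpM2r//; apply: mulr_ge0; apply: mulr_ge0;
  by rewrite ?sqrtr_ge0 ?normr_ge0 ?L2norm_ge0.
Qed.

(** What building trial functions near [p] requires: continuity of the fibres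
    of [En] there and sets of arbitrarily small positive measure, stated without
    a topology on [T]. *)
Definition localizable p := forall e, 0 < e -> exists U : set T,
  [/\ measurable U, 0 < fine (mu U) <= e
    & forall p', U p' -> forall q, `|En (p', q) - En (p, q)| <= e].

Let indic_norm (A : set T) : measurable A ->
  (\1_A : T -> R) \in Lfun mu 2%:E /\ L2norm mu \1_A = Num.sqrt (fine (mu A)).
Proof.
move=> mA; split.
  apply: (@bounded_L2 _ _ _ mu _ 1); first exact: measurable_indic.
  by move=> x; rewrite indicE; case: (_ \in _); rewrite ?normr1 ?normr0.
have <- : \int[mu]_q (\1_A q : R) = fine (mu A).
  by rewrite /Rintegral integral_indic// setIT.
congr Num.sqrt; apply: eq_Rintegral => q _.
by rewrite indicE; case: (_ \in _); rewrite ?mulr1 ?mulr0.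
Qed.

Let fine_mu_le (A B : set T) : measurable A -> measurable B -> A `<=` B ->
  fine (mu A) <= fine (mu B).
Proof.
move=> mA mB AB; apply: fine_le; rewrite ?fin_num_measure//.
by apply: le_measure => //; rewrite inE.
Qed.

(** Both particles are localized, near [p] and [q], and [psi] is an indicator
    function of a set so small that the interaction is negligible. *)
Lemma weyl_threshold w :
  (forall e, 0 < e -> exists p q,
     [/\ localizable p, localizable q & `|En (p, q) - w| <= e]) ->
  forall e, 0 < e -> exists f : E, N f != 0 /\ N (H f - w *: f) <= e * N f.
Proof.
move=> app; apply: weyl_criterion => e e0.
(* The integral of an indicator function is the square of its norm; [s] is the
   size of the norm at which the interaction contributes at most [e / 2]. *)
pose s := e / (2 * (`|k| * Num.sqrt M + 1)).
have c0 : 0 < `|k| * Num.sqrt M + 1 by rewrite ltr_wpDl// mulr_ge0// sqrtr_ge0.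
have s0 : 0 < s by rewrite divr_gt0// mulr_gt0.
have e6 : 0 < e / 6 by rewrite divr_gt0.
have [p0 [q0 [lp lq pqw]]] := app _ e6.
have [|B [mB /andP[B0 Be] Bq]] := lq (Num.min (e / 6) (s ^+ 2)).
  by rewrite lt_min e6 exprn_gt0.
(* [U] gets at most half the mass of [B], so that [B] without [U] still has
   positive measure. *)
have [|U [mU /andP[U0 Ue] Up]] :=
    lp (Num.min (e / 6) (Num.min (e ^+ 2) (fine (mu B) / 2))).
  by rewrite !lt_min e6 exprn_gt0//= divr_gt0.
move: Be Ue; rewrite !le_min => /andP[_ Bs] /andP[_ /andP[Ue UB]].
have mBU : measurable (B `\` U) by exact: measurableD.
have [psiL psin] := indic_norm mBU.
set m := fine (mu (B `\` U)) in psin.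
have mpos : 0 < m.
  have : fine (mu B) <= m + fine (mu U).
    rewrite -fineD ?fin_num_measure//; apply: fine_le.
    - exact: fin_num_measure.
    - by rewrite fin_numD !fin_num_measure.
    apply: le_trans (measureU2 _ _ _) => //.
    apply: le_measure; rewrite ?inE//; first exact: measurableU.
    by move=> x Bx; have [Ux|Ux] := pselect (U x); [right|left].
  by lra.
have ms : Num.sqrt m <= s.
  rewrite -(ger0_norm (ltW s0)) -sqrtr_sqr ler_wsqrtr//.
  by apply: le_trans Bs; apply: fine_mu_le => // x [].
have int_psi : \int[mu]_q (\1_(B `\` U) q : R) = m.
  by rewrite /Rintegral integral_indic// setIT.
pose b : T -> R := (e / 2) *: \1_(B `\` U) + (fun=> `|k| * m).
exists U, \1_(B `\` U), b; split.
- by split=> //; rewrite U0.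
- by rewrite psin sqrtr_gt0.
- have bL : b \in Lfun mu 2%:E by rewrite L2_add ?L2_scale ?L2_cst.
  split=> //; apply: le_trans (L2normD _ _) _; rewrite ?L2_scale ?L2_cst//.
  rewrite L2normZ// psin L2norm_cst (gtr0_norm (_ : 0 < e / 2)) ?divr_gt0//.
  rewrite normrM normr_id (gtr0_norm mpos).
  have mE : m = Num.sqrt m * Num.sqrt m by rewrite -expr2 sqr_sqrtr// ltW.
  rewrite {2}mE; set r := Num.sqrt m in ms *.
  have -> : `|k| * (r * r) * Num.sqrt M = (`|k| * Num.sqrt M * r) * r by ring.
  rewrite -mulrDl ler_wpM2r ?sqrtr_ge0//.
  have : `|k| * Num.sqrt M * r <= e / 2; last by lra.
  apply: (@le_trans _ _ ((`|k| * Num.sqrt M + 1) * s)).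
    rewrite ler_pM ?mulr_ge0 ?sqrtr_ge0//.
    by rewrite lerDl.
  by rewrite /s le_eqVlt; apply/orP; left; apply/eqP; field; rewrite gt_eqF.
- by move=> q Uq; rewrite indicE; case: (boolP (q \in _)) => // /set_mem[].
- move=> p q Up'; rewrite int_psi /b !fctE.
  have km0 : 0 <= `|k| * m by rewrite mulr_ge0// ltW.
  rewrite indicE; have [qB|qB] := boolP (q \in _); last first.
    rewrite mulr0 sub0r normrN normrM (gtr0_norm mpos) scaler0 add0r.
    exact: ler_norm.
  rewrite mulr1 -[_ *: _]/(e / 2 * 1) mulr1.
  rewrite [leRHS]ger0_norm; last by rewrite addr_ge0// divr_ge0// ltW.
  apply: le_trans (ler_normB _ _) _; rewrite normrM (gtr0_norm mpos) lerD//.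
  have -> : En (p, q) - w = (En (p, q) - En (p0, q)) +
      ((En (q, p0) - En (q0, p0)) + (En (p0, q0) - w)).
    by rewrite (En_sym p0 q) (En_sym p0 q0); ring.
  have [qB' _] := set_mem qB.
  have h1 := Up _ Up' q; have h2 := Bq _ qB' p0.
  rewrite !le_min in h1 h2; case/andP: h1 => h1 _; case/andP: h2 => h2 _.
  apply: le_trans (ler_normD _ _) _.
  have h3 := ler_normD (En (q, p0) - En (q0, p0)) (En (p0, q0) - w).
  lra.
Qed.

(** The condition says that [1 / (En (p0, _) - w)] is the wave function of a
    bound state of the pair, at total energy [w]. Cutting it off on the small
    set [A] and using it in the fibres over [A] costs little. *)
Lemma weyl_bound_state p0 w dd : localizable p0 -> 0 < dd ->
  (forall x, dd <= En x - w) -> k * \int[mu]_q (En (p0, q) - w)^-1 = 1 ->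
  forall e, 0 < e -> exists f : E, N f != 0 /\ N (H f - w *: f) <= e * N f.
Proof.
move=> lp dd0 ddP det; apply: weyl_criterion => e e0.
pose W q := (En (p0, q) - w)^-1.
have Wpos q : 0 < W q by rewrite invr_gt0 (lt_le_trans dd0).
have Wle q : W q <= dd^-1 by rewrite lef_pV2 ?posrE// (lt_le_trans dd0).
have Wbnd q : `|W q| <= dd^-1 by rewrite ger0_norm// ltW.
pose E2 := E1 + `|w|.
have EnE2 x : En x - w <= E2.
  apply: le_trans (ler_norm _) _; apply: le_trans (ler_normB _ _) _.
  by rewrite lerD2r.
have E20 : 0 < E2 by apply: lt_le_trans (EnE2 (p0, p0)); exact: lt_le_trans (ddP _).
have Wge q : E2^-1 <= W q by rewrite lef_pV2 ?posrE// (lt_le_trans dd0).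
have mW : measurable_fun setT W.
  rewrite (_ : W = fun q => (En (p0, q) - w) `^ (-1)); last first.
    apply/funext => q; rewrite powR_inv1//.
    by apply: le_trans (ddP _); exact: ltW.
  apply: (measurableT_comp (@measurable_powR R (-1))).
  by apply: measurable_funB => //; exact: measurable_section.
have WL := bounded_L2 mu mW Wbnd.
have M0 : 0 < M.
  have [U [mU /andP[U0 _] _]] := lp _ (@ltr01 R).
  by apply: lt_le_trans U0 _; exact: fine_mu_le.
(* The norm of the residual [b] chosen below is at most [s * C], and that of [psi]
   at least the factor of [e] in [t]. *)
pose C := (1 + `|k|) / dd * Num.sqrt M + (1 + `|k| / dd).
have C0 : 0 < C.
  by rewrite ltr_wpDl ?mulr_ge0 ?addr_ge0 ?invr_ge0 ?sqrtr_ge0 ?(ltW dd0)//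
    ltr_wpDr ?mulr_ge0 ?invr_ge0 ?(ltW dd0).
pose t := e * (E2^-1 * Num.sqrt (M / 2)).
have t0 : 0 < t by rewrite !mulr_gt0 ?invr_gt0// sqrtr_gt0 divr_gt0.
pose s := Num.min 1 (t / C).
have s0 : 0 < s by rewrite lt_min ltr01 divr_gt0.
have [|A [mA /andP[A0 Ae] Ap]] := lp (Num.min (s ^+ 2) (Num.min (e ^+ 2) (M / 2))).
  by rewrite !lt_min !exprn_gt0//= divr_gt0.
move: Ae; rewrite !le_min => /and3P[As Ae AM].
set a := fine (mu A) in A0 As Ae AM.
have s1 : s <= 1 by rewrite ge_min lexx.
have as' : a <= s.
  by apply: le_trans As _; rewrite expr2 ler_piMr// ltW.
have sas : Num.sqrt a <= s.
  by rewrite -(ger0_norm (ltW s0)) -sqrtr_sqr ler_wsqrtr.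
have [iaL ian] := indic_norm mA.
have mAc : measurable (~` A) by exact: measurableC.
have [icL icn] := indic_norm mAc.
pose psi : T -> R := \1_(~` A) * W.
have mpsi : measurable_fun setT psi.
  by apply: measurable_funM => //; exact: measurable_indic.
have psi_bnd q : `|psi q| <= `|W q|.
  rewrite /psi !fctE normrM indicE; case: (_ \in _); rewrite ?normr1 ?mul1r//.
  by rewrite normr0 mul0r.
have psiL : psi \in Lfun mu 2%:E by exact: L2_le mpsi WL psi_bnd.
have psi_norm : E2^-1 * Num.sqrt (M / 2) <= L2norm mu psi.
  apply: (@le_trans _ _ (L2norm mu (E2^-1 *: \1_(~` A)))).
    rewrite L2normZ// icn gtr0_norm ?invr_gt0// ler_pM2l ?invr_gt0//.
    rewrite ler_wsqrtr//.
    have : M <= a + fine (mu (~` A)).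
      rewrite -fineD ?fin_num_measure//; apply: fine_le.
      - exact: fin_num_measure.
      - by rewrite fin_numD !fin_num_measure.
      apply: le_trans (measureU2 _ _ _) => //.
      by rewrite setUv.
    by rewrite -/M; lra.
  apply: L2norm_le => //; first by apply: measurable_funM => //; exact: measurable_indic.
  move=> q; rewrite /psi !fctE -[_ *: _]/(E2^-1 * _) !normrM mulrC.
  rewrite ler_wpM2l//.
  by rewrite gtr0_norm ?invr_gt0// gtr0_norm.
have psi0 : 0 < L2norm mu psi.
  by apply: lt_le_trans psi_norm; rewrite mulr_gt0 ?invr_gt0// sqrtr_gt0 divr_gt0.
pose ka := k * \int[mu]_q (\1_A q * W q).
have iA : mu.-integrable setT (EFin \o (fun q => \1_A q * W q)).
  exact: L2_mul_integrable.
have int_psi : k * \int[mu]_q psi q = 1 - ka.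
  rewrite -det /ka -mulrBr -RintegralB//; last exact: L2_integrable.
  congr (_ * _); apply: eq_Rintegral => q _.
  rewrite /psi fctE !indicE in_setC; case: (q \in A); rewrite /W /=; ring.
have AWL : (fun q => \1_A q * W q) \in Lfun mu 2%:E.
  rewrite (_ : (fun q => _) = W * \1_A); first exact: L2_mul_bounded mW Wbnd iaL.
  by apply/funext => q; exact: mulrC.
have ka_le : `|ka| <= `|k| * (a / dd).
  rewrite normrM ler_wpM2l//; apply: le_trans (le_normr_Rintegral _ _) _ => //.
  have -> : a / dd = \int[mu]_q (dd^-1 * \1_A q).
    rewrite RintegralZl//; last exact: L2_integrable.
    by rewrite mulrC /Rintegral integral_indic// setIT.
  apply: le_Rintegral => //.
  - exact: (L2_integrable (L2_norm AWL)).
  - by apply: L2_integrable; exact: (L2_scale dd^-1 iaL).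
  - move=> q _; rewrite normrM mulrC ler_pM//.
    by rewrite indicE; case: (_ \in _); rewrite ?normr1 ?normr0.
pose b0 := (1 + `|k|) / dd * s; pose b1 := 1 + `|k| / dd.
have b00 : 0 <= b0 by rewrite !mulr_ge0 ?addr_ge0 ?invr_ge0 ?(ltW dd0) ?(ltW s0).
have b10 : 0 <= b1 by rewrite addr_ge0 ?mulr_ge0 ?invr_ge0 ?(ltW dd0).
pose b : T -> R := (fun=> b0) + b1 *: \1_A.
have bL : b \in Lfun mu 2%:E by rewrite L2_add ?L2_scale ?L2_cst.
exists A, psi, b; split=> //.
- by rewrite A0.
- split=> //; apply: le_trans (L2normD _ _) _; rewrite ?L2_scale ?L2_cst//.
  rewrite (L2normZ b1 iaL) ian L2norm_cst (ger0_norm b00) (ger0_norm b10).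
  apply: (@le_trans _ _ (s * C)).
    have : b1 * Num.sqrt a <= b1 * s by rewrite ler_wpM2l.
    rewrite /b0 /C -/b1; lra.
  apply: (@le_trans _ _ t); first by rewrite -ler_pdivlMr// ge_min lexx orbT.
  by rewrite ler_pM2l.
- by move=> q Aq; rewrite /psi fctE indicE in_setC (mem_set Aq) /= mul0r.
- move=> p q Ap'; rewrite int_psi /psi /b !fctE !indicE in_setC.
  have kas : `|ka| <= `|k| / dd * s.
    apply: le_trans ka_le _; rewrite [leRHS]mulrAC -mulrA ler_wpM2l//.
    by rewrite ler_pM2r ?invr_gt0.
  have [qA|qA] := boolP (q \in A) => /=.
    rewrite mul0r mulr0 sub0r normrN -[_ *: _]/(b1 * 1) mulr1.
    rewrite [leRHS]ger0_norm; last exact: addr_ge0 b00 b10.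
    apply: le_trans (ler_normB _ _) _; rewrite normr1.
    apply: (@le_trans _ _ b1); last by rewrite lerDr.
    rewrite /b1 lerD2l; apply: le_trans kas _.
    by rewrite ler_piMr// mulr_ge0 ?invr_ge0 ?(ltW dd0).
  rewrite mul1r scaler0 addr0 [leRHS]ger0_norm//.
  have n1 : En (p0, q) - w != 0 by rewrite gt_eqF// (lt_le_trans dd0).
  have -> : (En (p, q) - w) * W q - (1 - ka) =
      (En (p, q) - En (p0, q)) * W q + ka by rewrite /W; field.
  apply: le_trans (ler_normD _ _) _.
  have h1 : `|(En (p, q) - En (p0, q)) * W q| <= s * dd^-1.
    rewrite normrM ler_pM//.
    have h := Ap _ Ap' q; rewrite !le_min in h; case/andP: h => h _.
    by apply: le_trans h _; rewrite expr2 ler_piMr// ltW.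
  rewrite /b0; lra.
Qed.

End Weyl.

(** * Cosines and translations of the circle *)

Section RealFacts.
Context {R : realType}.
Implicit Types (x y a b : R).

(** Composing with the projection onto the interval makes [f] continuous on the whole
    line without a continuity hypothesis outside the interval. *)
Lemma lipschitz_IVT (f : R -> R) a b L v : a <= b ->
  (forall x y, a <= x <= b -> a <= y <= b -> `|f x - f y| <= L * `|x - y|) ->
  Num.min (f a) (f b) <= v <= Num.max (f a) (f b) ->
  exists2 c, a <= c <= b & f c = v.
Proof.
move=> ab lip fv.
pose cl x := Num.min (Num.max x a) b.
have clI x : a <= cl x <= b by rewrite /cl le_min le_max lexx orbT ab ge_min lexx orbT.
have cl_id x : a <= x <= b -> cl x = x.
  by move=> /andP[ax xb]; rewrite /cl (max_idPl ax) (min_idPl xb).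
have cl_lip x y : `|cl x - cl y| <= `|x - y|.
  have step z w : z <= w -> 0 <= cl w - cl z <= w - z.
    rewrite /cl !(minEle, maxEle) => zw.
    by do ?case: ifPn; rewrite -?ltNge; move=> *; apply/andP; split; lra.
  wlog xy : x y / x <= y.
    by move=> W; have [|/ltW] := leP x y; [exact: W|rewrite distrC (distrC x); exact: W].
  have /andP[h1 h2] := step _ _ xy.
  by rewrite distrC (distrC x) (ger0_norm h1) ger0_norm// subr_ge0.
have cf : continuous (f \o cl).
  move=> x; apply/cvgrPdist_le => /= e e0.
  pose D := Num.max L 1.
  have D0 : 0 < D by rewrite lt_max ltr01 orbT.
  near=> y.
  apply: le_trans (lip _ _ (clI x) (clI y)) _.
  apply: (@le_trans _ _ (D * `|x - y|)).
    apply: (@le_trans _ _ (D * `|cl x - cl y|)).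
      by rewrite ler_wpM2r// le_max lexx.
    by rewrite ler_pM2l.
  rewrite mulrC -ler_pdivlMr//.
  near: y; apply: (@cvgr_dist_le _ _ _ _ _ id x) => //.
  by rewrite divr_gt0.
have cfw : {within `[a, b], continuous (f \o cl)} by exact: continuous_subspaceT.
have fv' : Num.min ((f \o cl) a) ((f \o cl) b) <= v
    <= Num.max ((f \o cl) a) ((f \o cl) b).
  by rewrite /= !cl_id ?lexx ?ab.
have [c cI fc] := IVT ab cfw fv'.
exists c; first by rewrite in_itv in cI.
by rewrite -fc /= cl_id//; rewrite in_itv in cI.
Unshelve. all: by end_near. Qed.

Lemma cos_lipschitz x y : `|cos x - cos y| <= `|x - y|.
Proof.
wlog xy : x y / x <= y.
  by move=> W; have [|/ltW] := leP x y; [exact: W|rewrite distrC (distrC x); exact: W].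
have der z : z \in `]x, y[ -> is_derive z 1 (@cos R) (- sin z).
  by move=> _; exact: is_derive_cos.
have cnt : {within `[x, y], continuous (@cos R)}.
  by apply: continuous_subspaceT => z; exact: continuous_cos.
have [c _ e] := MVT_segment xy der cnt.
rewrite distrC e normrM (distrC x) ler_piMl// normrN ler_norml.
by rewrite sin_geN1 sin_le1.
Qed.

Lemma cosD2pin (n : int) x : cos (x + 2 * pi * n%:~R) = cos x.
Proof.
have pos (m : nat) (z : R) : cos (z + 2 * pi * m%:R) = cos z.
  elim: m z => [|m IH] z; first by rewrite mulr0 addr0.
  have -> : z + 2 * pi * m.+1%:R = (z + 2 * pi * m%:R) + pi *+ 2.
    by rewrite -natr1 -mulr_natl; ring.
  by rewrite cosD2pi IH.
case: n => n; first exact: pos.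
by rewrite NegzE mulrNz mulrN -[LHS](pos n.+1) subrK.
Qed.

Lemma reduce_2pi x : exists y, - pi < y <= pi /\ exists n : int, x = y + 2 * pi * n%:~R.
Proof.
have p0 : 0 < 2 * pi :> R by rewrite mulr_gt0// pi_gt0.
pose n := Num.floor ((pi - x) / (2 * pi)).
have /andP[n1 n2] := mem_rg1_floor ((pi - x) / (2 * pi)).
exists (x + 2 * pi * n%:~R); split; last first.
  by exists (- n); rewrite mulrNz mulrN addrK.
rewrite -/n in n1 n2.
have h1 : n%:~R * (2 * pi) <= pi - x by rewrite -ler_pdivlMr.
have h2 : pi - x < (n%:~R + 1) * (2 * pi) by rewrite -ltr_pdivrMr// -intrD1.
rewrite mulrC; apply/andP; split; lra.
Qed.

Lemma cos_half x : 1 - cos x <= 4 * (1 - cos (x / 2)).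
Proof.
have -> : cos x = 2 * cos (x / 2) ^+ 2 - 1.
  by rewrite -[in LHS](@divfK _ (2 : R) _ x)// mulr_natr cos_mulr2n mulr_natl.
have := cos_le1 (x / 2); have := cos_geN1 (x / 2).
set c := cos _ => h1 h2.
have : 0 <= (1 - c) * (1 - c) by rewrite -expr2 sqr_ge0.
lra.
Qed.

(** [1 - cos x] is at least of order [x^2]: it is at least [1] beyond [pi/2],
    and halving the argument divides it by at most [4]. *)
Lemma one_minus_cos_ge (n : nat) x : `|x| <= pi -> pi * 2^-1 ^+ n.+1 < `|x| ->
  4^-1 ^+ n <= 1 - cos x.
Proof.
have abs (z : R) : cos z = cos `|z|.
  by have [z0|z0] := leP 0 z; [rewrite ger0_norm|rewrite ltr0_norm// cosN].
have far (z : R) : pi / 2 < `|z| -> `|z| <= pi -> 1 <= 1 - cos z.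
  move=> z1 z2; rewrite lerDl oppr_ge0 abs.
  have -> : `|z| = (`|z| - pi) + pi by rewrite subrK.
  rewrite cosDpi oppr_le0; apply: cos_ge0_pihalf.
  have := pi_gt0 R; lra.
elim: n x => [|n IH] x xpi xn.
  by rewrite expr0; apply: far => //; rewrite expr1 in xn.
have [x2|x2] := ltP (pi / 2) `|x|.
  apply: le_trans (far _ x2 xpi); rewrite exprn_ile1//; lra.
have e2 : `|x * 2| = `|x| * 2 by rewrite normrM (ger0_norm (_ : 0 <= 2)).
have := IH (x * 2); rewrite e2 => /(_ _ _).
have h1 : `|x| * 2 <= pi by lra.
have h2 : pi * 2^-1 ^+ n.+1 < `|x| * 2.
  by rewrite -ltr_pdivrMr// -mulrA -exprSr.
move=> /(_ h1 h2) h; have := cos_half (x * 2); rewrite mulfK//.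
by rewrite exprS; lra.
Qed.

End RealFacts.

Section Preserves.
Context {R : realType}.

Definition preserves d (T : measurableType d) (m : set T -> \bar R) (r : T -> T) :=
  measurable_fun setT r /\ forall A, measurable A -> m (r @^-1` A) = m A.

Lemma preserves_ge0_integral d (T : measurableType d)
    (m : {measure set T -> \bar R}) r (f : T -> \bar R) :
  preserves m r -> measurable_fun setT f -> (forall x, (0 <= f x)%E) ->
  (\int[m]_x f (r x) = \int[m]_x f x)%E.
Proof.
move=> [mr rP] mf f0.
have := ge0_integral_pushforward mr m measurableT mf (fun x _ => f0 x).
rewrite preimage_setT => <-.
by apply: eq_measure_integral => A mA _; exact: rP.
Qed.

Lemma preserves_product d1 d2 (T1 : measurableType d1) (T2 : measurableType d2)
    (m1 : {finite_measure set T1 -> \bar R})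
    (m2 : {finite_measure set T2 -> \bar R}) r1 r2 :
  preserves m1 r1 -> preserves m2 r2 ->
  preserves (finite_product m1 m2) (fun x => (r1 x.1, r2 x.2)).
Proof.
move=> [mr1 r1P] [mr2 r2P].
have mr : measurable_fun setT (fun x : T1 * T2 => (r1 x.1, r2 x.2)).
  by apply: measurable_fun_pair; apply: measurableT_comp.
split=> // A mA.
have mpre d (T : measurableType d) (r : T -> T) B : measurable_fun setT r ->
    measurable B -> measurable (r @^-1` B).
  by move=> mr' mB; rewrite -[X in measurable X]setTI; exact: mr'.
rewrite -[LHS]/(pushforward (finite_product m1 m2)
  (fun x : T1 * T2 => (r1 x.1, r2 x.2)) A).
rewrite -[RHS]/((m1 \x m2)%E A); symmetry.
apply: product_measure_unique => // A1 A2 mA1 mA2.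
rewrite -[LHS]/((m1 \x m2)%E ((r1 @^-1` A1) `*` (r2 @^-1` A2))).
rewrite product_measure1E; [|exact: mpre|exact: mpre].
by congr (_ * _)%E; [exact: r1P|exact: r2P].
Qed.

(** The translated measure agrees with Lebesgue measure on half-open
    intervals. *)
Lemma lebesgue_translation (c : R) (A : set (measurableTypeR R)) : measurable A ->
  lebesgue_measure ((fun x => x + c) @^-1` A) = lebesgue_measure A.
Proof.
move=> mA.
have mt : measurable_fun setT (fun x : measurableTypeR R => x + c : measurableTypeR R).
  by apply: measurable_funD.
symmetry.
apply: (@lebesgue_measure_unique R (pushforward lebesgue_measure (fun x : measurableTypeR R => x + c : measurableTypeR R))) => //.
move=> X [[a b] _ <-] /=.
rewrite /pushforward (_ : _ @^-1` _ = `]a - c, b - c]%classic); last first.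
  by apply/seteqP; split=> x /=; rewrite !in_itv/= ltrBlDr lerBrDr.
rewrite !lebesgue_measure_itv/= !lte_fin ltrD2r.
by case: ifP => // _; rewrite -!EFinD; congr EFin; ring.
Qed.

End Preserves.

Section Circle.
Variable R : realType.
Local Notation circ := (circle_measure R).
Local Notation RR := (measurableTypeR R).

(** Translation by [phi] on the circle, as a map of the interval
    from [- pi] to [pi] into itself for [phi] between [0] and [2 pi]. *)
Definition rotation (phi x : R) : R :=
  if x + phi <= pi then x + phi else x + phi - 2 * pi.

Lemma cos_rotation phi x c : cos (rotation phi x - c) = cos (x + phi - c).
Proof.
rewrite /rotation; case: ifP => // _.
by rewrite -[LHS](cosD2pin 1) mulr1; congr cos; ring.
Qed.

Lemma circle_measureE (A : set RR) :
  circ A = lebesgue_measure (A `&` @circle R).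
Proof. by []. Qed.

Lemma measurable_rotation phi :
  measurable_fun setT (rotation phi : RR -> RR).
Proof.
apply: measurable_fun_ifT.
- apply: measurable_fun_ler => //; exact: measurable_funD.
- exact: measurable_funD.
- by apply: measurable_funB => //; exact: measurable_funD.
Qed.

(** The interval is cut at [pi - phi]; the two pieces are translated and change
    places. *)
Lemma preserves_rotation phi : 0 <= phi <= 2 * pi ->
  preserves circ (rotation phi : RR -> RR).
Proof.
move=> /andP[p0 p1]; split; first exact: measurable_rotation.
move=> A mA; have pi0 := pi_gt0 R.
rewrite !circle_measureE.
pose A1 : set RR := A `&` `]- pi + phi, pi]; pose A2 : set RR := A `&` `]- pi, - pi + phi].
have mA1 : measurable A1 by apply: measurableI => //; exact: measurable_itv.
have mA2 : measurable A2 by apply: measurableI => //; exact: measurable_itv.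
have mt c (B : set RR) : measurable B -> measurable ((fun x : RR => x + c : RR) @^-1` B).
  move=> mB; rewrite -[X in measurable X]setTI.
  by apply: (_ : measurable_fun setT _) => //; exact: measurable_funD.
have -> : (rotation phi : RR -> RR) @^-1` A `&` @circle R =
    ((fun x : RR => x + phi : RR) @^-1` A1) `|`
    ((fun x : RR => x + (phi - 2 * pi) : RR) @^-1` A2).
  apply/seteqP; split=> x /=; change (Real.sort R) in x;
      rewrite /A1 /A2 /circle/= !in_itv/= /rotation.
    case: ifPn => [h [Ax /andP[x1 x2]]|h [Ax /andP[x1 x2]]].
      by left; split=> //; apply/andP; split; lra.
    rewrite -ltNge in h; right; rewrite addrA; split=> //.
    by apply/andP; split; lra.
  rewrite addrA => -[[Ax /andP[x1 x2]]|[Ax /andP[x1 x2]]].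
    by rewrite x2; split=> //; apply/andP; split; lra.
  have -> : (x + phi <= pi) = false by apply/negbTE; rewrite -ltNge; lra.
  by split=> //; apply/andP; split; lra.
rewrite measureU; [|exact: mt|exact: mt|]; last first.
  apply/seteqP; split=> x //=; change (Real.sort R) in x.
  rewrite /A1 /A2 /= !in_itv/= => -[[_ /andP[x1 x2]] [_ /andP[x3 x4]]].
  lra.
transitivity (lebesgue_measure A1 + lebesgue_measure A2)%E.
  by congr (_ + _)%E; exact: lebesgue_translation.
rewrite -measureU//; last first.
  apply/seteqP; split=> x //=; change (Real.sort R) in x.
  rewrite /A1 /A2 /= !in_itv/= => -[[_ /andP[x1 x2]] [_ /andP[x3 x4]]].
  lra.
congr lebesgue_measure; apply/seteqP; split=> x /=; change (Real.sort R) in x;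
    rewrite /A1 /A2 /circle /= !in_itv /=.
  by move=> [[Ax /andP[x1 x2]]|[Ax /andP[x1 x2]]]; split=> //; apply/andP; split; lra.
move=> [Ax /andP[x1 x2]]; have [h|h] := leP x (- pi + phi); [right|left].
  by split=> //; rewrite x1.
by split.
Qed.

Lemma circle_measure_itv (a b : R) : - pi <= a -> a < b -> b <= pi ->
  circ `]a, b]%classic = (b - a)%:E.
Proof.
move=> a1 ab b1; rewrite circle_measureE (_ : _ `&` _ = `]a, b]%classic).
  by rewrite lebesgue_measure_itv/= lte_fin ab.
apply/seteqP; split=> x /=; change (Real.sort R) in x; rewrite /circle /= !in_itv/=.
  by case.
by move=> /andP[x1 x2]; split; apply/andP; split; lra.
Qed.

Lemma circle_mass : circ setT = (2 * pi)%:E.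
Proof.
have pi0 := pi_gt0 R.
rewrite circle_measureE setTI lebesgue_measure_itv/= lte_fin.
by rewrite (_ : - pi < pi) -?EFinD; [congr EFin; ring | lra].
Qed.

End Circle.

(** * The torus and the inverse of the dispersion *)

Section TorusMeasure.
Variable R : realType.
Local Notation RR := (measurableTypeR R).
Local Notation R3 := (RR * RR * RR)%type.
Local Notation circ := (circle_measure R).
Local Notation mu3 := (torus_measure R).

Lemma torus_boxE (A1 A2 A3 : set RR) :
  measurable A1 -> measurable A2 -> measurable A3 ->
  mu3 (A1 `*` A2 `*` A3) = (circ A1 * circ A2 * circ A3)%E.
Proof.
move=> m1 m2 m3.
rewrite -[LHS]/((finite_product circ circ \x circ)%E (A1 `*` A2 `*` A3)).
rewrite product_measure1E//; last exact: measurableX.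
by congr (_ * _)%E; exact: product_measure1E.
Qed.

Lemma ae_torus : \forall q \ae mu3, torus q.
Proof.
have mC := @measurable_circle R.
have mT : measurable (torus (R := R)) by do 2 ?apply: measurableX.
exists (~` torus (R := R)); split=> //; first exact: measurableC.
rewrite -setTD measureD//; last by rewrite ltey_eq fin_num_measure.
rewrite setTI [X in (_ - X)%E](_ : _ = mu3 setT).
  by rewrite subee// fin_num_measure.
transitivity (circ (@circle R) * circ (@circle R) * circ (@circle R))%E.
  exact: torus_boxE.
rewrite (_ : [set: R3] = setT `*` setT `*` setT); last first.
  by apply/seteqP; split.
rewrite torus_boxE//.
have -> : circ (@circle R) = circ setT by rewrite !circle_measureE setIid setTI.
by [].
Qed.

Definition rotation3 (phi q : R3) : R3 :=
  (rotation phi.1.1 q.1.1, rotation phi.1.2 q.1.2, rotation phi.2 q.2).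

Lemma preserves_rotation3 (phi : R3) : 0 <= phi.1.1 <= 2 * pi ->
  0 <= phi.1.2 <= 2 * pi -> 0 <= phi.2 <= 2 * pi ->
  preserves mu3 (rotation3 phi).
Proof.
move=> h1 h2 h3.
exact: (preserves_product (preserves_product (preserves_rotation h1)
  (preserves_rotation h2)) (preserves_rotation h3)).
Qed.

Lemma measurable_coord1 : measurable_fun setT (fun q : R3 => q.1.1 : RR).
Proof. exact: measurableT_comp measurable_fst measurable_fst. Qed.
Lemma measurable_coord2 : measurable_fun setT (fun q : R3 => q.1.2 : RR).
Proof. exact: measurableT_comp measurable_snd measurable_fst. Qed.
Lemma measurable_coord3 : measurable_fun setT (fun q : R3 => q.2 : RR).
Proof. exact: measurable_snd. Qed.

Lemma measurable_cos_comp d (T : measurableType d) (f : T -> R) :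
  measurable_fun setT f -> measurable_fun setT (fun x => cos (f x)).
Proof.
by move=> mf; apply: measurableT_comp mf; apply: continuous_measurable_fun => x;
  exact: continuous_cos.
Qed.

Lemma measurable_dispersion : measurable_fun setT (@dispersion R).
Proof.
apply: measurable_funD; first apply: measurable_funD.
- by apply: measurable_funB => //; exact: measurable_cos_comp measurable_coord1.
- by apply: measurable_funB => //; exact: measurable_cos_comp measurable_coord2.
- by apply: measurable_funB => //; exact: measurable_cos_comp measurable_coord3.
Qed.

Lemma dispersion_ge0 (q : R3) : 0 <= dispersion q.
Proof.
rewrite /dispersion; have := cos_le1 q.1.1; have := cos_le1 q.1.2.
have := cos_le1 q.2; lra.
Qed.

Lemma dispersion_le6 (q : R3) : dispersion q <= 6.
Proof.
rewrite /dispersion; have := cos_geN1 q.1.1; have := cos_geN1 q.1.2.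
have := cos_geN1 q.2; lra.
Qed.

Lemma measurable_inv d (T : measurableType d) (f : T -> R) :
  measurable_fun setT f -> (forall x, 0 <= f x) ->
  measurable_fun setT (fun x => (f x)^-1).
Proof.
move=> mf f0; rewrite (_ : (fun _ => _) = fun x => f x `^ (-1)).
  exact: (measurableT_comp (@measurable_powR R (-1)) mf).
by apply/funext => x; rewrite powR_inv1.
Qed.

Definition cube (r : R) : set R3 :=
  (`[- r, r]%classic : set RR) `*` (`[- r, r]%classic : set RR) `*` (`[- r, r]%classic : set RR).

Lemma measurable_cube r : measurable (cube r).
Proof. by do 2 ?apply: measurableX; exact: measurable_itv. Qed.

Lemma cubeP r (q : R3) : cube r q <-> [/\ `|q.1.1| <= r, `|q.1.2| <= r & `|q.2| <= r].
Proof.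
rewrite /cube /= !in_itv /= !ler_norml.
by split=> [[[? ?] ?]|[? ? ?]].
Qed.

Lemma cube_measure_le (r : R) : 0 <= r -> (mu3 (cube r) <= ((2 * r) ^+ 3)%:E)%E.
Proof.
move=> r0; pose I : set RR := `[- r, r]%classic.
have c1 : (circ I <= (2 * r)%:E)%E.
  apply: (@le_trans _ _ (lebesgue_measure I)).
    rewrite circle_measureE; apply: le_measure; rewrite ?inE; last exact: subIsetl.
      by apply: measurableI; exact: measurable_itv.
    exact: measurable_itv.
  rewrite lebesgue_measure_itv/= lte_fin.
  case: ifP => _; last by rewrite lee_fin mulr_ge0.
  by rewrite -EFinD lee_fin opprK; lra.
rewrite /cube torus_boxE; try exact: measurable_itv.
rewrite exprS expr2 mulrA !EFinM.
by apply: lee_pmul => //; rewrite ?mule_ge0//; apply: lee_pmul.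
Qed.

Lemma torus_cube (q : R3) : torus q -> cube pi q.
Proof.
rewrite /torus /cube /circle /= !in_itv/=.
by move=> [[/andP[/ltW -> ->] /andP[/ltW -> ->]] /andP[/ltW -> ->]].
Qed.

(** The quadratic vanishing of the dispersion at [0], on dyadic shells. *)
Lemma dispersion_shell (q : R3) n : cube pi q ->
  ~ cube (pi * 2^-1 ^+ n.+1) q -> 4^-1 ^+ n <= dispersion q.
Proof.
move=> /cubeP[c1 c2 c3] nc.
have a1 : 0 <= 1 - cos q.1.1 by rewrite subr_ge0 cos_le1.
have a2 : 0 <= 1 - cos q.1.2 by rewrite subr_ge0 cos_le1.
have a3 : 0 <= 1 - cos q.2 by rewrite subr_ge0 cos_le1.
rewrite /dispersion.
have [h1|h1] := ltP (pi * 2^-1 ^+ n.+1) `|q.1.1|.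
  by have := one_minus_cos_ge c1 h1; lra.
have [h2|h2] := ltP (pi * 2^-1 ^+ n.+1) `|q.1.2|.
  by have := one_minus_cos_ge c2 h2; lra.
have [h3|h3] := ltP (pi * 2^-1 ^+ n.+1) `|q.2|.
  by have := one_minus_cos_ge c3 h3; lra.
by exfalso; apply: nc; apply/cubeP.
Qed.

(** The sum of the layers dominates the inverse of the dispersion: on the shell
    between two consecutive cubes the inverse is at most the weight of the larger
    one. *)
Let layer n (q : R3) : \bar R := (4 ^+ n * \1_(cube (pi * 2^-1 ^+ n)) q)%:E.

Let layer_ge0 n q : (0 <= layer n q)%E.
Proof. by rewrite lee_fin mulr_ge0// exprn_ge0. Qed.

Let inv_dispersion_le q : torus q ->
  (((dispersion q)^-1)%:E <= \sum_(n <oo) layer n q)%E.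
Proof.
move=> /torus_cube qc.
have [q0|qN0] := eqVneq (dispersion q) 0.
  by rewrite q0 invr0; apply: nneseries_ge0 => n _ _.
have [n nq] : exists n, ~ cube (pi * 2^-1 ^+ n) q.
  apply: contrapT => noex; move/eqP: qN0; apply.
  have all n : cube (pi * 2^-1 ^+ n) q by apply: contrapT => h; apply: noex; exists n.
  have h0 : (0 : R) <= 2^-1 by []. have h1 : (2^-1 : R) < 1 by lra.
  have z (x : R) : (forall n, `|x| <= pi * 2^-1 ^+ n) -> x = 0.
    by move=> /(geometric_le0 h0 h1); rewrite normr_le0 => /eqP.
  have z1 : q.1.1 = 0 by apply: z => n; have /cubeP[] := all n.
  have z2 : q.1.2 = 0 by apply: z => n; have /cubeP[] := all n.
  have z3 : q.2 = 0 by apply: z => n; have /cubeP[] := all n.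
  by rewrite /dispersion z1 z2 z3 cos0 subrr !addr0.
have exn : exists n, `[< ~ cube (pi * 2^-1 ^+ n) q >] by exists n; exact/asboolP.
have [m /asboolP mq mmin] := ex_minnP exn.
have m0 : (0 < m)%N.
  by rewrite lt0n; apply/eqP => m0; apply: mq; rewrite m0 expr0 mulr1.
have mm : m.-1.+1 = m by rewrite prednK.
have inm : cube (pi * 2^-1 ^+ m.-1) q.
  apply: contrapT => h; have := mmin m.-1 (asboolT h).
  by rewrite -{1}mm ltnn.
have sh : 4^-1 ^+ m.-1 <= dispersion q.
  by apply: dispersion_shell => //; rewrite mm.
apply: (@le_trans _ _ (layer m.-1 q)).
  rewrite /layer indicE mem_set// mulr1 lee_fin -[leRHS]invrK -exprVn lef_pV2//.
  - by rewrite posrE lt_neqAle eq_sym qN0 dispersion_ge0.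
  - by rewrite posrE exprn_gt0.
apply: (@le_trans _ _ (\sum_(0 <= i < m.-1.+1) layer i q)%E); last first.
  by apply: nneseries_lim_ge => i _ _.
by rewrite big_nat_recr//= leeDr// sume_ge0.
Qed.

(** This is where dimension three enters: the [n]-th cube has volume of order
    [8^-n], so the layers have integrals of order [2^-n]. *)
Lemma inv_dispersion_integrable :
  mu3.-integrable setT (EFin \o (fun q => (dispersion q)^-1)).
Proof.
have minv := measurable_inv measurable_dispersion dispersion_ge0.
apply/integrableP; split; first exact/measurable_EFinP.
have ml n : measurable_fun setT (layer n).
  apply/measurable_EFinP; apply: measurable_funM => //.
  exact: measurable_indic (measurable_cube _).
apply: (@le_lt_trans _ _ (\int[mu3]_q \sum_(n <oo) layer n q)%E).
  apply: ae_ge0_le_integral => //.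
  - by apply: measurableT_comp => //; exact/measurable_EFinP.
  - by move=> q _; apply: nneseries_ge0 => n _ _.
  - by apply: ge0_emeasurable_sum.
  apply: filterS ae_torus => q tq _; rewrite gee0_abs.
    exact: inv_dispersion_le.
  by rewrite lee_fin invr_ge0 dispersion_ge0.
rewrite integral_nneseries//.
apply: (@le_lt_trans _ _ (2 * (2 * pi) ^+ 3)%:E); last by rewrite ltry.
have term n : (\int[mu3]_q layer n q <= ((2 * pi) ^+ 3 * 2^-1 ^+ n)%:E)%E.
  have pi0 := pi_ge0 R.
  rewrite /layer; under eq_integral do rewrite EFinM.
  rewrite ge0_integralZl ?lee_fin ?exprn_ge0//; last first.
    by apply/measurable_EFinP; exact: measurable_indic (measurable_cube _).
  rewrite integral_indic ?setIT//; last exact: measurable_cube.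
  apply: (@le_trans _ _ ((4 ^+ n)%:E * ((2 * (pi * 2^-1 ^+ n)) ^+ 3)%:E)%E).
    apply: lee_wpmul2l; first by rewrite lee_fin exprn_ge0.
    by apply: cube_measure_le; rewrite mulr_ge0// exprn_ge0.
  rewrite -EFinM lee_fin mulrA exprMn.
  rewrite mulrCA ler_wpM2l ?exprn_ge0 ?mulr_ge0//.
  have -> : (4 : R) = 2 * 2 by ring.
  rewrite exprMn -exprM mulnC exprM -!exprMn.
  by rewrite (_ : 2 * 2 * 2^-1 ^+ 3 = 2^-1 :> R)//; field.
apply: lime_le.
  by apply: is_cvg_nneseries => n _ _; apply: integral_ge0.
apply: nearW => n.
apply: (@le_trans _ _ (\sum_(0 <= i < n) ((2 * pi) ^+ 3 * 2^-1 ^+ i)%:E)%E).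
  by apply: lee_sum => i _.
rewrite sumEFin lee_fin -mulr_sumr mulrC ler_wpM2r ?exprn_ge0 ?mulr_ge0 ?pi_ge0//.
have -> : \sum_(0 <= i < n) 2^-1 ^+ i = 2 * (1 - 2^-1 ^+ n) :> R.
  elim: n => [|n IH]; first by rewrite big_geq// expr0 subrr mulr0.
  by rewrite big_nat_recr//= IH exprS; field.
by rewrite ler_piMr// lerBlDr lerDl exprn_ge0.
Qed.

(** A set of positive measure on which all three terms of the dispersion are
    bounded away from zero. *)
Definition corner : set R3 :=
  `]pi / 2, pi]%classic `*` `]pi / 2, pi]%classic `*` `]pi / 2, pi]%classic.

Lemma measurable_corner : measurable corner.
Proof. by do 2 ?apply: measurableX; exact: measurable_itv. Qed.

Lemma corner_measure : mu3 corner = ((pi / 2) ^+ 3)%:E.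
Proof.
have pi0 := pi_gt0 R.
rewrite torus_boxE; try exact: measurable_itv.
rewrite circle_measure_itv; [|lra|lra|lra].
by rewrite -!EFinM; congr EFin; field.
Qed.

Lemma corner_ge1 (q : R3) : corner q ->
  [/\ 1 <= 1 - cos q.1.1, 1 <= 1 - cos q.1.2 & 1 <= 1 - cos q.2].
Proof.
have far (x : R) : pi / 2 < x <= pi -> 1 <= 1 - cos x.
  move=> /andP[x1 x2]; have pi0 := pi_gt0 R.
  have := @one_minus_cos_ge R 0%N x; rewrite expr0 expr1 ger0_norm; last by lra.
  by apply.
by rewrite /corner /= !in_itv/= => -[[c1 c2] c3]; split; apply: far.
Qed.

Definition inv_dispersion_mass : R := \int[mu3]_q (dispersion q)^-1.

Lemma inv_dispersion_mass_gt0 : 0 < inv_dispersion_mass.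
Proof.
have pi0 := pi_gt0 R.
have mc := measurable_corner.
have cI : mu3.-integrable setT (EFin \o (fun q => 6^-1 * \1_corner q)).
  apply: L2_integrable; apply: (@bounded_L2 _ _ _ _ _ 1).
    by apply: measurable_funM => //; exact: measurable_indic.
  by move=> q; rewrite indicE; case: (_ \in _); rewrite ?mulr1 ?mulr0 ?normr0// ger0_norm; lra.
apply: (@lt_le_trans _ _ (\int[mu3]_q (6^-1 * \1_corner q))).
  have ic : mu3.-integrable setT (EFin \o (\1_corner : R3 -> R)).
    apply: L2_integrable; apply: (@bounded_L2 _ _ _ _ _ 1).
      exact: measurable_indic.
    by move=> q; rewrite indicE; case: (_ \in _); rewrite ?normr1 ?normr0.
  rewrite RintegralZl// mulr_gt0//.
  have -> : \int[mu3]_x (\1_corner x : R) = fine (mu3 corner).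
    by rewrite /Rintegral integral_indic// setIT.
  rewrite corner_measure /=.
  by rewrite exprn_gt0// divr_gt0.
apply: le_Rintegral => //; first exact: inv_dispersion_integrable.
move=> q _; rewrite indicE; case: (boolP (q \in corner)) => [/set_mem/corner_ge1[h1 h2 h3]|_].
  rewrite mulr1 lef_pV2 ?posrE//; first exact: dispersion_le6.
  by rewrite /dispersion; lra.
by rewrite mulr0 invr_ge0 dispersion_ge0.
Qed.

End TorusMeasure.

(** * Bounds and continuity of the energies *)

Section Energy.
Variables (R : realType) (gamma : R).
Local Notation RR := (measurableTypeR R).
Local Notation R3 := (RR * RR * RR)%type.
Local Notation circ := (circle_measure R).
Local Notation mu3 := (torus_measure R).
Hypothesis gamma_gt0 : 0 < gamma.

Lemma couplingE :
  coupling gamma / (2 * pi) ^+ 3 = (1 + gamma) / inv_dispersion_mass R.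
Proof.
have p0 : (2 * pi) ^+ 3 != 0 :> R by rewrite expf_neq0// mulf_neq0// gt_eqF// pi_gt0.
rewrite /coupling /mu0 -/(inv_dispersion_mass R); move: p0; set c := (2 * pi) ^+ 3 => p0.
by apply: (mulIf p0); rewrite divfK//; ring.
Qed.

Lemma coupling_gt0 : 0 < coupling gamma / (2 * pi) ^+ 3.
Proof. by rewrite couplingE divr_gt0 ?inv_dispersion_mass_gt0// addr_gt0. Qed.

Lemma dispersion_lipschitz (p q : R3) :
  `|dispersion p - dispersion q| <=
    `|p.1.1 - q.1.1| + `|p.1.2 - q.1.2| + `|p.2 - q.2|.
Proof.
have -> : dispersion p - dispersion q =
    (cos q.1.1 - cos p.1.1) + (cos q.1.2 - cos p.1.2) + (cos q.2 - cos p.2).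
  by rewrite /dispersion; ring.
rewrite (distrC p.1.1) (distrC p.1.2) (distrC p.2).
do 2 (apply: le_trans (ler_normD _ _) _; apply: lerD; last exact: cos_lipschitz).
exact: cos_lipschitz.
Qed.

(** The energies are functions on all of [R^3]; periodicity extends to every point
    what the infima and suprema over the torus say there. *)
Lemma torus_representative (p : R3) : exists2 p' : R3, torus p' &
  dispersion p' = dispersion p /\ forall a, dispersion (a - p') = dispersion (a - p).
Proof.
have [x [x1 [n1 xE]]] := reduce_2pi p.1.1.
have [y [y1 [n2 yE]]] := reduce_2pi p.1.2.
have [z [z1 [n3 zE]]] := reduce_2pi p.2.
have per (c u : R) n : cos (c - (u + 2 * pi * n%:~R)) = cos (c - u).
  by rewrite opprD addrA -(cosD2pin n (c - u - _)) subrK.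
exists (x, y, z); first by rewrite /torus /circle /= !in_itv/=.
split=> [|a]; rewrite /dispersion /=.
  by rewrite xE yE zE !cosD2pin.
by rewrite xE yE zE !per.
Qed.

Lemma torus_representatives (p q : R3) : exists p' q' : R3,
  [/\ torus p', torus q' & forall K, energy3 K gamma (p', q') = energy3 K gamma (p, q)].
Proof.
have [p' tp [dp dp']] := torus_representative p.
have [q' tq [dq dq']] := torus_representative q.
exists p', q'; split=> // K; rewrite /energy3 /= dp dq dq'.
by rewrite (addrAC K) dp' (addrAC K).
Qed.

Lemma measurable_dispersion_comp d (T : measurableType d) (f : T -> R3) :
  measurable_fun setT f -> measurable_fun setT (fun x => dispersion (f x)).
Proof. by move=> mf; apply: measurableT_comp mf; exact: measurable_dispersion. Qed.

Lemma measurable_sub3 d (T : measurableType d) (f g : T -> R3) :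
  measurable_fun setT f -> measurable_fun setT g ->
  measurable_fun setT (fun x => f x - g x : R3).
Proof.
move=> mf mg.
have c1 (h : T -> R3) : measurable_fun setT h -> measurable_fun setT (fun x : T => (h x).1.1 : RR).
  by move=> mh; exact: (measurableT_comp (@measurable_coord1 R) mh).
have c2 (h : T -> R3) : measurable_fun setT h -> measurable_fun setT (fun x : T => (h x).1.2 : RR).
  by move=> mh; exact: (measurableT_comp (@measurable_coord2 R) mh).
have c3 (h : T -> R3) : measurable_fun setT h -> measurable_fun setT (fun x : T => (h x).2 : RR).
  by move=> mh; exact: (measurableT_comp (@measurable_coord3 R) mh).
apply: measurable_fun_pair; last exact: (measurable_funB (c3 _ mf) (c3 _ mg)).
apply: measurable_fun_pair; first exact: (measurable_funB (c1 _ mf) (c1 _ mg)).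
exact: (measurable_funB (c2 _ mf) (c2 _ mg)).
Qed.

Lemma measurable_energy2 (k : R3) : measurable_fun setT (energy2 k gamma).
Proof.
apply: measurable_funD; first exact: measurable_dispersion.
apply: measurable_funM => //; apply: measurable_dispersion_comp.
exact: measurable_sub3.
Qed.

Lemma measurable_energy3 (K : R3) : measurable_fun setT (energy3 K gamma).
Proof.
apply: measurable_funD; first apply: measurable_funD.
- exact: measurable_dispersion_comp measurable_fst.
- exact: measurable_dispersion_comp measurable_snd.
apply: measurable_funM => //; apply: measurable_dispersion_comp.
by apply: measurable_sub3 => //; exact: measurable_sub3.
Qed.

Lemma energy2_ge0 (k q : R3) : 0 <= energy2 k gamma q.
Proof. by rewrite addr_ge0 ?mulr_ge0 ?dispersion_ge0// ltW. Qed.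

Lemma energy2_le (k q : R3) : energy2 k gamma q <= 6 + gamma * 6.
Proof. by rewrite lerD ?dispersion_le6// ler_wpM2l ?dispersion_le6// ltW. Qed.

Lemma energy3_energy2 (K p q : R3) :
  energy3 K gamma (p, q) = dispersion p + energy2 (K - p) gamma q.
Proof. exact: esym (addrA _ _ _). Qed.

Lemma energy3_sym (K p q : R3) : energy3 K gamma (q, p) = energy3 K gamma (p, q).
Proof. by rewrite /energy3 /= [dispersion q + _]addrC (addrAC K). Qed.

Lemma energy3_bounded (K : R3) x : `|energy3 K gamma x| <= 12 + gamma * 6.
Proof.
case: x => p q; rewrite energy3_energy2 ger0_norm; last first.
  by rewrite addr_ge0 ?energy2_ge0// dispersion_ge0.
have := energy2_le (K - p) q; have := dispersion_le6 p; lra.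
Qed.

Lemma energy3_lipschitz (K p p' q : R3) :
  `|energy3 K gamma (p, q) - energy3 K gamma (p', q)| <=
    (1 + gamma) * (`|p.1.1 - p'.1.1| + `|p.1.2 - p'.1.2| + `|p.2 - p'.2|).
Proof.
have g0 := ltW gamma_gt0.
have -> : energy3 K gamma (p, q) - energy3 K gamma (p', q) =
    (dispersion p - dispersion p') +
    gamma * (dispersion (K - p - q) - dispersion (K - p' - q)).
  by rewrite /energy3 /=; ring.
apply: le_trans (ler_normD _ _) _; rewrite mulrDl mul1r lerD ?dispersion_lipschitz//.
rewrite normrM ger0_norm// ler_wpM2l//.
apply: le_trans (dispersion_lipschitz _ _) _ => /=.
have e (a x y c : R) : `|a - x - c - (a - y - c)| = `|x - y|.
  by rewrite distrC; congr `|_|; ring.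
by rewrite !e.
Qed.

Let circle_net (e : R) : 0 < e -> exists (n : nat) (c : 'I_n -> R),
  forall x, - pi < x <= pi -> exists i, `|x - c i| <= e.
Proof.
move=> e0.
exists (Num.truncn (2 * pi / e)).+1, (fun i => - pi + i%:R * e) => x /andP[x1 x2].
have t0 : 0 <= (x + pi) / e by rewrite divr_ge0 ?(ltW e0)//; lra.
have /andP[h1 h2] := truncn_itv t0.
have lt : (Num.truncn ((x + pi) / e) < (Num.truncn (2 * pi / e)).+1)%N.
  rewrite ltnS; apply: le_truncn; rewrite ler_pM2r ?invr_gt0//; lra.
exists (Ordinal lt) => /=; set m := Num.truncn _ in h1 h2 *.
rewrite ler_pdivlMr// in h1; rewrite ltr_pdivrMr// -natr1 mulrDl mul1r in h2.
rewrite ger0_norm; lra.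
Qed.

(** The family of fibres is totally bounded in the uniform norm: Lipschitz
    dependence on [p], and a finite grid on the torus. *)
Lemma energy3_net (K : R3) (e : R) : 0 < e -> exists (n : nat) (c : 'I_n -> R3),
  forall p, exists i, forall q, `|energy3 K gamma (p, q) - energy3 K gamma (c i, q)| <= e.
Proof.
move=> e0; have g0 : 0 < (1 + gamma) * 3 by rewrite mulr_gt0// addr_gt0.
have [n [c cP]] := circle_net (divr_gt0 e0 g0).
pose I := ('I_n * 'I_n * 'I_n)%type.
exists #|{: I}|, (fun i => let j := enum_val i in (c j.1.1, c j.1.2, c j.2)) => p.
have [p' tp' [dp dp']] := torus_representative p.
have [[/= h1 h2] h3] := tp'.
rewrite /circle /= !in_itv/= in h1 h2 h3.
have [i1 c1] := cP _ h1; have [i2 c2] := cP _ h2; have [i3 c3] := cP _ h3.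
exists (enum_rank ((i1, i2, i3) : I)) => q.
have -> : energy3 K gamma (p, q) = energy3 K gamma (p', q).
  by rewrite /energy3 /= dp (addrAC K) -dp' (addrAC K).
apply: le_trans (energy3_lipschitz _ _ _ _) _.
rewrite enum_rankK /=.
have : e = (1 + gamma) * 3 * (e / ((1 + gamma) * 3)) by rewrite mulrC divfK// gt_eqF.
set r := e / _ in c1 c2 c3 * => ->; rewrite -mulrA ler_pM2l ?addr_gt0//; lra.
Qed.

(** The set is a small box with upper corner [p], which stays inside the torus
    because the torus is half-open on the left. *)
Lemma energy3_localizable (K p : R3) : torus p ->
  localizable mu3 (energy3 K gamma) p.
Proof.
move=> [[/= h1 h2] h3] e e0.
rewrite /circle /= !in_itv/= in h1 h2 h3.
have g0 : 0 < (1 + gamma) * 3 by rewrite mulr_gt0// addr_gt0.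
pose r := Num.min 1 (Num.min e (Num.min (e / ((1 + gamma) * 3))
  (Num.min (p.1.1 + pi) (Num.min (p.1.2 + pi) (p.2 + pi))))).
have /andP[a1 b1] := h1; have /andP[a2 b2] := h2; have /andP[a3 b3] := h3.
have r0 : 0 < r by rewrite !lt_min ltr01 e0 divr_gt0//=; apply/and3P; split; lra.
have [r1 re rg [s1 s2 s3]] : [/\ r <= 1, r <= e, r <= e / ((1 + gamma) * 3)
    & [/\ r <= p.1.1 + pi, r <= p.1.2 + pi & r <= p.2 + pi]].
  have : r <= r by []; rewrite {2}/r !le_min.
  by move=> /and5P[-> -> -> -> /andP[-> ->]].
pose I x : set RR := `]x - r, x]%classic.
exists (I p.1.1 `*` I p.1.2 `*` I p.2); split.
- by do 2 ?apply: measurableX; exact: measurable_itv.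
- rewrite torus_boxE; try exact: measurable_itv.
  have m x : r <= x + pi -> x <= pi -> circ (I x) = r%:E.
    by move=> ? ?; rewrite circle_measure_itv; [congr EFin; ring|lra|lra|].
  rewrite !m// -!EFinM /= !mulr_gt0//=.
  apply: le_trans re; rewrite -[leRHS]mulr1 -mulrA ler_pM2l// mulr_ile1 ?(ltW r0)//.
- move=> [[x y] z] [[/= i1 i2] i3] q.
  rewrite /I /= !in_itv/= in i1 i2 i3.
  have n (x' y' : R) : y' - r < x' <= y' -> `|x' - y'| <= e / ((1 + gamma) * 3).
    by move=> /andP[j1 j2]; apply: le_trans rg; rewrite ler0_norm; lra.
  have := n _ _ i1; have := n _ _ i2; have := n _ _ i3.
  move=> c1 c2 c3.
  apply: le_trans (energy3_lipschitz _ _ _ _) _ => /=.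
  have : e = (1 + gamma) * 3 * (e / ((1 + gamma) * 3)) by rewrite mulrC divfK// gt_eqF.
  move=> -> ; rewrite -mulrA ler_pM2l ?addr_gt0//; lra.
Qed.

Definition energy3_min (K : R3) : R :=
  inf [set energy3 K gamma pq | pq in @torus R `*` @torus R].

Lemma torus0 : torus (0 : R3).
Proof.
have pi0 := pi_gt0 R.
by rewrite /torus /circle /= !in_itv/=; do !split; apply/andP; split; lra.
Qed.

Let energy3_set (K : R3) := [set energy3 K gamma pq | pq in @torus R `*` @torus R].

Let energy3_set0 K : energy3_set K !=set0.
Proof.
exists (energy3 K gamma (0, 0)); exists (0, 0) => //.
by split; exact: torus0.
Qed.

Lemma energy3_min_le (K : R3) x : energy3_min K <= energy3 K gamma x.
Proof.
case: x => p q; have [p' [q' [tp tq <-]]] := torus_representatives p q.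
apply: ge_inf; last by exists (p', q').
exists (- (12 + gamma * 6)) => _ [y _ <-].
by have := energy3_bounded K y; rewrite ler_norml => /andP[].
Qed.

Lemma energy3_le_max (K : R3) x : energy3 K gamma x <= energy3_max K gamma.
Proof.
case: x => p q; have [p' [q' [tp tq <-]]] := torus_representatives p q.
apply: ub_le_sup; last by exists (p', q').
exists (12 + gamma * 6) => _ [y _ <-].
by have := energy3_bounded K y; rewrite ler_norml => /andP[].
Qed.

Lemma energy3_near_min (K : R3) e : 0 < e -> exists p q : R3,
  [/\ torus p, torus q & energy3 K gamma (p, q) < energy3_min K + e].
Proof.
move=> e0; have hi : has_inf (energy3_set K).
  split; first exact: energy3_set0.
  exists (- (12 + gamma * 6)) => _ [y _ <-].
  by have := energy3_bounded K y; rewrite ler_norml => /andP[].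
have [_ [[p q] [tp tq] <-] lt] := inf_adherent e0 hi.
by exists p, q.
Qed.

Lemma energy3_near_max (K : R3) e : 0 < e -> exists p q : R3,
  [/\ torus p, torus q & energy3_max K gamma - e < energy3 K gamma (p, q)].
Proof.
move=> e0; have hs : has_sup (energy3_set K).
  split; first exact: energy3_set0.
  exists (12 + gamma * 6) => _ [y _ <-].
  by have := energy3_bounded K y; rewrite ler_norml => /andP[].
have [_ [[p q] [tp tq] <-] lt] := sup_adherent e0 hs.
by exists p, q.
Qed.

(** The energy is not constant: moving the fermions by opposite amounts changes
    their kinetic energies and leaves the boson alone. *)
Lemma energy3_min_lt_max (K : R3) : energy3_min K < energy3_max K gamma.
Proof.
rewrite lt_neqAle (le_trans (energy3_min_le K 0) (energy3_le_max K 0)) andbT.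
apply/eqP => eq.
have cst x : energy3 K gamma x = energy3_min K.
  by apply/eqP; rewrite eq_le energy3_min_le eq energy3_le_max.
have := cst ((pi / 2, 0, 0), (- (pi / 2), 0, 0)).
rewrite -(cst (0, 0)) /energy3 /dispersion /=.
rewrite cosN cos_pihalf cos0.
rewrite (_ : K.1.1 - pi / 2 - - (pi / 2) = K.1.1 - 0 - 0); last by ring.
set c := gamma * _; lra.
Qed.

Lemma energy2_min_le (k q : R3) : energy2_min k gamma <= energy2 k gamma q.
Proof.
have [q' tq [dq dq']] := torus_representative q.
rewrite (_ : energy2 k gamma q = energy2 k gamma q'); last by rewrite /energy2 dq dq'.
apply: ge_inf; last by exists q'.
by exists 0 => _ [y _ <-]; exact: energy2_ge0.
Qed.

Lemma le_energy2_min (k : R3) m : (forall q, m <= energy2 k gamma q) ->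
  m <= energy2_min k gamma.
Proof.
move=> h; apply: lb_le_inf; last by move=> _ [y _ <-].
by exists (energy2 k gamma 0); exists 0 => //; exact: torus0.
Qed.

End Energy.

(** * Bound states of a pair *)

Section InverseIntegral.
Context d (T : measurableType d) (R : realType).
Variable mu : {finite_measure set T -> \bar R}.
Local Notation M := (total_mass mu).
Implicit Types u v : T -> R.

Lemma inv_L2 u c : measurable_fun setT u -> 0 < c -> (forall x, c <= u x) ->
  (fun x => (u x)^-1) \in Lfun mu 2%:E.
Proof.
move=> mu' c0 cu; have u0 x : 0 < u x by exact: lt_le_trans (cu x).
apply: (@bounded_L2 _ _ _ mu _ c^-1).
  by apply: measurable_inv => // x; rewrite (ltW (u0 x)).
by move=> x; rewrite ger0_norm ?invr_ge0 ?(ltW (u0 x))// lef_pV2 ?posrE.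
Qed.

Lemma inv_integrable u c : measurable_fun setT u -> 0 < c -> (forall x, c <= u x) ->
  mu.-integrable setT (EFin \o (fun x => (u x)^-1)).
Proof. by move=> mu' c0 cu; apply: L2_integrable; exact: inv_L2 cu. Qed.

Section Pair.
Variables (u v : T -> R) (c : R).
Hypotheses (mu' : measurable_fun setT u) (mv : measurable_fun setT v).
Hypotheses (c0 : 0 < c) (cu : forall x, c <= u x) (cv : forall x, c <= v x).

Let u0 x : 0 < u x. Proof. exact: lt_le_trans (cu x). Qed.
Let v0 x : 0 < v x. Proof. exact: lt_le_trans (cv x). Qed.
Let iu := inv_integrable mu' c0 cu.
Let iv := inv_integrable mv c0 cv.

Lemma inv_integral_le : (forall x, u x <= v x) ->
  \int[mu]_x (v x)^-1 <= \int[mu]_x (u x)^-1.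
Proof. by move=> uv; apply: le_Rintegral => // x _; rewrite lef_pV2 ?posrE. Qed.

Lemma inv_integral_lipschitz e : (forall x, `|u x - v x| <= e) ->
  `|\int[mu]_x (u x)^-1 - \int[mu]_x (v x)^-1| <= e / c ^+ 2 * M.
Proof.
move=> uv; rewrite -RintegralB//.
have iuv : mu.-integrable setT (EFin \o (fun x => (u x)^-1 - (v x)^-1)).
  have := integrableB measurableT iu iv; congr (integrable _ _ _).
apply: le_trans (le_normr_Rintegral measurableT iuv) _.
rewrite -Rintegral_cst//; apply: le_Rintegral => //.
- exact: integrable_norm.
- by apply: L2_integrable; exact: L2_cst.
move=> x _.
have -> : (u x)^-1 - (v x)^-1 = (v x - u x) * (u x * v x)^-1.
  by field; rewrite !gt_eqF.
rewrite normrM distrC ler_pM//.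
rewrite ger0_norm ?invr_ge0 ?mulr_ge0 ?(ltW (u0 x)) ?(ltW (v0 x))//.
rewrite lef_pV2 ?posrE ?exprn_gt0 ?mulr_gt0// expr2.
by rewrite ler_pM// ltW.
Qed.

(** A quantitative form of strict monotonicity, uniform in [u] and [v]. *)
Lemma inv_integral_gap s C : 0 <= s -> (forall x, u x + s <= v x) ->
  (forall x, v x <= C) ->
  s / C ^+ 2 * M <= \int[mu]_x (u x)^-1 - \int[mu]_x (v x)^-1.
Proof.
move=> s0 uv vC; rewrite -RintegralB// -Rintegral_cst//.
apply: le_Rintegral => //.
- by apply: L2_integrable; exact: L2_cst.
- have := integrableB measurableT iu iv; congr (integrable _ _ _).
move=> x _.
have -> : (u x)^-1 - (v x)^-1 = (v x - u x) * (u x * v x)^-1.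
  by field; rewrite !gt_eqF.
have C0 : 0 < C by exact: lt_le_trans (vC x).
have ux : u x <= C by apply: le_trans (vC x); apply: le_trans (uv x); rewrite lerDl.
rewrite ler_pM//; first by rewrite invr_ge0 exprn_ge0// ltW.
  by rewrite lerBrDl.
rewrite lef_pV2 ?posrE ?exprn_gt0 ?mulr_gt0// expr2.
by rewrite ler_pM// ltW.
Qed.
End Pair.

End InverseIntegral.

Lemma ReM_real (R : realType) (a : R) (w : R[i]) :
  complex.Re (a%:C%C * w) = a * complex.Re w.
Proof. by case: w => x y /=; rewrite mul0r subr0. Qed.

Lemma ImM_real (R : realType) (a : R) (w : R[i]) :
  complex.Im (a%:C%C * w) = a * complex.Im w.
Proof. by case: w => x y /=; rewrite mul0r addr0. Qed.

Section BoundState.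
Variables (R : realType) (gamma : R).
Local Notation RR := (measurableTypeR R).
Local Notation R3 := (RR * RR * RR)%type.
Local Notation mu3 := (torus_measure R).
Local Notation M := (total_mass mu3).
Local Notation g := (coupling gamma / (2 * pi) ^+ 3).
Hypothesis gamma_gt0 : 0 < gamma.

Lemma torus_mass_gt0 : 0 < M.
Proof.
have pi0 := pi_gt0 R.
rewrite /total_mass (_ : [set: R3] = setT `*` setT `*` setT); last by apply/seteqP; split.
by rewrite torus_boxE// !circle_mass -!EFinM /= !mulr_gt0.
Qed.

(** A function [f] with [h2 f = z f] is a multiple of [(E - z)^-1], and then the
    multiple, which is the integral of [f], has to be reproduced. *)
Lemma eigenvalue_h2 (k : R3) (z : R) : z < energy2_min k gamma ->
  is_eigenvalue mu3 (cL2 mu3) (h2 gamma k) z%:C%C <->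
  g * \int[mu3]_q (energy2 k gamma q - z)^-1 = 1.
Proof.
move=> zm; set W := fun q => (energy2 k gamma q - z)^-1.
have c0 : 0 < energy2_min k gamma - z by rewrite subr_gt0.
have cu q : energy2_min k gamma - z <= energy2 k gamma q - z.
  by rewrite lerB// energy2_min_le.
have u0 q : 0 < energy2 k gamma q - z by exact: lt_le_trans (cu q).
have mE : measurable_fun setT (fun q => energy2 k gamma q - z).
  by apply: measurable_funB => //; exact: measurable_energy2.
have WL : W \in Lfun mu3 2%:E by exact: inv_L2 cu.
have g0 := coupling_gt0 gamma_gt0.
split=> [[f [[rL iL] ef] fN0]|det]; last first.
  exists (fun q => Complex (W q) 0).
    split; first by split => //; exact: L2_cst.
    apply: nearW => q _; apply: eq_ReIm.
      rewrite /h2 !(ReD, ReN, ReM) /= !mul0r !subr0 det.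
      by rewrite -[X in _ - X](mulfV (lt0r_neq0 (u0 q))) /W; ring.
      rewrite /h2 !(ImD, ImN, ImM) /= Rintegral_cst// !mul0r.
    by rewrite ?mulr0 ?mul0r ?addr0 ?mulr0 ?oppr0 ?addr0.
  move=> ae0; have : g * \int[mu3]_q W q = 0.
    rewrite (_ : \int[mu3]_q W q = \int[mu3]_q (0 : R)).
      by rewrite Rintegral_cst// mul0r mulr0.
    apply: ae_eq_Rintegral => //; first exact: L2_measurable WL.
    by apply: filterS ae0 => q /(_ I)[].
  by rewrite det => /eqP; rewrite oner_eq0.
set r := (fun q => complex.Re (f q)) in rL.
set i := (fun q => complex.Im (f q)) in iL.
have part (h : R3 -> R) c : h \in Lfun mu3 2%:E ->
    h = (fun q => c * W q) %[ae mu3] -> \int[mu3]_q h q = c * \int[mu3]_q W q.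
  move=> hL hW; rewrite -RintegralZl//; last exact: L2_integrable.
  apply: ae_eq_Rintegral => //; first exact: L2_measurable hL.
  by apply: measurable_funM => //; exact: L2_measurable WL.
have solve q (x c : R) : energy2 k gamma q * x - c = z * x -> x = c * W q.
  move=> e; have -> : c = (energy2 k gamma q - z) * x by rewrite mulrBl -e; ring.
  by rewrite mulrAC /W mulfV ?mul1r// gt_eqF.
have rW : r = (fun q => (g * \int[mu3]_q r q) * W q) %[ae mu3].
  apply: filterS ef => q /(_ I) e _; apply: solve.
  have := congr1 (@complex.Re R) e; rewrite /h2 ReD ReN !ReM_real.
  exact.
have iW : i = (fun q => (g * \int[mu3]_q i q) * W q) %[ae mu3].
  apply: filterS ef => q /(_ I) e _; apply: solve.
  have := congr1 (@complex.Im R) e; rewrite /h2 ImD ImN !ImM_real.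
  exact.
have dich (h : R3 -> R) : h \in Lfun mu3 2%:E ->
    h = (fun q => (g * \int[mu3]_q h q) * W q) %[ae mu3] ->
    \int[mu3]_q h q = 0 \/ g * \int[mu3]_q W q = 1.
  move=> hL /(part _ _ hL); set c := \int[mu3]_q h q => e.
  have [c00|cN0] := eqVneq c 0; [by left|right].
  by apply: (mulfI cN0); rewrite mulr1 [RHS]e; ring.
have [r0|//] := dich _ rL rW; have [i0|//] := dich _ iL iW.
exfalso; apply: fN0; apply: filterS2 rW iW => q /(_ I) rq /(_ I) iq _.
apply: eq_ReIm.
  by rewrite -[LHS]/(r q) rq r0 mulr0 mul0r.
by rewrite -[LHS]/(i q) iq i0 mulr0 mul0r.
Qed.

Lemma cos1_circle (x : R) : - pi < x <= pi -> cos x = 1 -> x = 0.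
Proof.
move=> /andP[x1 x2] c1; have [x0|x0|//] := ltgtP x 0.
  suff : cos (- x) < cos 0 by rewrite cosN c1 cos0 ltxx.
  by rewrite ltr_cos ?in_itv/=; [lra|apply/andP; split; lra|apply/andP; split; lra].
suff : cos x < cos 0 by rewrite c1 cos0 ltxx.
by rewrite ltr_cos ?in_itv/=; [lra|apply/andP; split; lra|apply/andP; split; lra].
Qed.

Lemma cos1_in_2piZ (x : R) : cos x = 1 -> in_2piZ x.
Proof.
have [y [y1 [n ->]]] := reduce_2pi x; rewrite cosD2pin => /(cos1_circle y1) ->.
by exists n; rewrite add0r.
Qed.

Lemma ae_dispersion_gt0 : \forall q \ae mu3, 0 < dispersion q.
Proof.
pose Z : set RR := [set 0].
have m1 : measurable Z by exact: measurable_set1.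
have null : mu3.-negligible (Z `*` Z `*` Z).
  exists (Z `*` Z `*` Z); split => //.
    by do 2 ?apply: measurableX.
  rewrite torus_boxE// (_ : circle_measure R Z = 0%E) ?mule0//.
  apply/eqP; rewrite -measure_le0 -[X in (X <= _)%E]/(lebesgue_measure (Z `&` @circle R)).
  apply: (@le_trans _ _ (lebesgue_measure Z)); last first.
    by rewrite lebesgue_measure_set1.
  apply: le_measure; rewrite ?inE//; first by apply: measurableI => //; exact: measurable_itv.
have ae0 : \forall q \ae mu3, ~ (Z `*` Z `*` Z) q.
  by case: null => B [mB B0 sB]; exists B; split => // q /contrapT /sB.
apply: filterS2 (@ae_torus R) ae0 => q tq q0.
rewrite lt_neqAle dispersion_ge0 andbT; apply/negP => /eqP d0; apply: q0.
have [[/= h1 h2] h3] := tq.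
have z (x : R) : circle x -> 1 - cos x = 0 -> x = 0.
  by rewrite /circle /= in_itv/= => xc c0; apply: cos1_circle => //; lra.
have := cos_le1 q.1.1; have := cos_le1 q.1.2; have := cos_le1 q.2.
move: d0; rewrite /dispersion => d0 c3 c2 c1.
by split; [split|] => /=; apply: z => //; lra.
Qed.


(** A sum of two waves of amplitudes [1] and [gamma] with phase difference [a] is
    one wave, of amplitude [1 + gamma] only if they are in phase. *)
Lemma polar (a : R) : exists r phi : R,
  [/\ 0 <= r <= 1 + gamma, 0 <= phi <= 2 * pi, cos a != 1 -> r < 1 + gamma
    & forall x, cos x + gamma * cos (a - x) = r * cos (x - phi)].
Proof.
have pi0 := pi_gt0 R.
pose u := 1 + gamma * cos a; pose v := gamma * sin a.
have uv x : cos x + gamma * cos (a - x) = u * cos x + v * sin x.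
  by rewrite cosB /u /v; ring.
have n2 : u ^+ 2 + v ^+ 2 = (1 + gamma) ^+ 2 - 2 * gamma * (1 - cos a).
  rewrite /u /v exprMn (sin2cos2 a); ring.
have ca := cos_le1 a.
have s0 : 0 <= u ^+ 2 + v ^+ 2 by rewrite addr_ge0 ?sqr_ge0.
pose r := Num.sqrt (u ^+ 2 + v ^+ 2).
have r2 : r ^+ 2 = u ^+ 2 + v ^+ 2 by rewrite sqr_sqrtr.
have r0 : 0 <= r by exact: sqrtr_ge0.
have g1 : 0 < 1 + gamma by rewrite addr_gt0.
have rle : r <= 1 + gamma.
  rewrite -(ler_pXn2r (n := 2)) ?nnegrE ?(ltW g1)// r2 n2 gerBl.
  by rewrite !mulr_ge0 ?(ltW gamma_gt0)// subr_ge0.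
have rlt : cos a != 1 -> r < 1 + gamma.
  move=> c1; rewrite -(ltr_pXn2r (n := 2)) ?nnegrE ?(ltW g1)// r2 n2 gtrBl.
  by rewrite !mulr_gt0// subr_gt0 lt_neqAle c1.
have [rz|rN0] := eqVneq r 0.
  have [u0 v0] : u = 0 /\ v = 0.
    move: r2; rewrite rz expr0n /= => /esym/eqP.
    by rewrite paddr_eq0 ?sqr_ge0// !sqrf_eq0 => /andP[/eqP -> /eqP ->].
  exists r, 0; split => //; first by rewrite r0.
    by rewrite lexx mulr_ge0// ltW.
  by move=> x; rewrite uv u0 v0 rz !mul0r addr0.
have rp : 0 < r by rewrite lt_neqAle eq_sym rN0.
have ur : -1 <= u / r <= 1.
  rewrite -ler_norml normrM normfV (gtr0_norm rp) ler_pdivrMr// mul1r.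
  by rewrite -(ler_pXn2r (n := 2)) ?nnegrE// real_normK ?num_real// r2 lerDl sqr_ge0.
pose phi0 := acos (u / r).
have cphi : r * cos phi0 = u by rewrite /phi0 acosK ?in_itv/=// mulrC divfK.
have sphi : r * sin phi0 = `|v|.
  rewrite /phi0 sin_acos// -[X in X * _](ger0_norm r0) -sqrtr_sqr -sqrtrM ?sqr_ge0//.
  rewrite -[RHS]sqrtr_sqr; congr Num.sqrt.
  by rewrite mulrBr mulr1 expr_div_n mulrC divfK ?expf_neq0// r2 addrAC subrr add0r.
have phi1 : 0 <= phi0 <= pi by rewrite acos_ge0 ?acos_lepi.
have /andP[p1 p2] := phi1.
have [v0|v0] := leP 0 v.
  exists r, phi0; split => //; first by rewrite r0.
    by apply/andP; split; lra.
  by move=> x; rewrite uv cosB -cphi -(ger0_norm v0) -sphi; ring.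
exists r, (2 * pi - phi0); split => //; first by rewrite r0.
  by apply/andP; split; lra.
move=> x; rewrite uv (_ : x - _ = x + phi0 + 2 * pi * (- 1)%:~R); last first.
  by rewrite mulrN1z; ring.
rewrite cosD2pin cosD mulrBr -cphi.
have -> : v = - (r * sin phi0) by rewrite sphi ltr0_norm// opprK.
by ring.
Qed.

(** The normalization of [mu0]: at [k = 0] the coupling is exactly critical at
    the threshold. *)
Lemma inv_dispersion_det :
  g * \int[mu3]_q ((1 + gamma) * dispersion q)^-1 = 1.
Proof.
have g1 : 1 + gamma != 0 by rewrite gt_eqF// addr_gt0.
under eq_Rintegral do rewrite invfM.
rewrite RintegralZl//; last exact: inv_dispersion_integrable.
rewrite (couplingE gamma) -/(inv_dispersion_mass R).
by field; rewrite g1 gt_eqF ?inv_dispersion_mass_gt0.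
Qed.

Lemma inv_dispersion_shift_integrable :
  mu3.-integrable setT (EFin \o (fun q => ((1 + gamma) * dispersion q)^-1)).
Proof.
rewrite (_ : (fun q => _) = fun q => (1 + gamma)^-1 * (dispersion q)^-1); last first.
  by apply/funext => q; rewrite invfM.
have := integrableZl measurableT (1 + gamma)^-1 (inv_dispersion_integrable R).
by congr (integrable _ _ _); apply/funext => q /=; rewrite EFinM.
Qed.

(** Fatou's lemma as [s] tends to [0]. *)
Lemma inv_dispersion_le_limit c :
  (forall s, 0 < s <= 1 -> \int[mu3]_q ((1 + gamma) * dispersion q + s)^-1 <= c) ->
  \int[mu3]_q ((1 + gamma) * dispersion q)^-1 <= c.
Proof.
move=> hs; have g1 : 0 < 1 + gamma by rewrite addr_gt0.
pose B (q : R3) := (1 + gamma) * dispersion q.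
have B0 q : 0 <= B q by rewrite mulr_ge0 ?dispersion_ge0 ?(ltW g1).
have mB : measurable_fun setT B by apply: measurable_funM => //; exact: measurable_dispersion.
pose s n : R := n.+1%:R^-1.
have s0 n : 0 < s n by rewrite invr_gt0.
have s1 n : s n <= 1 by rewrite invf_le1// ler1n.
pose F n q := ((B q + s n)^-1)%:E.
have ms n : measurable_fun setT (fun q => B q + s n) by exact: measurable_funD.
have cs n q : s n <= B q + s n by rewrite lerDr.
have mF n : measurable_fun setT (F n).
  apply/measurable_EFinP; apply: measurable_inv => // q.
  by rewrite addr_ge0// ltW.
have iF n : mu3.-integrable setT (F n).
  exact: inv_integrable (ms n) (s0 n) (cs n).
have F0 n q : (0 <= F n q)%E by rewrite lee_fin invr_ge0 addr_ge0// ltW.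
have fin := integrable_fin_num measurableT inv_dispersion_shift_integrable.
rewrite -lee_fin /Rintegral fineK//.
apply: (@le_trans _ _ (\int[mu3]_q limn_einf (F^~ q))%E); last first.
  apply: le_trans (fatou mu3 measurableT mF _) _ => //.
  apply: limn_einf_le => n.
  rewrite -(fineK (integrable_fin_num measurableT (iF n))) lee_fin.
  by apply: hs; rewrite s0 s1.
apply: ge0_le_integral => //.
- by move=> q _; rewrite lee_fin invr_ge0; exact: B0.
- by apply/measurable_EFinP; exact: measurable_inv.
- exact: measurable_fun_limn_einf.
move=> q _ /=; rewrite -/(B q).
have [Bz|BN0] := eqVneq (B q) 0.
  by rewrite Bz invr0; apply: (@limn_einf_ge _ _ _ 0%N) => n _.
have Bp : 0 < B q by rewrite lt_neqAle eq_sym BN0 B0.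
apply/lee_addgt0Pr => e e0; rewrite -leeBlDr//.
have [N NP] : exists N, s N <= e * B q ^+ 2.
  have p0 : 0 < e * B q ^+ 2 by rewrite mulr_gt0// exprn_gt0.
  exists (Num.truncn (e * B q ^+ 2)^-1); rewrite /s.
  rewrite -[leRHS]invrK lef_pV2 ?posrE ?invr_gt0//.
  by rewrite ltW// truncnS_gt.
apply: (@limn_einf_ge _ _ _ N) => n Nn.
have sn : s n <= s N by rewrite lef_pV2 ?posrE// ler_nat.
rewrite -EFinB lee_fin lerBlDr -lerBlDl.
have Bs := addr_gt0 Bp (s0 n).
have -> : (B q)^-1 - (B q + s n)^-1 = s n * (B q * (B q + s n))^-1.
  by field; rewrite BN0 gt_eqF.
rewrite ler_pdivrMr; last exact: mulr_gt0 Bp Bs.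
apply: (le_trans sn); apply: (le_trans NP); rewrite ler_pM2l//.
by rewrite expr2 ler_pM2l// lerDl ltW.
Qed.


(** If all these integrals were at most critical, then those of
    [(1 + gamma) * dispersion + s] would be subcritical by a margin, coming from
    [corner], that does not depend on [s]; the margin would survive in the limit,
    against [inv_dispersion_det]. *)
Lemma supercritical (r : R3) : 0 <= r.1.1 <= 1 + gamma -> 0 <= r.1.2 <= 1 + gamma ->
  0 <= r.2 <= 1 + gamma -> r.1.1 + r.1.2 + r.2 < 3 * (1 + gamma) ->
  exists2 s, 0 < s <= 1 & 1 < g * \int[mu3]_q
    (r.1.1 * (1 - cos q.1.1) + r.1.2 * (1 - cos q.1.2) + r.2 * (1 - cos q.2) + s)^-1.
Proof.
move=> /andP[r1 r1'] /andP[r2 r2'] /andP[r3 r3'] rlt.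
have g1 : 0 < 1 + gamma by rewrite addr_gt0.
have g0 := coupling_gt0 gamma_gt0.
pose A (q : R3) := r.1.1 * (1 - cos q.1.1) + r.1.2 * (1 - cos q.1.2) + r.2 * (1 - cos q.2).
pose B (q : R3) := (1 + gamma) * dispersion q.
apply: contrapT => nex.
have sub s : 0 < s <= 1 -> \int[mu3]_q (A q + s)^-1 <= g^-1.
  move=> hs; rewrite -[leRHS]mulr1 ler_pdivlMl// leNgt; apply/negP => gt1.
  by apply: nex; exists s.
have c1 (x : R) : 0 <= 1 - cos x by rewrite subr_ge0 cos_le1.
have c2 (x : R) : 1 - cos x <= 2 by have := cos_geN1 x; lra.
have A0 q : 0 <= A q by rewrite /A !addr_ge0// mulr_ge0.
have BA q : B q - A q = (1 + gamma - r.1.1) * (1 - cos q.1.1) +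
   (1 + gamma - r.1.2) * (1 - cos q.1.2) + (1 + gamma - r.2) * (1 - cos q.2).
  by rewrite /A /B /dispersion; ring.
have AB q : A q <= B q.
  by rewrite -subr_ge0 BA !addr_ge0// mulr_ge0// subr_ge0.
have B0 q : 0 <= B q by exact: le_trans (AB q).
have B6 q : B q <= (1 + gamma) * 6 by rewrite ler_wpM2l ?dispersion_le6// ltW.
have mB : measurable_fun setT B by apply: measurable_funM => //; exact: measurable_dispersion.
have mc c (f : R3 -> RR) : measurable_fun setT f -> measurable_fun setT (fun q => c * (1 - cos (f q))).
  move=> mf; apply: measurable_funM => //; apply: measurable_funB => //.
  exact: measurable_cos_comp.
have mA : measurable_fun setT A.
  apply: measurable_funD; first apply: measurable_funD.
  - exact: mc (measurable_coord1 (R := R)).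
  - exact: mc (measurable_coord2 (R := R)).
  - exact: mc (measurable_coord3 (R := R)).
pose eta := 3 * (1 + gamma) - (r.1.1 + r.1.2 + r.2).
have eta0 : 0 < eta by rewrite subr_gt0.
pose C := (1 + gamma) * 6 + 1.
have C0 : 0 < C by rewrite ltr_wpDl// mulr_ge0// ltW.
pose c0 := (pi / 2 : R) ^+ 3.
have c00 : 0 < c0 by rewrite exprn_gt0// divr_gt0// pi_gt0.
pose theta := eta / C ^+ 2.
have th0 : 0 < theta by rewrite divr_gt0// exprn_gt0.
have mco := @measurable_corner R.
have ic : mu3.-integrable setT (EFin \o (\1_(@corner R) : R3 -> R)).
  apply: L2_integrable; apply: (@bounded_L2 _ _ _ _ _ 1).
    exact: measurable_indic.
  by move=> q; rewrite indicE; case: (_ \in _); rewrite ?normr1 ?normr0.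
have ict : mu3.-integrable setT (EFin \o (fun q => theta * \1_(@corner R) q)).
  have := integrableZl measurableT theta ic; congr (integrable _ _ _).
have cint : \int[mu3]_q (theta * \1_(@corner R) q) = theta * c0.
  rewrite RintegralZl//; congr (_ * _).
  have -> : \int[mu3]_x (\1_(@corner R) x : R) = fine (mu3 (@corner R)).
    by rewrite /Rintegral integral_indic// setIT.
  by rewrite corner_measure.
have key s : 0 < s <= 1 -> \int[mu3]_q (B q + s)^-1 <= g^-1 - theta * c0.
  move=> /andP[s0 s1]; rewrite lerBrDr -cint.
  have iA : mu3.-integrable setT (EFin \o (fun q => (A q + s)^-1)).
    by apply: (@inv_integrable _ _ _ _ _ s) => //; [exact: measurable_funD|move=> q; rewrite lerDr].
  have iB : mu3.-integrable setT (EFin \o (fun q => (B q + s)^-1)).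
    by apply: (@inv_integrable _ _ _ _ _ s) => //; [exact: measurable_funD|move=> q; rewrite lerDr].
  rewrite -RintegralD//.
  apply: (@le_trans _ _ (\int[mu3]_q (A q + s)^-1)); last by apply: sub; rewrite s0.
  apply: le_Rintegral => //.
    have := integrableD measurableT iB ict; congr (integrable _ _ _).
  move=> q _; have As : 0 < A q + s by rewrite ltr_wpDl.
  have Bs : 0 < B q + s by rewrite ltr_wpDl.
  rewrite -lerBrDl (_ : _ - _ = (B q - A q) / ((A q + s) * (B q + s))); last first.
    by field; rewrite !gt_eqF.
  have BsC : B q + s <= C by rewrite lerD.
  have AsC : A q + s <= C by apply: le_trans BsC; rewrite lerD2r.
  rewrite indicE; case: (boolP (q \in _)) => [/set_mem/corner_ge1[h1 h2 h3]|_]; last first.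
    by rewrite mulr0 divr_ge0 ?subr_ge0// mulr_ge0// ltW.
  rewrite mulr1 /theta ler_pM ?(ltW eta0) ?invr_ge0 ?exprn_ge0 ?(ltW C0)//; last first.
    by rewrite lef_pV2 ?posrE ?exprn_gt0 ?mulr_gt0// expr2 ler_pM// ltW.
  rewrite BA /eta.
  have w (a x : R) : 0 <= a -> 1 <= x -> a <= a * x by move=> a0 x1; rewrite ler_peMr.
  have := w (1 + gamma - r.1.1) _ _ h1; rewrite subr_ge0 => /(_ r1').
  have := w (1 + gamma - r.1.2) _ _ h2; rewrite subr_ge0 => /(_ r2').
  have := w (1 + gamma - r.2) _ _ h3; rewrite subr_ge0 => /(_ r3').
  by lra.
have lim := inv_dispersion_le_limit key.
have := inv_dispersion_det; apply/eqP; rewrite lt_eqF//.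
apply: (@le_lt_trans _ _ (g * (g^-1 - theta * c0))); first by rewrite ler_pM2l.
rewrite mulrBr mulfV ?gt_eqF// gtrBl; exact: mulr_gt0 g0 (mulr_gt0 th0 c00).
Qed.

(** By [polar] in each coordinate and a translation of the torus, the integral is
    that of a sum of cosines with amplitudes [r]; [m] is the value of the pair
    energy at the common minimum of the three terms. *)
Lemma energy2_polar (k : R3) : exists (r : R3) (m : R),
  [/\ [/\ 0 <= r.1.1 <= 1 + gamma, 0 <= r.1.2 <= 1 + gamma & 0 <= r.2 <= 1 + gamma],
      ~ [/\ cos k.1.1 = 1, cos k.1.2 = 1 & cos k.2 = 1] ->
        r.1.1 + r.1.2 + r.2 < 3 * (1 + gamma),
      0 <= m, (forall q, m <= energy2 k gamma q)
    & forall s, 0 < s -> \int[mu3]_q (energy2 k gamma q - (m - s))^-1 =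
      \int[mu3]_q (r.1.1 * (1 - cos q.1.1) + r.1.2 * (1 - cos q.1.2) +
        r.2 * (1 - cos q.2) + s)^-1 ].
Proof.
have [r1 [f1 [R1 F1 C1 P1]]] := polar k.1.1.
have [r2 [f2 [R2 F2 C2 P2]]] := polar k.1.2.
have [r3 [f3 [R3' F3 C3 P3]]] := polar k.2.
have /andP[a1 b1] := R1; have /andP[a2 b2] := R2; have /andP[a3 b3] := R3'.
pose m := (1 + gamma - r1) + (1 + gamma - r2) + (1 + gamma - r3).
have eE q : energy2 k gamma q = m + (r1 * (1 - cos (q.1.1 - f1)) +
    r2 * (1 - cos (q.1.2 - f2)) + r3 * (1 - cos (q.2 - f3))).
  transitivity (3 * (1 + gamma) - (cos q.1.1 + gamma * cos (k.1.1 - q.1.1)) -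
      (cos q.1.2 + gamma * cos (k.1.2 - q.1.2)) - (cos q.2 + gamma * cos (k.2 - q.2))).
    by rewrite /energy2 /dispersion /=; ring.
  by rewrite P1 P2 P3 /m; ring.
have c1 (x : R) : 0 <= 1 - cos x by rewrite subr_ge0 cos_le1.
have me q : m <= energy2 k gamma q.
  by rewrite eE lerDl !addr_ge0// mulr_ge0.
exists (r1, r2, r3), m; split => //=.
- move=> nc; rewrite /=.
  have [e1|n1] := eqVneq (cos k.1.1) 1; last by have := C1 n1; lra.
  have [e2|n2] := eqVneq (cos k.1.2) 1; last by have := C2 n2; lra.
  have [e3|n3] := eqVneq (cos k.2) 1; last by have := C3 n3; lra.
  by exfalso; apply: nc.
- by rewrite /m; lra.
move=> s s0.
have pr : preserves mu3 (rotation3 ((f1, f2, f3) : R3)) by exact: preserves_rotation3.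
have mE : measurable_fun setT (fun q => ((energy2 k gamma q - (m - s))^-1)%:E).
  apply/measurable_EFinP; apply: measurable_inv.
    by apply: measurable_funB => //; exact: measurable_energy2.
  by move=> q; have := me q; lra.
congr fine; rewrite -(preserves_ge0_integral pr mE); last first.
  by move=> q; rewrite lee_fin invr_ge0; have := me q; lra.
apply: eq_integral => q _; congr (_ ^-1)%:E.
rewrite eE /= !cos_rotation !addrK; ring.
Qed.

(** The integral increases in [z] from small values far below the spectrum to
    supercritical ones near the bottom. *)
Lemma bound_state_exists (k : R3) :
  ~ [/\ cos k.1.1 = 1, cos k.1.2 = 1 & cos k.2 = 1] ->
  exists2 z, z < energy2_min k gamma & g * \int[mu3]_q (energy2 k gamma q - z)^-1 = 1.
Proof.
move=> nc; have [r [m [[r1 r2 r3] rlt m0 me cv]]] := energy2_polar k.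
have [s /andP[s0 s1] gt1] := supercritical r1 r2 r3 (rlt nc).
rewrite -cv// in gt1.
have g0 := coupling_gt0 gamma_gt0.
have gM0 : 0 <= g * M by rewrite mulr_ge0 ?(ltW g0) ?(ltW torus_mass_gt0).
(* At distance more than [g * M] below [0] the integral is subcritical. *)
pose z0 := - (g * M + 1).
have z0m : z0 <= m - s by rewrite /z0; lra.
have mz z : measurable_fun setT (fun q => energy2 k gamma q - z).
  by apply: measurable_funB => //; exact: measurable_energy2.
pose f z := g * \int[mu3]_q (energy2 k gamma q - z)^-1.
have fz0 : f z0 <= 1.
  have p : 0 < g * M + 1 by rewrite ltr_wpDl.
  have -> : 1 = g * ((g * M + 1)^-1 * M) + (g * M + 1)^-1.
    by rewrite mulrCA -[X in _ + X]mulr1 -mulrDr mulVf// gt_eqF.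
  rewrite /f -[leLHS]addr0 lerD ?invr_ge0 ?(ltW p)// ler_pM2l//.
  rewrite -[M]/(fine (mu3 setT)) -Rintegral_cst//.
  apply: (@inv_integral_le _ _ _ mu3 (fun=> g * M + 1) _ (g * M + 1)) => // q.
    by rewrite /z0; have := energy2_ge0 gamma_gt0 k q; lra.
  by rewrite /z0; have := energy2_ge0 gamma_gt0 k q; lra.
have [z /andP[z1 z2] fz] : exists2 z, z0 <= z <= m - s & f z = 1.
  apply: (@lipschitz_IVT _ f z0 (m - s) (g * ((s ^+ 2)^-1 * M))) => //; last first.
    by rewrite ge_min fz0 le_max (ltW gt1) orbT.
  move=> x y /andP[x1 x2] /andP[y1 y2]; rewrite /f -mulrBr normrM gtr0_norm//.
  rewrite -[leRHS]mulrA ler_pM2l//.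
  have := @inv_integral_lipschitz _ _ _ mu3 _ _ s (mz x) (mz y) s0 _ _ `|x - y|.
  rewrite [_ / _ * _]mulrC [_ * (`|x - y| / _)]mulrCA [`|x - y| * _]mulrC [M * _]mulrC; apply.
  - by move=> q; have := me q; lra.
  - by move=> q; have := me q; lra.
  - by move=> q; rewrite opprB addrC subrKA distrC.
exists z => //; apply: le_lt_trans z2 _; apply: (@lt_le_trans _ _ m); first by lra.
exact: le_energy2_min.
Qed.

End BoundState.

(** * The essential spectrum *)

Section PairEnergy.
Variables (R : realType) (gamma : R).
Local Notation RR := (measurableTypeR R).
Local Notation R3 := (RR * RR * RR)%type.
Local Notation mu3 := (torus_measure R).
Local Notation M := (total_mass mu3).
Local Notation g := (coupling gamma / (2 * pi) ^+ 3).
Hypothesis gamma_gt0 : 0 < gamma.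

Let mE (k : R3) z : measurable_fun setT (fun q => energy2 k gamma q - z).
Proof. by apply: measurable_funB => //; exact: measurable_energy2. Qed.

Lemma pair_integral_lt (k : R3) (z z' : R) : z < z' -> z' < energy2_min k gamma ->
  g * \int[mu3]_q (energy2 k gamma q - z)^-1 <
  g * \int[mu3]_q (energy2 k gamma q - z')^-1.
Proof.
move=> zz' z'm; rewrite ltr_pM2l ?coupling_gt0// -subr_gt0.
have c0 : 0 < energy2_min k gamma - z' by rewrite subr_gt0.
have lo q := energy2_min_le gamma_gt0 k q.
have hi q := energy2_le gamma_gt0 k q.
have C0 : 0 < 6 + gamma * 6 - z by have := lo 0; have := hi 0; lra.
apply: lt_le_trans (@inv_integral_gap _ _ _ mu3 _ _ _ (mE k z') (mE k z) c0 _ _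
  (z' - z) (6 + gamma * 6 - z) _ _ _).
- by rewrite mulr_gt0 ?torus_mass_gt0// divr_gt0 ?exprn_gt0// subr_gt0.
- by move=> q; have := lo q; lra.
- by move=> q; have := lo q; lra.
- by rewrite subr_ge0 ltW.
- by move=> q; lra.
- by move=> q; have := hi q; lra.
Qed.

(** All that matters of [z2]: it separates the subcritical from the supercritical
    energies below the bottom of the continuum. *)
Variant z2_spec (k : R3) (z : R) : Prop := Z2Spec of
    (forall q, z <= energy2 k gamma q)
  & - (g * M) <= z
  & (forall w, w < z -> g * \int[mu3]_q (energy2 k gamma q - w)^-1 < 1)
  & (forall w, z < w -> w < energy2_min k gamma ->
      1 < g * \int[mu3]_q (energy2 k gamma q - w)^-1).

Let gM0 : 0 <= g * M.
Proof. by rewrite mulr_ge0 ?(ltW (coupling_gt0 _)) ?(ltW (torus_mass_gt0 _)). Qed.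

(** At [k = 0] the value [0] is the threshold itself, where the integral is
    still finite and equal to the critical value. *)
Let z2_spec_zero (k : R3) : in_2piZ k.1.1 -> in_2piZ k.1.2 -> in_2piZ k.2 ->
  z2_spec k 0.
Proof.
move=> [n1 e1] [n2 e2] [n3 e3].
have per (x : R) n : cos (2 * pi * n%:~R - x) = cos x.
  by rewrite addrC cosD2pin cosN.
have eE q : energy2 k gamma q = (1 + gamma) * dispersion q.
  by rewrite /energy2 /dispersion /= e1 e2 e3 !per; ring.
have sub0 w : w < 0 -> g * \int[mu3]_q (energy2 k gamma q - w)^-1 <= 1.
  move=> w0; rewrite -[leRHS](inv_dispersion_det gamma_gt0) ler_pM2l ?coupling_gt0//.
  have e0 q := energy2_ge0 gamma_gt0 k q.
  have iw : mu3.-integrable setT (EFin \o (fun q => (energy2 k gamma q - w)^-1)).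
    by apply: (@inv_integrable _ _ _ _ _ (- w)) => // [|q]; [lra|have := e0 q; lra].
  have iB := inv_dispersion_shift_integrable gamma.
  have g1 : 0 < 1 + gamma by rewrite addr_gt0.
  apply: fine_le; try exact: integrable_fin_num.
  apply: ae_ge0_le_integral => //.
  - by move=> q _; rewrite lee_fin invr_ge0; have := e0 q; lra.
  - exact: measurable_int iw.
  - by move=> q _; rewrite lee_fin invr_ge0 mulr_ge0 ?dispersion_ge0// ltW.
  - exact: measurable_int iB.
  apply: filterS (@ae_dispersion_gt0 R) => q q0 _.
  have B0 : 0 < (1 + gamma) * dispersion q by rewrite mulr_gt0.
  rewrite lee_fin eE lef_pV2 ?posrE//; lra.
split.
- exact: energy2_ge0.
- by rewrite oppr_le0.
- move=> w w0; apply: lt_le_trans (sub0 (w / 2) _); last by lra.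
  apply: pair_integral_lt; first by lra.
  apply: (@lt_le_trans _ _ 0); first by lra.
  by apply: le_energy2_min => q; exact: energy2_ge0.
- move=> w w0 wm; exfalso; have := energy2_min_le gamma_gt0 k 0.
  by rewrite eE /dispersion /= cos0; lra.
Qed.

Let z2_spec_bound_state (k : R3) (z : R) : z < energy2_min k gamma ->
  g * \int[mu3]_q (energy2 k gamma q - z)^-1 = 1 -> z2_spec k z.
Proof.
move=> zm det; split.
- by move=> q; apply: le_trans (energy2_min_le gamma_gt0 k q); exact: ltW.
- have [z0|z0] := leP 0 z; first by apply: le_trans z0; rewrite oppr_le0.
  have z0' : 0 < - z by rewrite oppr_gt0.
  have le : \int[mu3]_q (energy2 k gamma q - z)^-1 <= (- z)^-1 * M.
    rewrite -[M]/(fine (mu3 setT)) -Rintegral_cst//.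
    apply: (@inv_integral_le _ _ _ mu3 (fun=> - z) _ (- z)) => // q;
    by have := energy2_ge0 gamma_gt0 k q; lra.
  rewrite -(ler_pM2l (coupling_gt0 gamma_gt0)) det mulrCA ler_pdivlMl// mulr1 in le.
  by rewrite lerNl.
- by move=> w wz; rewrite -[ltRHS]det; exact: pair_integral_lt.
- by move=> w zw wm; rewrite -[ltLHS]det; exact: pair_integral_lt.
Qed.

Lemma z2P (k : R3) : z2_spec k (z2 gamma k).
Proof.
rewrite /z2; case: pselect => [[i1 i2 i3]|nz]; first exact: z2_spec_zero.
case: xgetP => [z _ [zm /(eigenvalue_h2 gamma_gt0 zm) det]|none].
  exact: z2_spec_bound_state.
exfalso; have [|z zm det] := bound_state_exists gamma_gt0 (k := k).
  by move=> [c1 c2 c3]; apply: nz; split; exact: cos1_in_2piZ.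
by apply: (none z); split => //; exact/(eigenvalue_h2 gamma_gt0 zm).
Qed.

End PairEnergy.

Section ThreeBody.
Variables (R : realType) (gamma : R).
Local Notation RR := (measurableTypeR R).
Local Notation R3 := (RR * RR * RR)%type.
Local Notation mu3 := (torus_measure R).
Local Notation M := (total_mass mu3).
Local Notation g := (coupling gamma / (2 * pi) ^+ 3).
Hypothesis gamma_gt0 : 0 < gamma.
Variable K : R3.
Hypothesis torusK : torus K.
Local Notation En := (energy3 K gamma).
Local Notation E := (antisym mu3).
Local Notation N := (ipnorm (@antisym_ip _ _ _ mu3)).
Local Notation Emin := (energy3_min gamma K).
Local Notation Emax := (energy3_max K gamma).

Let mEn : measurable_fun setT En. Proof. exact: measurable_energy3. Qed.
Let En_sym p q : En (q, p) = En (p, q). Proof. exact: energy3_sym. Qed.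
Let En_bnd x : `|En x| <= 12 + gamma * 6. Proof. exact: energy3_bounded. Qed.
Local Notation H := (antisym_ham g mEn En_sym En_bnd).
(** The factor in the channel equation at energy [w] is [1 - det p w]. *)
Let det p w := g * \int[mu3]_q (En (p, q) - w)^-1.

Let detE p w : det p w = g * \int[mu3]_q (energy2 (K - p) gamma q - (w - dispersion p))^-1.
Proof.
congr (_ * _); apply: eq_Rintegral => q _; rewrite energy3_energy2.
by congr (_ ^-1); ring.
Qed.

Let pair_min p w : w < Emin -> w - dispersion p < energy2_min (K - p) gamma.
Proof.
move=> wm; apply: (@lt_le_trans _ _ (Emin - dispersion p)); first by rewrite ltrD2r.
apply: le_energy2_min => q; rewrite lerBlDl -energy3_energy2.
exact: energy3_min_le.
Qed.

Lemma tau_le p : torus p -> tau K gamma <= z2 gamma (K - p) + dispersion p.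
Proof.
move=> tp; apply: ge_inf; last by exists p.
exists (- (g * M)) => _ [q _ <-]; have [_ h _ _] := z2P gamma_gt0 (K - q).
by rewrite -[leLHS]addr0 lerD ?dispersion_ge0.
Qed.

Lemma tau_lt w : tau K gamma < w ->
  exists2 p, torus p & z2 gamma (K - p) + dispersion p < w.
Proof.
move=> tw; have hi : has_inf [set z2 gamma (K - p) + dispersion p | p in @torus R].
  split; first by exists (z2 gamma (K - 0) + dispersion 0), 0; [exact: torus0|].
  exists (- (g * M)) => _ [q _ <-]; have [_ h _ _] := z2P gamma_gt0 (K - q).
  by rewrite -[leLHS]addr0 lerD ?dispersion_ge0.
have d0 : 0 < w - tau K gamma by rewrite subr_gt0.
have [_ [p tp <-] lt] := inf_adherent d0 hi.
exists p => //; apply: lt_le_trans lt _.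
by rewrite -[X in X + _]/(tau K gamma) addrC subrK.
Qed.

Lemma tau_le_min : tau K gamma <= Emin.
Proof.
apply: lb_le_inf.
  by exists (En (0, 0)), (0, 0) => //; split; exact: torus0.
move=> _ [[p q] [/= tp tq] <-]; apply: le_trans (tau_le tp) _.
have [h _ _ _] := z2P gamma_gt0 (K - p).
by rewrite energy3_energy2 addrC lerD2l.
Qed.

Let approx w := forall e, 0 < e -> exists f : E, N f != 0 /\ N (H f - w *: f) <= e * N f.

Lemma approx_closed w :
  (forall e, 0 < e -> exists2 w', `|w' - w| <= e & approx w') -> approx w.
Proof.
move=> cl e e0; have e2 : 0 < e / 2 by rewrite divr_gt0.
have [w' ww' /(_ _ e2)[f [f0 fe]]] := cl _ e2.
exists f; split => //.
have -> : H f - w *: f = (H f - w' *: f) + (w' - w) *: f.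
  by rewrite scalerBl addrA subrK.
have ipl := @antisym_ip_linear _ _ _ mu3.
have ips := @antisym_ip_sym _ _ _ mu3.
have ip0 := @antisym_ip_ge0 _ _ _ mu3.
apply: le_trans (ipnormD ipl ips ip0 _ _) _.
have -> : e * N f = e / 2 * N f + e / 2 * N f by rewrite -mulrDl -splitr.
rewrite lerD// (ipnormZ ipl ips) ?ler_wpM2r ?ipnorm_ge0//.
Qed.

Let seg (p p' : R3) t : R3 := (p.1.1 + t * (p'.1.1 - p.1.1), p.1.2 + t * (p'.1.2 - p.1.2),
  p.2 + t * (p'.2 - p.2)).

Let seg0 p p' : seg p p' 0 = p.
Proof. by rewrite /seg !mul0r !addr0; case: p => [[]]. Qed.

Let seg1 p p' : seg p p' 1 = p'.
Proof. by rewrite /seg !mul1r !(addrC _ (_ - _)) !subrK; case: p' => [[]]. Qed.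

Let seg_torus p p' t : torus p -> torus p' -> 0 <= t <= 1 -> torus (seg p p' t).
Proof.
move=> [[a1 a2] a3] [[b1 b2] b3] /andP[t0 t1].
have conv (x y : R) : circle x -> circle y -> circle (x + t * (y - x)).
  rewrite /circle /= !in_itv/= => /andP[x1 x2] /andP[y1 y2].
  have t1' : 0 <= 1 - t by rewrite subr_ge0.
  have [xy|yx] := leP x y.
    have xy' : 0 <= y - x by rewrite subr_ge0.
    have := mulr_ge0 t0 xy'; have := mulr_ge0 t1' xy'.
    by move=> h1 h2; apply/andP; split; lra.
  have xy' : 0 <= x - y by rewrite subr_ge0 ltW.
  have := mulr_ge0 t0 xy'; have := mulr_ge0 t1' xy'.
  by move=> h1 h2; apply/andP; split; lra.
by split; [split|]; exact: conv.
Qed.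

Let dist1 (p p' : R3) := `|p.1.1 - p'.1.1| + `|p.1.2 - p'.1.2| + `|p.2 - p'.2|.

Let seg_dist p p' s t : dist1 (seg p p' s) (seg p p' t) = `|s - t| * dist1 p' p.
Proof.
have d1 (x y : R) : `|x + s * (y - x) - (x + t * (y - x))| = `|s - t| * `|y - x|.
  by rewrite -normrM; congr `|_|; ring.
by rewrite /dist1 /= !d1 -!mulrDr.
Qed.

(** The pair integral is at most critical at [p = K], where the pair has
    quasi-momentum zero, and supercritical at some other point of the torus, so
    it is critical somewhere on the segment between them. *)
Lemma approx_channel w : tau K gamma < w -> w < Emin -> approx w.
Proof.
move=> tw wE.
have [p1 tp1 lt1] := tau_lt tw.
have c0 : 0 < Emin - w by rewrite subr_gt0.
have lo x : Emin - w <= En x - w by rewrite lerD2r energy3_min_le.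
have hi1 : 1 < det p1 w.
  rewrite detE; have [_ _ _ h] := z2P gamma_gt0 (K - p1); apply: h.
    by rewrite ltrBrDr.
  exact: pair_min.
have hi0 : det K w <= 1.
  rewrite detE; have [_ _ h _] := z2P gamma_gt0 (K - K); apply/ltW/h.
  have -> : z2 gamma (K - K) = 0.
    rewrite /z2; case: pselect => // -[]; split; exists 0; rewrite mulr0 /=;
    exact: subrr.
  rewrite subr_lt0; apply: (lt_le_trans wE).
  apply: le_trans (energy3_min_le gamma_gt0 K (K, 0)) _.
  rewrite /energy3 /dispersion /= !subrr cos0 !subrr; lra.
pose L := g * ((1 + gamma) * dist1 p1 K / (Emin - w) ^+ 2 * M).
have [t t01 dt] : exists2 t, 0 <= t <= 1 & det (seg K p1 t) w = 1.
  apply: (@lipschitz_IVT _ (fun t => det (seg K p1 t) w) 0 1 L) => //; last first.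
    by rewrite seg0 seg1 ge_min hi0 le_max (ltW hi1) orbT.
  move=> x y _ _; rewrite /det -mulrBr normrM gtr0_norm ?coupling_gt0//.
  rewrite /L -[leRHS]mulrA ler_pM2l ?coupling_gt0//.
  have me s : measurable_fun setT (fun q => En (seg K p1 s, q) - w).
    by apply: measurable_funB => //; exact: measurable_section mEn.
  apply: le_trans (@inv_integral_lipschitz _ _ _ mu3 _ _ (Emin - w) (me x) (me y) c0
     _ _ ((1 + gamma) * (`|x - y| * dist1 p1 K)) _) _ => //.
    move=> q; rewrite (_ : _ - w - _ = En (seg K p1 x, q) - En (seg K p1 y, q)); last by ring.
    apply: le_trans (energy3_lipschitz gamma_gt0 _ _ _ _) _.
    by rewrite ler_pM2l ?addr_gt0// -seg_dist.
  by rewrite le_eqVlt; apply/orP; left; apply/eqP; field; rewrite gt_eqF.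
have tt := seg_torus torusK tp1 t01.
by apply: (weyl_bound_state mEn En_sym En_bnd _ c0 lo dt); exact: energy3_localizable.
Qed.

(** The value [w] is taken by the energy on the segment from a point near the
    minimum to one near the maximum. *)
Lemma approx_continuum w : Emin < w -> w < Emax -> approx w.
Proof.
move=> w1 w2.
have d1 : 0 < w - Emin by rewrite subr_gt0.
have d2 : 0 < Emax - w by rewrite subr_gt0.
have [p0 [q0 [tp0 tq0 lt0]]] := energy3_near_min gamma_gt0 K d1.
have [p1 [q1 [tp1 tq1 lt1]]] := energy3_near_max gamma_gt0 K d2.
rewrite addrC subrK in lt0; rewrite opprB addrC subrK in lt1.
pose L := (1 + gamma) * (dist1 p1 p0 + dist1 q1 q0).
have [t t01 et] : exists2 t, 0 <= t <= 1 & En (seg p0 p1 t, seg q0 q1 t) = w.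
  apply: (@lipschitz_IVT _ (fun t => En (seg p0 p1 t, seg q0 q1 t)) 0 1 L) => //; last first.
    by rewrite !seg0 !seg1 ge_min (ltW lt0) le_max (ltW lt1) orbT.
  move=> x y _ _.
  have -> : En (seg p0 p1 x, seg q0 q1 x) - En (seg p0 p1 y, seg q0 q1 y) =
     (En (seg p0 p1 x, seg q0 q1 x) - En (seg p0 p1 y, seg q0 q1 x)) +
     (En (seg q0 q1 x, seg p0 p1 y) - En (seg q0 q1 y, seg p0 p1 y)).
    by rewrite [En (seg q0 q1 x, _)]En_sym [En (seg q0 q1 y, _)]En_sym; ring.
  apply: le_trans (ler_normD _ _) _.
  rewrite /L mulrDr mulrDl lerD// -mulrA [_ * `|x - y|]mulrC -seg_dist;
  exact: energy3_lipschitz.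
apply: weyl_threshold => e e0.
exists (seg p0 p1 t), (seg q0 q1 t); split.
- by apply: energy3_localizable => //; exact: seg_torus.
- by apply: energy3_localizable => //; exact: seg_torus.
- by rewrite et subrr normr0 ltW.
Qed.

(** The open intervals on both sides of the minimum of the energy are dense. *)
Lemma approx_interval w : tau K gamma <= w <= Emax -> approx w.
Proof.
move=> /andP[tw wE]; apply: approx_closed => e e0.
have mm := energy3_min_lt_max gamma_gt0 K.
have tm := tau_le_min.
have split3 d : 0 < d -> exists2 s, 0 < s <= d & s <= e.
  by move=> d0; exists (Num.min d e); rewrite ?lt_min ?d0 ?e0 ?ge_min ?lexx ?orbT.
have [wm|wm|wm] := ltgtP w Emin.
- have [|s /andP[s0 sd] se] := split3 ((Emin - w) / 2); first by lra.
  exists (w + s); first by rewrite addrC addKr gtr0_norm.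
  by apply: approx_channel; lra.
- have [|s /andP[s0 sd] se] := split3 ((w - Emin) / 2); first by lra.
  exists (w - s); first by rewrite addrC addKr normrN gtr0_norm.
  by apply: approx_continuum; lra.
- have [|s /andP[s0 sd] se] := split3 ((Emax - Emin) / 2); first by lra.
  exists (w + s); first by rewrite addrC addKr gtr0_norm.
  by apply: approx_continuum; lra.
Qed.

(** Between [w] and the intermediate energy [w'] the pair integral grows by an
    amount that does not depend on [p], and at [w'] it is still subcritical. *)
Lemma semi_fredholm_below w : w < tau K gamma ->
  semi_fredholm (@antisym_ip _ _ _ mu3) H w.
Proof.
move=> wt; have tm := tau_le_min.
pose w' := (w + tau K gamma) / 2.
have w1 : w < w' by rewrite /w'; lra.
have w2 : w' < tau K gamma by rewrite /w'; lra.
have wm' : 0 < Emin - w' by lra.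
have wm : 0 < Emin - w by lra.
pose C := 12 + gamma * 6 - w.
have hi x : En x - w <= C.
  by rewrite lerD2r; have := En_bnd x; rewrite ler_norml => /andP[].
have lo x : Emin <= En x by exact: energy3_min_le.
have C0 : 0 < C by have := hi 0; have := lo 0; lra.
pose dl := g * ((w' - w) / C ^+ 2 * M).
have dl0 : 0 < dl.
  apply: mulr_gt0; first exact: coupling_gt0.
  by rewrite mulr_gt0 ?torus_mass_gt0// divr_gt0 ?exprn_gt0// subr_gt0.
have ddP x : Emin - w <= En x - w by rewrite lerD2r.
apply: (faddeev_semi_fredholm mEn En_sym En_bnd (energy3_net gamma_gt0 K) wm ddP dl0) => p0.
have [p tp [dp dp']] := torus_representative p0.
have -> : \int[mu3]_q (En (p0, q) - w)^-1 = \int[mu3]_q (En (p, q) - w)^-1.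
  apply: eq_Rintegral => q _; rewrite /energy3 /= dp.
  by rewrite -(_ : dispersion (K - p - q) = dispersion (K - p0 - q))// (addrAC K) dp' (addrAC K).
have me s : measurable_fun setT (fun q => En (p, q) - s).
  by apply: measurable_funB => //; exact: measurable_section mEn.
have below : det p w' < 1.
  rewrite detE; have [_ _ h _] := z2P gamma_gt0 (K - p); apply: h.
  by rewrite ltrBlDr; apply: lt_le_trans w2 (tau_le tp).
have gap : dl <= det p w' - det p w.
  rewrite /dl /det -mulrBr ler_pM2l ?coupling_gt0//.
  apply: (@inv_integral_gap _ _ _ mu3 _ _ _ (me w') (me w) wm') => [q|q||q|q].
  - by rewrite lerD2r.
  - by have := lo (p, q); lra.
  - by rewrite subr_ge0 ltW.
  - by lra.
  - exact: hi.
rewrite -/(det p w); lra.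
Qed.


Let spec := spectrum (finite_product mu3 mu3) (cantisym mu3) (cham mu3 En g).

Lemma interval_spectrum w : tau K gamma <= w <= Emax -> spec (Complex w 0).
Proof.
by move=> wi; exact: approximate_spectrum (approx_interval wi).
Qed.

(** A point of a nondegenerate interval contained in the spectrum is not
    isolated. *)
Lemma interval_essential w : tau K gamma <= w <= Emax ->
  essential_spectrum_H3 gamma K (Complex w 0).
Proof.
move=> wi; split; first exact: interval_spectrum.
move=> [[_ [r r0 iso]] _ _]; have /andP[w1 w2] := wi.
have tE : tau K gamma < Emax := le_lt_trans tau_le_min (energy3_min_lt_max gamma_gt0 K).
have [w' [w'i w'N w'r]] :
    exists w', [/\ tau K gamma <= w' <= Emax, w' != w & `|w' - w| < r].
  have [wE|Ew] := ltP w Emax.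
    pose s := Num.min (Emax - w) (r / 2).
    have s0 : 0 < s by rewrite lt_min subr_gt0 wE divr_gt0.
    have [sE sr] : s <= Emax - w /\ s <= r / 2 by rewrite /s !ge_min !lexx orbT.
    exists (w + s); split; [apply/andP; split; lra|apply/eqP; lra|].
    by rewrite addrC addKr gtr0_norm//; lra.
  pose s := Num.min (w - tau K gamma) (r / 2).
  have s0 : 0 < s by rewrite lt_min subr_gt0 (lt_le_trans tE Ew) divr_gt0.
  have [sE sr] : s <= w - tau K gamma /\ s <= r / 2 by rewrite /s !ge_min !lexx orbT.
  exists (w - s); split; [apply/andP; split; lra|apply/eqP; lra|].
  by rewrite addrC addKr normrN gtr0_norm//; lra.
have := iso (Complex w' 0) (interval_spectrum w'i).
rewrite /= subr0 expr0n addr0 sqrtr_sqr => /(_ w'r)[].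
by apply/eqP.
Qed.

Lemma essential_interval z : essential_spectrum_H3 gamma K z ->
  exists2 w, tau K gamma <= w <= Emax & Complex w 0 = z.
Proof.
case: z => a b ess.
have [b0|bN0] := eqVneq b 0; last first.
  case: ess => sp _; exfalso; apply: sp.
  exact: (nonreal_resolvent mu3 g mEn En_sym En_bnd a bN0).
rewrite b0 in ess *; exists a => //; rewrite !leNgt; apply/andP; split; apply/negP => lt.
  have d0 : 0 < tau K gamma - a by rewrite subr_gt0.
  apply: (semi_fredholm_not_essential (mEn := mEn) (En_sym := En_sym)
    (En_bnd := En_bnd) d0 _ ess) => w wa.
  by apply: semi_fredholm_below; have := ler_norm (w - a); lra.
case: ess => sp _; apply: sp.
apply: (bounded_below_resolvent (mEn := mEn) (En_sym := En_sym) (En_bnd := En_bnd)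
  (C := (a - Emax)^-1)).
apply: bounded_below_above => //; first exact/ltW/coupling_gt0.
exact: energy3_le_max.
Qed.

End ThreeBody.

Theorem theorem4p4 (R : realType) (gamma : R) (K : R * R * R)
    (hgamma : 0 < gamma) (hK : torus K) :
  essential_spectrum_H3 gamma K =
  [set (x%:C)%C | x in `[tau K gamma, energy3_max K gamma]].
Proof.
apply/seteqP; split=> [z|_ [w /= wi <-]].
  move=> /(essential_interval hgamma)[w wi <-].
  by exists w => //=; rewrite in_itv.
by apply: interval_essential => //; move: wi; rewrite in_itv.
Qed.
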